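(* A closed ideal of a strongly maximal TAF algebra $\mathcal{A}$ is a completely meet irreducible ideal if and only if it is the kernel of an essential nest representation of $\mathcal{A}$.
   Context: Strongly maximal TAF algebra: for each $i\in\mathbb{N}$, let $\mathfrak{A}_i$ be a finite direct sum of full complex matrix algebras and $\mathcal{A}_i\subseteq\mathfrak{A}_i$ the corresponding direct sum of the upper triangular matrix subalgebras. Let $\varphi_i:\mathfrak{A}_i\to\mathfrak{A}_{i+1}$ be an injective $*$-homomorphism with $\varphi_i(\mathcal{A}_i)\subseteq\mathcal{A}_{i+1}$ (the embedding of $\mathcal{A}_i$ is $*$-extendable) which is regular, i.e. maps each matrix unit to a sum of matrix units. Then $\mathcal{A}=\varinjlim(\mathcal{A}_i,\varphi_i)$ is the norm closure of $\bigcup_i\mathcal{A}_i$ inside the AF C*-algebra $\mathfrak{A}=\varinjlim(\mathfrak{A}_i,\varphi_i)$. Nest representation: a representation is a bounded algebra homomorphism $\rho:\mathcal{A}\to B(\mathcal{H})$, $\mathcal{H}$ a Hilbert space; it is a nest representation if the lattice $\mathcal{N}=\operatorname{Lat}\rho(\mathcal{A})$ of closed $\rho(\mathcal{A})$-invariant subspaces is linearly ordered, i.e. a nest. $0_+$ is the minimal non-zero element of $\mathcal{N}$ (with $0_+=0$ if none exists); $I_-$ is the largest element of $\mathcal{N}$ different from $I$, i.e. from $\mathcal{H}$ (with $I_-=I$ if none exists). Essential nest representation: a nest representation $\rho:\mathcal{A}\to\operatorname{Alg}\mathcal{N}$ is essential if (i) $\dim 0_+=\dim I_-^{\perp}=1$,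 and (ii) the rank one operator from $I_-^{\perp}$ into $0_+$ (i.e. $x\mapsto\langle x,h\rangle g$ with $0_+=[g]$, $I_-^\perp=[h]$) belongs to $\rho(\mathcal{A})$. Ideals of Banach algebras are closed and two-sided. An ideal $\mathcal{J}$ of $\mathcal{A}$ is completely meet irreducible if, for any collection of ideals $\mathcal{J}_a$ containing $\mathcal{J}$, $\mathcal{J}=\bigcap_a\mathcal{J}_a$ implies $\mathcal{J}=\mathcal{J}_a$ for some $a$; equivalently, $\mathcal{J}$ has a unique successor $\mathcal{J}^+$ in the ideal lattice (an ideal $\mathcal{J}^+\supsetneq\mathcal{J}$ contained in every ideal properly containing $\mathcal{J}$; in particular $\mathcal{J}\neq\mathcal{A}$). *)

(* Defs.v *)
From HB Require Import structures.
From mathcomp Require Export all_boot all_order all_algebra.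
From mathcomp Require Export all_classical all_reals all_analysis.
From mathcomp.real_closed Require Export complex.

Set Implicit Arguments.
Unset Strict Implicit.
Unset Printing Implicit Defensive.

Export numFieldNormedType.Exports.
Import Order.TTheory GRing.Theory Num.Theory.

Local Open Scope ring_scope.
Local Open Scope classical_set_scope.
Local Open Scope complex_scope.

(* No unit is required: the connecting maps of an AF system need not be unital.
   The norm of a complex normed module is valued in [R[i]], where [x <= y] means
   that [y - x] is a nonnegative real. *)
HB.mixin Record isCStarAlgebra (R : realType) (B : Type)
    of CompleteNormedModule R[i] B := {
  cmul : B -> B -> B;
  cstar : B -> B;
  cmulA : associative cmul;
  cmul_linearl : forall y, linear (fun x => cmul x y);
  cmul_linearr : forall x, linear (cmul x);
  cmul_norm : forall x y, `|cmul x y| <= `|x| * `|y|;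
  cstarK : involutive cstar;
  cstar_antilinear : forall (c : R[i]) x y,
    cstar (c *: x + y) = Num.conj c *: cstar x + cstar y;
  cstarM : forall x y, cstar (cmul x y) = cmul (cstar y) (cstar x);
  cstar_norm : forall x, `|cmul (cstar x) x| = `|x| ^+ 2
}.

#[short(type="cstarAlgType")]
HB.structure Definition CStarAlgebra (R : realType) :=
  {B of CompleteNormedModule R[i] B & isCStarAlgebra R B}.

(* The inner product is linear in its first argument. *)
HB.mixin Record isHilbert (R : realType) (H : Type)
    of CompleteNormedModule R[i] H := {
  hdot : {dot H for (@Num.conj R[i])};
  hdot_norm : forall x : H, `|x| ^+ 2 = hdot x x
}.

#[short(type="hilbertType")]
HB.structure Definition Hilbert (R : realType) :=
  {H of CompleteNormedModule R[i] H & isHilbert R H}.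

Section MatrixSum.
Variables (R : realType) (k : nat) (n : 'I_k -> nat).

Definition msum : Type := forall j : 'I_k, 'M[R[i]]_(n j).

HB.instance Definition _ := gen_eqMixin msum.
HB.instance Definition _ := gen_choiceMixin msum.

Let add (x y : msum) : msum := fun j => x j + y j.
Let opp (x : msum) : msum := fun j => - x j.
Let zero : msum := fun=> 0.

Fact msum_addA : associative add.
Proof. by move=> x y z; apply: functional_extensionality_dep => j; exact: addrA. Qed.
Fact msum_addC : commutative add.
Proof. by move=> x y; apply: functional_extensionality_dep => j; exact: addrC. Qed.
Fact msum_add0 : left_id zero add.
Proof. by move=> x; apply: functional_extensionality_dep => j; exact: add0r. Qed.
Fact msum_addN : left_inverse zero opp add.
Proof. by move=> x; apply: functional_extensionality_dep => j; exact: addNr. Qed.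

HB.instance Definition _ :=
  GRing.isZmodule.Build msum msum_addA msum_addC msum_add0 msum_addN.

Let scale (c : R[i]) (x : msum) : msum := fun j => c *: x j.

Fact msum_scaleA c d x : scale c (scale d x) = scale (c * d) x.
Proof. by apply: functional_extensionality_dep => j; exact: scalerA. Qed.
Fact msum_scale1 : left_id 1 scale.
Proof. by move=> x; apply: functional_extensionality_dep => j; exact: scale1r. Qed.
Fact msum_scaleDr : right_distributive scale +%R.
Proof. by move=> c x y; apply: functional_extensionality_dep => j; exact: scalerDr. Qed.
Fact msum_scaleDl x : {morph scale^~ x : c d / c + d}.
Proof. by move=> c d; apply: functional_extensionality_dep => j; exact: scalerDl. Qed.

HB.instance Definition _ := GRing.Zmodule_isLmodule.Build R[i] msum
  msum_scaleA msum_scale1 msum_scaleDr msum_scaleDl.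

Definition msum_mul (x y : msum) : msum := fun j => x j *m y j.
Definition msum_star (x : msum) : msum := fun j => map_mx Num.conj (x j)^T.

Definition upper_triangular : set msum :=
  [set x | forall j (p q : 'I_(n j)), (q < p)%N -> x j p q = 0].

Definition unit_index : finType := {j : 'I_k & ('I_(n j) * 'I_(n j))%type}.

Definition matrix_unit (u : unit_index) : msum :=
  @dfwith _ (fun j => 'M[R[i]]_(n j)) (fun=> 0) (tag u)
    (delta_mx (tagged u).1 (tagged u).2).

End MatrixSum.

Record taf_system (R : realType) := TafSystem {
  summands : nat -> nat;
  msize : forall i, 'I_(summands i) -> nat;
  msize_gt0 : forall i j, (0 < msize (i := i) j)%N;
  phi : forall i, msum R (msize (i := i)) -> msum R (msize (i := i.+1));
  phi_linear : forall i, linear (phi (i := i));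
  phi_mul : forall i, {morph phi (i := i) : x y / msum_mul x y};
  phi_star : forall i, {morph phi (i := i) : x / msum_star x};
  phi_inj : forall i, injective (phi (i := i));
  phi_upper : forall i x,
    upper_triangular x -> upper_triangular (phi (i := i) x);
  phi_regular : forall i (u : unit_index (msize (i := i))),
    exists V : {set unit_index (msize (i := i.+1))},
      phi (matrix_unit R u) = \sum_(v in V) matrix_unit R v
}.

Definition level (R : realType) (S : taf_system R) (i : nat) :=
  msum R (msize (t := S) (i := i)).

(* [B], with the canonical maps [iota i], is the C*-inductive limit of the full
   matrix levels. Injective *-homomorphisms between C*-algebras are isometric,
   so these conditions determine [B] up to *-isomorphism over the system. *)
Record is_AF_limit (R : realType) (S : taf_system R) (B : cstarAlgType R)
    (iota : forall i, level S i -> B) : Prop := {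
  iota_linear : forall i, linear (iota i);
  iota_mul : forall i, {morph iota i : x y / msum_mul x y >-> cmul x y};
  iota_star : forall i, {morph iota i : x / msum_star x >-> cstar x};
  iota_inj : forall i, injective (iota i);
  iota_phi : forall i x, iota i.+1 (phi x) = iota i x;
  iota_dense : closure (\bigcup_i range (iota i)) = setT
}.

Definition strongly_maximal_TAF (R : realType) (B : cstarAlgType R)
    (A : set B) : Prop :=
  exists (S : taf_system R) (iota : forall i, level S i -> B),
    is_AF_limit iota /\
    A = closure (\bigcup_i (iota i @` @upper_triangular R _ _)).

Definition subspace (K : numDomainType) (V : lmodType K) (M : set V) : Prop :=
  M 0 /\ forall (c : K) x y, M x -> M y -> M (c *: x + y).

Section Ideals.
Variables (R : realType) (B : cstarAlgType R) (A : set B).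

Definition is_ideal (J : set B) : Prop :=
  [/\ J `<=` A, subspace J, closed J &
      forall a x, A a -> J x -> J (cmul a x) /\ J (cmul x a)].

(* The empty collection of ideals has intersection [A], so [J] is proper. *)
Definition completely_meet_irreducible (J : set B) : Prop :=
  is_ideal J /\
  forall F : set (set B), (forall I, F I -> is_ideal I /\ J `<=` I) ->
    J = A `&` \bigcap_(I in F) I -> F J.

End Ideals.

Section NestRepresentations.
Variables (R : realType) (B : cstarAlgType R) (A : set B) (H : hilbertType R).

(* The values of [rho] outside [A] are irrelevant. *)
Record is_representation (rho : B -> {linear H -> H}) : Prop := {
  rep_linear : forall (c : R[i]) a b x, A a -> A b ->
    rho (c *: a + b) x = c *: rho a x + rho b x;
  rep_mul : forall a b x, A a -> A b -> rho (cmul a b) x = rho a (rho b x);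
  rep_bounded : exists M : R[i], forall a x, A a ->
    `|rho a x| <= M * `|a| * `|x|
}.

Definition rep_kernel (rho : B -> {linear H -> H}) : set B :=
  [set a | A a /\ forall x, rho a x = 0].

Definition Lat (rho : B -> {linear H -> H}) : set (set H) :=
  [set M | [/\ subspace M, closed M &
               forall a x, A a -> M x -> M (rho a x)]].

Definition linearly_ordered (N : set (set H)) : Prop :=
  forall L M, N L -> N M -> L `<=` M \/ M `<=` L.

Definition nest_representation (rho : B -> {linear H -> H}) : Prop :=
  is_representation rho /\ linearly_ordered (Lat rho).

(* [0_+] and [I_-]; [xget] returns its first argument if no such element
   exists. *)
Definition zero_plus (N : set (set H)) : set H :=
  xget [set 0] [set M | [/\ N M, M <> [set 0] &
    forall L, N L -> L <> [set 0] -> M `<=` L]].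

Definition I_minus (N : set (set H)) : set H :=
  xget setT [set M | [/\ N M, M <> setT &
    forall L, N L -> L <> setT -> L `<=` M]].

Definition orthogonal_complement (M : set H) : set H :=
  [set y | forall x, M x -> hdot x y = 0].

Definition line (g : H) : set H := range (fun c : R[i] => c *: g).

Definition one_dimensional (M : set H) : Prop :=
  exists2 g, g != 0 & M = line g.

Definition essential_nest_representation (rho : B -> {linear H -> H}) : Prop :=
  [/\ nest_representation rho,
      one_dimensional (zero_plus (Lat rho)),
      one_dimensional (orthogonal_complement (I_minus (Lat rho))) &
      exists g h : H,
        [/\ zero_plus (Lat rho) = line g,
            orthogonal_complement (I_minus (Lat rho)) = line h &
            exists2 a, A a & forall x, rho a x = hdot x h *: g]].

End NestRepresentations.

(* Main.v *)
Require Import Defs.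
From HB Require Import structures.
From mathcomp Require Import ring lra finmap.

Set Implicit Arguments.
Unset Strict Implicit.
Unset Printing Implicit Defensive.

Import Order.TTheory GRing.Theory Num.Theory.
Local Open Scope ring_scope.
Local Open Scope classical_set_scope.
Local Open Scope complex_scope.

(** Closed ideals of [A] are governed by the matrix units of the levels.  A unit
    at distance at most 1/4 from a closed ideal lies in it ([unit_in_ideal]), and
    a closed ideal contains another one as soon as it contains its matrix units
    ([ideal_units]).  Both rest on a norm bound for block sums, [nm_blocks].

    Kernels of essential representations are completely meet irreducible
    ([essential_kernel_cmi]).  Let [rho a] be the rank one operator from the line
    of [h] to the line of [g].  It suffices that [a] belongs to every ideal [I]
    strictly above the kernel ([rank_one_in_ideal]), since [a] is not in the
    kernel.  Diagonal matrix units act by 0 or 1 on [g] and on the functional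
    [hdot _ h]; on every high level some diagonal unit [p] fixes [g] and some [q]
    fixes the functional.  The units [q] decrease with the level, and a
    compactness argument in the Hilbert space yields one vector [k] fixed by all
    of them.  As [I] is not contained in the kernel, maximality of [I_-] and
    minimality of [0_+] produce [c] in [I] with [rho c k] close to [g].  On a high
    level the compressions of [a] and of [c] by [p] and [q] are nearly multiples
    of the same matrix unit, the multiple for [c] being bounded away from zero.
    Hence [a] is close to a multiple of the compression of [c] plus the element
    [a - p a q] of the kernel, that is, to [I].

    Conversely let [J] be completely meet irreducible.  Its successor contains a
    matrix unit outside [J].  Following summands outside [J] from level to level
    gives a tower of matrix units [E (x i) (y i)], each one a summand of the
    preceding one; every ideal strictly above [J] contains them all.  The rows
    between [x i] and [y i] embed into those of the next level; let [T] be their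
    direct limit, a totally ordered set with least element [x] and greatest
    element [y].  Compressing the matrices to these rows is multiplicative on
    upper triangular matrices, because the rows form an interval, and gives in
    the limit a representation of [A] on the square summable families over [T].
    Its invariant subspaces are the closed spans of initial segments of [T], so they
    form a nest with extreme lines spanned by the basis vectors at [x] and [y].
    The entries of the elements of [J] are small by [unit_in_ideal], so [J] is
    contained in the kernel, and they are equal because the kernel does not
    contain [E (x 0) (y 0)].  Finally [E (x 0) (y 0)] acts as the required rank
    one operator: by [corner_only] it has no other summand between the rows of
    the tower.  Indeed such a summand would lie in the ideal generated by [J] and
    a later unit of the tower; then each entry of that unit on a high level would
    dominate another one strictly inside it, an infinite ascent in a finite
    matrix. *)

Local Notation "x ∘ y" := (cmul x y) (at level 40, left associativity).

(** * Norms as real numbers *)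

Section RealNorm.
Variables (R : realType).

(** The norm of a complex normed module takes values in [R[i]]; its real part
    can be handled by the arithmetic of ordered fields. *)
Definition nm (V : normedZmodType R[i]) (x : V) : R := complex.Re `|x|.

Lemma nmE (V : normedZmodType R[i]) (x : V) : `|x| = (nm x)%:C.
Proof.
rewrite /nm; move: (normr_ge0 x); case: `|x| => a b.
by rewrite lecE /= => /andP[/eqP-> _].
Qed.

Lemma gt0_realE (e : R[i]) : 0 < e -> exists2 d : R, 0 < d & e = d%:C.
Proof.
case: e => a b; rewrite ltcE /= => /andP[/eqP-> a0].
by exists a.
Qed.

Section Zmod.
Variable V : normedZmodType R[i].
Implicit Types x y z : V.

Lemma nm_ge0 x : 0 <= nm x.
Proof. by have := normr_ge0 x; rewrite nmE lecR. Qed.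

Lemma nm0 : nm (0 : V) = 0.
Proof. by rewrite /nm normr0. Qed.

Lemma nm_eq0 x : nm x = 0 -> x = 0.
Proof. by move=> h; apply/eqP; rewrite -normr_eq0 nmE h. Qed.

Lemma nm_small x : (forall e : R, 0 < e -> nm x <= e) -> x = 0.
Proof.
move=> h; apply: nm_eq0; apply/eqP; rewrite eq_le nm_ge0 andbT.
by apply/ler_addgt0Pr => e /h; rewrite add0r.
Qed.

Lemma nm_gt0 x : x != 0 -> 0 < nm x.
Proof.
move=> x0; rewrite lt_neqAle nm_ge0 andbT eq_sym; apply/eqP => /nm_eq0 h.
by rewrite h eqxx in x0.
Qed.

Lemma nmD x y : nm (x + y) <= nm x + nm y.
Proof. by have := ler_normD x y; rewrite !nmE -rmorphD lecR. Qed.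

Lemma nmN x : nm (- x) = nm x.
Proof. by rewrite /nm normrN. Qed.

Lemma nmB x y : nm (x - y) = nm (y - x).
Proof. by rewrite /nm distrC. Qed.

Lemma nm_tri z x y : nm (x - y) <= nm (x - z) + nm (z - y).
Proof. by apply: le_trans (nmD _ _); rewrite addrA subrK. Qed.

Lemma nm_lebD x y : nm x <= nm y + nm (x - y).
Proof. by apply: le_trans (nmD _ _); rewrite addrC subrK. Qed.

Lemma nm_sum (I : Type) (r : seq I) (P : pred I) (f : I -> V) :
  nm (\sum_(i <- r | P i) f i) <= \sum_(i <- r | P i) nm (f i).
Proof.
elim/big_ind2 : _ => [|x a y b hx hy|//]; first by rewrite nm0.
exact: le_trans (nmD _ _) (lerD hx hy).
Qed.

End Zmod.

Lemma nmM (c d : R[i]) : nm (c * d) = nm c * nm d.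
Proof. by apply: complexI; rewrite rmorphM /= -!nmE normrM. Qed.

Lemma nm_real (a : R) : nm a%:C = `|a|.
Proof. by rewrite /nm normc_def /= expr0n addr0 sqrtr_sqr. Qed.

Lemma nm1 : nm (1 : R[i]) = 1.
Proof. by rewrite /nm normr1. Qed.

Lemma nm_nat n : nm (n%:R : R[i]) = n%:R.
Proof. by rewrite -(rmorph_nat (real_complex R)) nm_real ger0_norm. Qed.

Lemma nmV (c : R[i]) : nm c^-1 = (nm c)^-1.
Proof. by apply: complexI; rewrite fmorphV /= -!nmE normfV. Qed.

Lemma nm_conj (c : R[i]) : nm (Num.conj c) = nm c.
Proof. by rewrite /nm norm_conjC. Qed.

Lemma mulc_conj (c : R[i]) : c * Num.conj c = (nm c ^+ 2)%:C.
Proof. by rewrite -normCK nmE rmorphXn. Qed.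

Lemma nmZ (V : normedModType R[i]) (c : R[i]) (x : V) :
  nm (c *: x) = nm c * nm x.
Proof. by apply: complexI; rewrite rmorphM /= -!nmE normrZ. Qed.

Section Limits.
Variable V : normedModType R[i].
Implicit Types x y z : V.

Lemma cvg_nmP (T : Type) (F : set_system T) (FF : Filter F) (u : T -> V) l :
  u @ F --> l <-> forall e : R, 0 < e -> \forall n \near F, nm (l - u n) < e.
Proof.
split => [/cvgrPdist_lt h e e0|h].
  have e0' : 0 < e%:C :> R[i] by rewrite ltcR.
  by move: (h _ e0'); apply: filterS => n; rewrite nmE ltcR.
apply/cvgrPdist_lt => _ /gt0_realE[e e0 ->].
by move: (h _ e0); apply: filterS => n; rewrite nmE ltcR.
Qed.

Lemma cvg_seqP (u : nat -> V) l :
  u @ \oo --> l <->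
  forall e : R, 0 < e -> exists N, forall n, (N <= n)%N -> nm (u n - l) < e.
Proof.
split=> [/cvg_nmP h e /h [N _ hN]|h].
  by exists N => n /hN /=; rewrite nmB.
apply/cvg_nmP => e /h[N hN]; exists N => // n /= /hN; by rewrite nmB.
Qed.

Lemma closure_nmP (S : set V) x :
  closure S x <-> forall e : R, 0 < e -> exists2 y, S y & nm (x - y) < e.
Proof.
split => [h e e0|h U].
  have e0' : 0 < e%:C :> R[i] by rewrite ltcR.
  have /h [y [Sy]] := nbhsx_ballx x e%:C e0'.
  by rewrite -ball_normE /= nmE ltcR => ?; exists y.
move=> /nbhs_ballP[_ /= /gt0_realE[e e0 ->]].
have [y Sy xy] := h _ e0 => sub; exists y; split => //; apply: sub.
by rewrite -ball_normE /= nmE ltcR.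
Qed.

Lemma closed_nm (S : set V) : closed S -> forall x,
  (forall e : R, 0 < e -> exists2 y, S y & nm (x - y) < e) -> S x.
Proof. by move=> cS x h; apply: cS; apply/closure_nmP. Qed.

Lemma nm_closed (S : set V) :
  (forall x, (forall e : R, 0 < e -> exists2 y, S y & nm (x - y) < e) -> S x) ->
  closed S.
Proof. by move=> h x /closure_nmP; exact: h. Qed.

End Limits.

Lemma cauchy_seq_cvg (V : completeNormedModType R[i]) (u : nat -> V) :
  (forall e : R, 0 < e -> exists N, forall m n,
     (N <= m)%N -> (N <= n)%N -> nm (u m - u n) < e) ->
  exists l : V, u @ \oo --> l.
Proof.
move=> h.
have cu : cauchy (u @ \oo); last by exists (lim (u @ \oo)); exact: (@cauchy_cvg V (u @ \oo) _ cu).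
apply: cauchy_exP => _ /gt0_realE[e e0 ->].
have [N hN] := h _ e0.
exists (u N); exists N => // n /= Nn.
by rewrite -ball_normE /= nmE ltcR; apply: hN.
Qed.

Lemma subspace_closure (V : normedModType R[i]) (S : set V) :
  subspace S -> subspace (closure S).
Proof.
move=> [S0 SD]; split; first exact: subset_closure.
move=> c x y /closure_nmP hx /closure_nmP hy; apply/closure_nmP => e e0.
have n1 : 0 < nm c + 1 by have := nm_ge0 c; lra.
have [x' Sx' xx'] := hx (e / 2 / (nm c + 1)) ltac:(by rewrite !divr_gt0).
have [y' Sy' yy'] := hy (e / 2) ltac:(by rewrite divr_gt0).
exists (c *: x' + y'); first exact: SD.
rewrite opprD addrACA -scalerBr; apply: le_lt_trans (nmD _ _) _.
rewrite [e]splitr; apply: ler_ltD => //.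
rewrite nmZ; move: xx'; rewrite ltr_pdivlMr // => xx'.
by have := nm_ge0 (x - x'); nra.
Qed.

End RealNorm.

(** * Nearest points in Hilbert spaces *)

Section PreHilbert.
Variables (C : numClosedFieldType) (U : lmodType C).
Variable (form : {dot U for (@Num.conj C)}).
Implicit Types u v : U.

Lemma dot_CauchySchwarz u v :
  `|form u v| ^+ 2 <= form u u * form v v.
Proof.
have [->|v0] := eqVneq v 0; first by rewrite [form u 0]linear0r [form 0 0]linear0r normr0 expr0n mulr0.
have vv : form v v != 0 by rewrite dnorm_eq0.
pose a := form u v / form v v; pose w := u - a *: v.
have wv : form w v = 0 by rewrite linearBl /= linearZl_LR /= divfK ?subrr.
have -> : u = w + a *: v by rewrite subrK.
have wav : form w (a *: v) = 0 by rewrite linearZr_LR /= wv mulr0.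
rewrite hnormDd // linearDl /= wv add0r linearZl_LR /= normrM exprMn dnormZ.
rewrite (ger0_norm (dnorm_ge0 _ _)) mulrDl [form v v ^+ 2]expr2 mulrA.
by rewrite lerDr mulr_ge0 // dnorm_ge0.
Qed.

Lemma dot_triangle u v :
  sqrtC (form (u + v) (u + v)) <= sqrtC (form u u) + sqrtC (form v v).
Proof.
rewrite -ler_sqr ?nnegrE ?addr_ge0 ?sqrtC_ge0 ?dnorm_ge0 //.
rewrite sqrrD !sqrtCK addrAC dnormD lerD2l.
have le : `|form u v| <= sqrtC (form u u) * sqrtC (form v v).
  rewrite -ler_sqr ?nnegrE ?mulr_ge0 ?sqrtC_ge0 ?dnorm_ge0 //.
  by rewrite exprMn !sqrtCK dot_CauchySchwarz.
have -> : form u v + (form u v)^* = 'Re (form u v) *+ 2.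
  by rewrite ReE -mulr_natr divfK ?pnatr_eq0.
by rewrite lerMn2r /=; apply: le_trans le; rewrite (leif_Re_Creal (form u v)).
Qed.

End PreHilbert.

Section HilbertGeometry.
Variables (R : realType) (H : hilbertType R).
Implicit Types x y v : H.

Lemma nm_sqr x : (nm x ^+ 2)%:C = hdot x x.
Proof. by rewrite -hdot_norm nmE rmorphXn. Qed.

Lemma hdotC x y : hdot x y = Num.conj (hdot y x).
Proof. by have := hermC (@hdot R H) x y; rewrite expr0 mul1r. Qed.

Lemma parallelogram x y :
  nm (x + y) ^+ 2 + nm (x - y) ^+ 2 = 2 * (nm x ^+ 2 + nm y ^+ 2).
Proof.
apply: complexI; rewrite [LHS]rmorphD [RHS]rmorphM [X in _ = _ * X]rmorphD /= !nm_sqr.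
rewrite linearDl linearBl /= !linearDr !linearNr /= rmorphMn /=.
by rewrite mulr_natl; ring.
Qed.

Lemma hdot_bound x y : nm (hdot x y) <= nm x * nm y.
Proof.
have := dot_CauchySchwarz (@hdot R H) x y.
rewrite -!nm_sqr nmE -rmorphXn -rmorphM /= lecR -exprMn.
by rewrite ler_pXn2r // ?nnegrE ?mulr_ge0 ?nm_ge0.
Qed.

(** Bounded closed convex sets of a Hilbert space are weakly compact; for nested
    sequences this reduces to the parallelogram law, which makes points of almost
    minimal norm a Cauchy sequence. *)
Lemma nested_convex (C : nat -> set H) (M : R) :
  (forall n, closed (C n)) ->
  (forall n x y, C n x -> C n y -> C n (2^-1 *: (x + y))) ->
  (forall m n, (m <= n)%N -> C n `<=` C m) ->
  (forall n, exists2 x, C n x & nm x <= M) ->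
  exists x, forall n, C n x.
Proof.
move=> clC midC decC neC.
pose N n := [set nm x | x in C n].
have infN n : has_inf (N n).
  split; first by have [x Cx _] := neC n; exists (nm x); exists x.
  by exists 0 => _ [x _ <-]; exact: nm_ge0.
pose d n : R := inf (N n).
have d_le n x : C n x -> d n <= nm x.
  by move=> Cx; apply: ge_inf; [case: (infN n)|exists x].
have d0 n : 0 <= d n.
  by apply: lb_le_inf; [case: (infN n)|move=> _ [x _ <-]; exact: nm_ge0].
have dM n : d n <= M by have [x Cx] := neC n; exact/le_trans/d_le.
have M0 : 0 <= M by exact: le_trans (d0 0) (dM 0).
have dec m n : (m <= n)%N -> d m <= d n.
  move=> mn; apply: lb_le_inf; first by case: (infN n).
  by move=> _ [x Cx <-]; apply: d_le; apply: decC mn _ Cx.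
have ex n : {x | C n x /\ nm x < d n + n.+1%:R^-1}.
  apply: cid; have [_ [x Cx <-] lt] := @inf_adherent R (N n) n.+1%:R^-1 ltac:(by rewrite invr_gt0) (infN n).
  by exists x.
pose x n := sval (ex n).
have xC n : C n (x n) by rewrite /x; case: (ex n) => ? [].
have xd n : nm (x n) < d n + n.+1%:R^-1 by rewrite /x; case: (ex n) => ? [].
have cvd : cvgn d.
  apply: nondecreasing_is_cvgn; first by move=> m n; exact: dec.
  by exists M => _ [n _ <-].
pose dl : R := limn d.
have d_lel n : d n <= dl.
  by apply: nondecreasing_cvgn_le => // m n'; exact: dec.
(* The parallelogram law controls the distance of two almost minimal points. *)
have key m n : (m <= n)%N ->
    nm (x m - x n) ^+ 2 <=
      2 * ((d m + m.+1%:R^-1) ^+ 2 + (dl + m.+1%:R^-1) ^+ 2) - 4 * d m ^+ 2.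
  move=> mn.
  have mid : d m <= nm (2^-1 *: (x m + x n)).
    by apply: d_le; apply: midC => //; apply: decC mn _ (xC n).
  have par := parallelogram (x m) (x n).
  rewrite nmZ nmV nm_nat in mid.
  have h1 : nm (x m) ^+ 2 <= (d m + m.+1%:R^-1) ^+ 2.
    by rewrite ler_pXn2r // ?nnegrE ?nm_ge0 ?ltW ?addr_ge0 //; first exact: le_lt_trans (nm_ge0 _) (xd m).
  have h2 : nm (x n) ^+ 2 <= (dl + m.+1%:R^-1) ^+ 2.
    have le : nm (x n) <= dl + m.+1%:R^-1.
      apply: (le_trans (ltW (xd n))); apply: lerD => //.
      by rewrite lef_pV2 ?posrE // ler_nat.
    by rewrite ler_pXn2r // nnegrE ?nm_ge0 // (le_trans (nm_ge0 _) le).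
  have h3 : 4 * d m ^+ 2 <= nm (x m + x n) ^+ 2.
    have := d0 m; have := nm_ge0 (x m + x n); nra.
  by move: (m.+1%:R^-1 : R) h1 h2 => ? h1 h2; lra.
have small (e : R) : 0 < e -> exists m, forall n, (m <= n)%N ->
    2 * ((d n + n.+1%:R^-1) ^+ 2 + (dl + n.+1%:R^-1) ^+ 2) - 4 * d n ^+ 2 < e ^+ 2.
  move=> e0.
  have dl0 : 0 <= dl by exact: le_trans (d0 0) (d_lel _).
  have K0 : 0 < e ^+ 2 / (8 * dl + 4 + 8 * dl).
    by rewrite divr_gt0 // ?exprn_gt0 //; lra.
  have [N1 _ hN1] : \forall n \near \oo, `|dl - d n| < e ^+ 2 / (8 * dl + 4 + 8 * dl).
    by move/cvgrPdist_lt: cvd; apply.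
  have [N2 _ hN2] : \forall n \near \oo, n.+1%:R^-1 < e ^+ 2 / (8 * dl + 4 + 8 * dl).
    exact: near_infty_natSinv_lt (PosNum K0).
  exists (maxn N1 N2) => n; rewrite geq_max => /andP[/hN1 /= k1 /hN2 /= k2].
  have s0 : 0 <= n.+1%:R^-1 :> R by rewrite invr_ge0.
  have s1 : n.+1%:R^-1 <= 1 :> R by rewrite invf_le1 // ler1n.
  move: k1; rewrite ger0_norm ?subr_ge0 // => k1.
  move: k1 k2 s0 s1 (d0 n) (d_lel n).
  move: (n.+1%:R^-1 : R) (d n) => s t.
  have D0 : 0 < 8 * dl + 4 + 8 * dl by lra.
  rewrite !ltr_pdivlMr // => k1 k2 s0 s1 t0 tl.
  move: (e ^+ 2) k1 k2 => E k1 k2; nra.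
have [l xl] : exists l : H, x @ \oo --> l.
  apply: cauchy_seq_cvg => e e0; have [m hm] := small e e0.
  have wl p q : (m <= p)%N -> (p <= q)%N -> nm (x p - x q) < e.
    move=> mp pq; rewrite -(ltr_pXn2r (n := 2)) // ?nnegrE ?nm_ge0 ?ltW //.
    exact: le_lt_trans (key _ _ pq) (hm _ mp).
  exists m => p q mp mq; have [pq|/ltnW qp] := leqP p q; first exact: wl.
  by rewrite nmB; exact: wl.
exists l => n; apply: (closed_nm (clC n)) => e e0.
have [k hk] := (cvg_seqP _ _).1 xl e e0.
exists (x (maxn n k)); first by apply: decC (leq_maxl _ _) _ (xC _).
by rewrite nmB; apply: hk; exact: leq_maxr.
Qed.

Lemma scale2N1_add (x : H) : 2^-1 *: (x + x) = x.
Proof. by rewrite -[x in x + x]scale1r -scalerDl scalerA mulVf ?scale1r ?pnatr_eq0. Qed.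

(** The nearest point of [K] comes from the nested sets of those [v - k], [k] in
    [K], whose norm is at most [1/(n+1)] above the distance of [v] to [K]. *)
Lemma projection (K : set H) (v : H) : subspace K -> closed K ->
  exists2 k, K k & forall x, K x -> hdot x (v - k) = 0.
Proof.
move=> [K0 KD] clK.
have KDD x y : K x -> K y -> K (x + y).
  by move=> Kx Ky; rewrite -[x]scale1r; exact: KD.
have KZ c x : K x -> K (c *: x) by move=> Kx; rewrite -[_ *: _]addr0; exact: KD.
have KB x y : K x -> K y -> K (x - y).
  by move=> Kx Ky; apply: KDD => //; rewrite -scaleN1r; exact: KZ.
pose N := [set nm (v - x) | x in K].
have infN : has_inf N.
  by split; [exists (nm (v - 0)); exists 0|exists 0 => _ [x _ <-]; exact: nm_ge0].
pose d : R := inf N.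
have d_le x : K x -> d <= nm (v - x).
  by move=> Kx; apply: ge_inf; [case: infN|exists x].
have d0 : 0 <= d.
  by apply: lb_le_inf; [case: infN|move=> _ [x _ <-]; exact: nm_ge0].
pose C n := [set w : H | K (v - w) /\ nm w <= d + n.+1%:R^-1].
have [w wC] : exists w : H, forall n, C n w.
  apply: (@nested_convex C (d + 1)).
  - move=> n; apply: nm_closed => x hx; split.
      apply: (closed_nm clK) => e /hx[y [Ky _] xy]; exists (v - y) => //.
      by rewrite opprB addrC addrA subrK nmB.
    rewrite leNgt; apply/negP => lt; have /hx[y [_ ny] xy] : 0 < nm x - (d + n.+1%:R^-1).
      by rewrite subr_gt0.
    by move: (n.+1%:R^-1 : R) lt ny xy (nm_lebD x y) => ? ? ? ?; lra.
  - move=> n x y [Kx nx] [Ky ny]; split.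
      have -> : v - 2^-1 *: (x + y) = 2^-1 *: ((v - x) + (v - y)).
        by rewrite [in RHS]addrACA [RHS]scalerDr scale2N1_add -opprD scalerN.
      by apply: KZ; exact: KDD.
    by rewrite nmZ nmV nm_nat; move: (n.+1%:R^-1 : R) nx ny (nmD x y) => ? ? ?; lra.
  - move=> m n mn x [Kx nx]; split=> //; apply: (le_trans nx); rewrite lerD2l.
    by rewrite lef_pV2 ?posrE // ler_nat.
  - move=> n; have [_ [x Kx <-] lt] := @inf_adherent R N n.+1%:R^-1 ltac:(by rewrite invr_gt0) infN.
    exists (v - x); first by split; [rewrite opprB addrC subrK|exact: ltW].
    apply: (le_trans (ltW lt)); rewrite lerD2l.
    by rewrite invf_le1 // ler1n.
have wd : nm w <= d.
  apply/ler_addgt0Pr => e e0.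
  have [k _ hk] := near_infty_natSinv_lt (PosNum e0).
  by move: (k.+1%:R^-1 : R) (wC k).2 (hk k (leqnn _)) => ? ? /= ?; lra.
exists (v - w); first exact: (wC 0).1.
move=> x Kx; rewrite opprB addrC subrK.
apply/eqP/negPn/negP => xw0.
have x0 : x != 0 by apply: contraNneq xw0 => ->; rewrite linear0l.
(* Subtracting from [w] its component along [x] would shorten it. *)
pose a := hdot w x / hdot x x.
have xx0 : hdot x x != 0 by rewrite dnorm_eq0.
have ox : hdot (w - a *: x) x = 0.
  by rewrite linearBl /= linearZl_LR /= divfK ?subrr.
have pyth : nm w ^+ 2 = nm (w - a *: x) ^+ 2 + nm (a *: x) ^+ 2.
  apply: complexI; rewrite [RHS]rmorphD /= !nm_sqr -[in LHS](subrK (a *: x) w).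
  by rewrite hnormDd // linearZr_LR /= ox mulr0.
have le : d <= nm (w - a *: x).
  rewrite -[w - _](subKr v); apply: d_le.
  rewrite opprB addrA addrAC; apply: KDD; first exact: (wC 0).1.
  exact: KZ.
have a0 : a != 0.
  rewrite mulf_neq0 ?invr_eq0 //; apply: contraNneq xw0 => h.
  by rewrite hdotC h conjC0.
have ax : 0 < nm (a *: x) by apply: nm_gt0; rewrite scaler_eq0 negb_or a0.
by have := nm_ge0 w; nra.
Qed.

Lemma codim1_perp (K : set H) (h : H) : subspace K -> closed K ->
  orthogonal_complement K = line h -> forall v, hdot v h = 0 -> K v.
Proof.
move=> sK cK Kh v vh; have [k Kk ok] := projection v sK cK.
have : orthogonal_complement K (v - k) by move=> x /ok.
rewrite Kh => -[c _ ch].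
have hk : hdot k h = 0.
  have : orthogonal_complement K h by rewrite Kh; exists 1; rewrite ?scale1r.
  by move/(_ _ Kk).
suff : v - k = 0 by move/subr0_eq ->.
apply/eqP; rewrite -(dnorm_eq0 (@hdot R H)) -{2}ch linearZr_LR /=.
by rewrite linearBl /= vh hk subrr mulr0.
Qed.

End HilbertGeometry.

(** * The Hilbert space of square summable families *)

Section FiniteSubsets.
Variable T : choiceType.

(** The filter of the finite subsets ordered by inclusion: sums over [T] are
    limits along it. *)
Definition fsets : set_system {fset T} :=
  filter_from setT (fun s0 => [set s | (s0 `<=` s)%fset]).

Global Instance fsets_filter : ProperFilter fsets.
Proof.
apply: filter_from_proper => [|s _]; last by exists s => /=; exact: fsubset_refl.
apply: filter_from_filter; first by exists fset0.
move=> s s' _ _; exists (s `|` s')%fset => // u /= h; split.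
  exact: fsubset_trans (fsubsetUl _ _) h.
exact: fsubset_trans (fsubsetUr _ _) h.
Qed.

End FiniteSubsets.
Arguments fsets : clear implicits.

Section SquareSummable.
Variables (R : realType) (T : choiceType).
Implicit Types (f g h : T -> R[i]^o) (s : {fset T}).

Definition nsq s f : R := \sum_(t <- s) nm (f t) ^+ 2.

Lemma nsq_ge0 s f : 0 <= nsq s f.
Proof. by apply: sumr_ge0 => t _; rewrite exprn_ge0 ?nm_ge0. Qed.

Lemma nsq_le s s' f : (s `<=` s')%fset -> nsq s f <= nsq s' f.
Proof.
move=> ss'; pose F t := if t \in s then nm (f t) ^+ 2 else 0.
have -> : nsq s f = \sum_(t <- s) F t.
  by rewrite /nsq big_seq [RHS]big_seq; apply: eq_bigr => t ts; rewrite /F ts.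
rewrite (big_fset_incl _ ss') => [|t _ /negPf]; last by rewrite /F => ->.
by apply: ler_sum => t _; rewrite /F; case: ifP => // _; rewrite exprn_ge0 ?nm_ge0.
Qed.

Definition square_summable f := exists M : R, forall s, nsq s f <= M.

Lemma nmD_sqr (V : normedZmodType R[i]) (x y : V) :
  nm (x + y) ^+ 2 <= 2 * nm x ^+ 2 + 2 * nm y ^+ 2.
Proof.
have le : nm (x + y) ^+ 2 <= (nm x + nm y) ^+ 2.
  by rewrite ler_pXn2r ?nnegrE ?addr_ge0 ?nm_ge0 ?nmD.
have : 0 <= (nm x - nm y) ^+ 2 by exact: sqr_ge0.
move: le; move: (nm x) (nm y) (nm _ ^+ 2) => a b c; rewrite sqrrD sqrrB; lra.
Qed.

Lemma nsqD s f g : nsq s (f + g) <= 2 * nsq s f + 2 * nsq s g.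
Proof.
rewrite /nsq !mulr_sumr -big_split /=; apply: ler_sum => t _.
exact: nmD_sqr.
Qed.

Lemma nsqZ s c f : nsq s (c *: f) = nm c ^+ 2 * nsq s f.
Proof.
rewrite /nsq mulr_sumr; apply: eq_bigr => t _.
by rewrite -exprMn -nmM.
Qed.

Definition l2_pred : {pred T -> R[i]^o} :=
  fun f => `[< square_summable f >].

Lemma l2_predP f : reflect (square_summable f) (f \in l2_pred).
Proof. exact: asboolP. Qed.

Fact l2_submod : submod_closed l2_pred.
Proof.
split.
  apply/l2_predP; exists 0 => s; rewrite /nsq big1 // => t _.
  by rewrite nm0 expr0n.
move=> c f g /l2_predP[M hM] /l2_predP[N hN]; apply/l2_predP.
exists (2 * (nm c ^+ 2 * M) + 2 * N) => s; apply: (le_trans (nsqD _ _ _)).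
rewrite nsqZ; apply: lerD; rewrite ler_pM2l //.
by apply: ler_wpM2l; rewrite ?exprn_ge0 ?nm_ge0.
Qed.

HB.instance Definition _ :=
  GRing.isSubmodClosed.Build _ (T -> R[i]^o) l2_pred l2_submod.

Record l2 := L2 { l2_fun :> T -> R[i]^o; _ : l2_fun \in l2_pred }.

HB.instance Definition _ := [isSub for l2_fun].
HB.instance Definition _ := [Choice of l2 by <:].
HB.instance Definition _ := [SubChoice_isSubLmodule of l2 by <:].

Implicit Types (u v w : l2).

Lemma l2P u : square_summable u.
Proof. by case: u => f /= /l2_predP. Qed.

Lemma l2_ext u v : (forall t, u t = v t) -> u = v.
Proof. by move=> h; apply: val_inj; apply/funext. Qed.

Lemma l2D u v t : (u + v) t = u t + v t. Proof. by []. Qed.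
Lemma l2Z c u t : (c *: u) t = c * u t. Proof. by []. Qed.
Lemma l2N u t : (- u) t = - u t. Proof. by []. Qed.
Lemma l20 t : (0 : l2) t = 0. Proof. by []. Qed.

Lemma nsq_cvg u : exists2 l : R, forall s, nsq s u <= l &
  (fun s => (nsq s u)%:C : R[i]^o) @ fsets T --> (l%:C : R[i]^o).
Proof.
have [M hM] := l2P u.
pose S := [set nsq s u | s in setT].
have supS : has_sup S by split; [exists (nsq fset0 u); exists fset0|exists M => _ [s _ <-]].
exists (sup S) => [s|]; first by apply: sup_upper_bound => //; exists s.
apply/cvg_nmP => e e0.
have [_ [s0 _ <-] lt] := sup_adherent e0 supS.
exists s0 => // s /= ss0.
rewrite -rmorphB /= nm_real ger0_norm.
  by have := nsq_le u ss0; lra.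
by rewrite subr_ge0; apply: sup_upper_bound => //; exists s.
Qed.

Definition pdot s f g : R[i]^o := \sum_(t <- s) f t * Num.conj (g t).

(** Reduces the convergence of inner products to that of the increasing sums of
    squares. *)
Lemma polarization (a b : R[i]) :
  a * Num.conj b = 4^-1 * ((nm (a + b) ^+ 2)%:C - (nm (a - b) ^+ 2)%:C
    + 'i * (nm (a + 'i * b) ^+ 2)%:C - 'i * (nm (a - 'i * b) ^+ 2)%:C).
Proof.
rewrite -!mulc_conj !(rmorphD, rmorphB, rmorphM, rmorphN) /= !conjCi.
set a' := Num.conj a; set b' := Num.conj b.
have ii : 'i * 'i = -1 :> R[i] by rewrite -expr2 sqrCi.
have -> : 'i * ((a + 'i * b) * (a' + - 'i * b')) =
   'i * (a * a') - ('i * 'i) * a * b' + ('i * 'i) * b * a' - 'i * ('i * 'i) * (b * b') by ring.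
have -> : 'i * ((a - 'i * b) * (a' - - 'i * b')) =
   'i * (a * a') + ('i * 'i) * a * b' - ('i * 'i) * b * a' - 'i * ('i * 'i) * (b * b') by ring.
by rewrite ii; field.
Qed.

Lemma cvg_scal (k : R[i]) (F : {fset T} -> R[i]^o) (a : R[i]^o) :
  F @ fsets T --> a -> (fun s => k * F s : R[i]^o) @ fsets T --> (k * a : R[i]^o).
Proof. by move=> h; exact: (@cvgZl_tmp _ R[i]^o _ (fsets T) _ k F a h). Qed.

Lemma cvg_add (F G : {fset T} -> R[i]^o) (a b : R[i]^o) :
  F @ fsets T --> a -> G @ fsets T --> b ->
  (fun s => F s + G s : R[i]^o) @ fsets T --> (a + b : R[i]^o).
Proof. by move=> h h'; exact: (@cvgD _ R[i]^o _ (fsets T) _ F G a b h h'). Qed.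

Lemma cvg_sub (F G : {fset T} -> R[i]^o) (a b : R[i]^o) :
  F @ fsets T --> a -> G @ fsets T --> b ->
  (fun s => F s - G s : R[i]^o) @ fsets T --> (a - b : R[i]^o).
Proof. by move=> h h'; exact: (@cvgB _ R[i]^o _ (fsets T) _ F G a b h h'). Qed.

Lemma pdot_cvg u v : exists l : R[i]^o, (fun s => pdot s u v) @ fsets T --> l.
Proof.
have [l1 _ c1] := nsq_cvg (u + v).
have [l2 _ c2] := nsq_cvg (u - v).
have [l3 _ c3] := nsq_cvg (u + 'i *: v).
have [l4 _ c4] := nsq_cvg (u - 'i *: v).
exists (4^-1 * (l1%:C - l2%:C + 'i * l3%:C - 'i * l4%:C)).
rewrite (_ : (fun s => _) = fun s => 4^-1 * ((nsq s (u + v))%:C - (nsq s (u - v))%:C +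
  'i * (nsq s (u + 'i *: v))%:C - 'i * (nsq s (u - 'i *: v))%:C)).
  apply: cvg_scal; apply: cvg_sub; last exact: cvg_scal.
  by apply: cvg_add; [exact: cvg_sub|exact: cvg_scal].
apply/funext => s; rewrite /nsq /pdot !rmorph_sum /= !mulr_sumr -!sumrN -!big_split /= mulr_sumr.
by apply: eq_bigr => t _; exact: polarization.
Qed.

Definition dot u v : R[i] := sval (cid (pdot_cvg u v)).

Lemma dot_cvg u v : (fun s => pdot s u v) @ fsets T --> (dot u v : R[i]^o).
Proof. by rewrite /dot; case: cid. Qed.

Lemma dot_unique u v (l : R[i]^o) :
  (fun s => pdot s u v) @ fsets T --> l -> dot u v = l.
Proof. by move=> h; exact: (cvg_unique _ (@dot_cvg u v) h). Qed.

Lemma dotC u v : dot u v = Num.conj (dot v u).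
Proof.
apply: dot_unique; apply/cvg_nmP => e e0.
move/cvg_nmP: (@dot_cvg v u) => /(_ e e0); apply: filterS => s.
rewrite -(nm_conj (dot v u - _)) rmorphB /= rmorph_sum /=.
congr (nm (_ - _) < e); apply: eq_bigr => t _.
by rewrite rmorphM /= conjCK mulrC.
Qed.

Lemma dot_linearl w : linear_for *%R (dot^~ w).
Proof.
move=> c u v; apply: dot_unique.
rewrite (_ : (fun s => _) = fun s => c * pdot s u w + pdot s v w).
  by apply: cvg_add; [apply: cvg_scal|]; exact: dot_cvg.
apply/funext => s; rewrite /pdot mulr_sumr -big_split /=.
by apply: eq_bigr => t _; rewrite mulrDl mulrA.
Qed.

Lemma dot_linearr u : linear_for (Num.conj \; *%R) (dot u).
Proof.
by move=> c v w; rewrite dotC dot_linearl rmorphD rmorphM /= -!dotC.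
Qed.

Lemma dot_self u : exists2 l : R, dot u u = l%:C & forall s, nsq s u <= l.
Proof.
have [l hl cl] := nsq_cvg u; exists l => //; apply: dot_unique.
rewrite (_ : (fun s => _) = fun s => (nsq s u)%:C) //; apply/funext => s.
by rewrite /pdot /nsq rmorph_sum /=; apply: eq_bigr => t _; rewrite mulc_conj.
Qed.

HB.instance Definition _ := @bilinear_isBilinear.Build R[i] l2 l2 R[i]
  *%R (Num.conj \; *%R) dot (conj dot_linearl dot_linearr).

HB.instance Definition _ := @isHermitianSesquilinear.Build R[i] l2 false
  Num.conj dot (fun u v => esym (etrans (mul1r _) (esym (dotC u v)))).

Fact dot_gt0 u : u != 0 -> 0 < dot u u.
Proof.
move=> u0; have [l -> hl] := dot_self u; rewrite ltcR.
have [t ut] : exists t, u t != 0.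
  apply/not_existsP => h; move/eqP: u0; apply; apply: l2_ext => t.
  by apply/eqP/negPn/negP/h.
apply: lt_le_trans (hl [fset t]%fset).
by rewrite /nsq big_seq_fset1 exprn_gt0 // nm_gt0.
Qed.

HB.instance Definition _ := isDotProduct.Build R[i] l2 dot dot_gt0.

Definition l2_dot : {dot l2 for (@Num.conj R[i])} := dot.

Definition l2_norm u : R[i] := sqrtC (dot u u).

Fact l2_normD u v : l2_norm (u + v) <= l2_norm u + l2_norm v.
Proof. exact: (dot_triangle l2_dot). Qed.

Fact l2_normZ (c : R[i]) u : l2_norm (c *: u) = `|c| * l2_norm u.
Proof.
rewrite /l2_norm (dnormZ l2_dot c u) sqrtCM ?nnegrE ?exprn_ge0 //.
by rewrite sqrCK.
Qed.

Fact l2_norm0 u : l2_norm u = 0 -> u = 0.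
Proof. by move/eqP; rewrite (sqrt_dnorm_eq0 l2_dot) => /eqP. Qed.

HB.instance Definition _ := @Lmodule_isNormed.Build R[i] l2 l2_norm
  l2_normD l2_normZ l2_norm0.

Lemma l2_normE u : `|u| = sqrtC (dot u u). Proof. by []. Qed.

Lemma dot_nm u : dot u u = (nm u ^+ 2)%:C.
Proof. by rewrite rmorphXn /= -nmE l2_normE sqrtCK. Qed.

Fact l2_hdot_norm u : `|u| ^+ 2 = l2_dot u u.
Proof. by rewrite l2_normE sqrtCK. Qed.

Lemma nsq_nm s u : nsq s u <= nm u ^+ 2.
Proof.
by have [l e h] := dot_self u; apply: (le_trans (h s)); rewrite -lecR -e dot_nm.
Qed.

Lemma nm_coord u t : nm (u t) <= nm u.
Proof.
have := nsq_nm [fset t]%fset u.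
by rewrite /nsq big_seq_fset1 ler_pXn2r // nnegrE nm_ge0.
Qed.

Lemma nsq_cvg_nm u :
  (fun s => (nsq s u)%:C : R[i]^o) @ fsets T --> ((nm u ^+ 2)%:C : R[i]^o).
Proof.
rewrite -dot_nm (_ : (fun s => _) = fun s => pdot s u u); first exact: dot_cvg.
apply/funext => s; rewrite /pdot /nsq rmorph_sum /=.
by apply: eq_bigr => t _; rewrite mulc_conj.
Qed.

Lemma nm_l2_le u (M : R) : 0 <= M -> (forall s, nsq s u <= M ^+ 2) -> nm u <= M.
Proof.
move=> M0 h; rewrite -(ler_pXn2r (n := 2)) ?nnegrE ?nm_ge0 //.
rewrite leNgt; apply/negP => lt.
have lt' : 0 < nm u ^+ 2 - M ^+ 2 by rewrite subr_gt0.
move/cvg_nmP: (@nsq_cvg_nm u) => /(_ _ lt')[s0 _ /(_ s0 (fsubset_refl _))] /=.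
rewrite -rmorphB /= nm_real; have := h s0; have := ler_norm (nm u ^+ 2 - nsq s0 u); lra.
Qed.

Lemma nm_l2_adherent u (e : R) : 0 < e ->
  exists s0, forall s, (s0 `<=` s)%fset -> nm u ^+ 2 - nsq s u < e.
Proof.
move=> e0; move/cvg_nmP: (@nsq_cvg_nm u) => /(_ _ e0)[s0 _ hs]; exists s0 => s /hs /=.
by rewrite -rmorphB /= nm_real; apply: le_lt_trans; exact: ler_norm.
Qed.

Lemma nm_ReIm (z : R[i]) : nm z <= `|complex.Re z| + `|complex.Im z|.
Proof.
case: z => a b; rewrite /nm normc_def /=.
rewrite -[leRHS]ger0_norm ?addr_ge0 // -sqrtr_sqr ler_wsqrtr //.
rewrite sqrrD !real_normK ?num_real // lerD2r lerDl.
by rewrite mulrn_wge0 // mulr_ge0.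
Qed.

Lemma l2_complete (F : set_system l2) : ProperFilter F -> cauchy F -> cvg F.
Proof.
move=> FF /cauchyP cF.
have ball_nm u (e : R) v : ball u e%:C v -> nm (u - v) < e.
  by rewrite -ball_normE /= nmE ltcR.
(* The completeness of [R] applies to the real and imaginary parts. *)
have coord (t : T) : exists c : R[i], forall e : R, 0 < e ->
    \forall u \near F, nm (c - (u : l2) t) < e.
  have part (p : R[i] -> R) : (forall a b, `|p a - p b| <= nm (a - b)) ->
      cvg (p ((u : l2) t) @[u --> F]).
    move=> hp; apply: R_complete; apply: cauchy_exP => e e0.
    have [u Fu] := cF e%:C ltac:(by rewrite ltcR).
    exists (p (u t)); change (F [set v : l2 | `|p (u t) - p (v t)| < e]).
    apply: filterS Fu => v /ball_nm uv; apply: (le_lt_trans (hp _ _)).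
    exact: le_lt_trans (nm_coord (u - v) t) uv.
  have reP : forall a b : R[i], `|complex.Re a - complex.Re b| <= nm (a - b).
    move=> a b; have := normc_ge_Re (a - b); rewrite nmE lecR raddfB //.
  have imP : forall a b : R[i], `|complex.Im a - complex.Im b| <= nm (a - b).
    move=> a b; rewrite -raddfB; case: (a - b) => x y /=.
    by rewrite /nm normc_def /= -sqrtr_sqr ler_wsqrtr // lerDr sqr_ge0.
  pose cr : R := lim (complex.Re ((u : l2) t) @[u --> F]).
  pose ci : R := lim (complex.Im ((u : l2) t) @[u --> F]).
  exists (cr +i* ci) => e e0.
  have e2 : 0 < e / 2 by rewrite divr_gt0.
  have /cvgrPdist_lt/(_ _ e2) := part _ reP.
  have /cvgrPdist_lt/(_ _ e2) := part _ imP.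
  apply: filterS2 => u hi hr.
  apply: le_lt_trans (nm_ReIm _) _; rewrite raddfB raddfB /=.
  by rewrite [e]splitr; exact: ltrD.
pose g (t : T) : R[i]^o := sval (cid (coord t)).
have gP t (e : R) : 0 < e -> \forall u \near F, nm (g t - (u : l2) t) < e.
  by rewrite /g; case: cid => c hc /=; exact: hc.
have near_g (e : R) u : 0 < e -> F (ball u e%:C) -> forall s,
    nsq s ((u : T -> R[i]^o) - g) <= (2 * e) ^+ 2.
  move=> e0 Fu s.
  have n1 : 0 < #|` s|%:R + 1 :> R by rewrite ltr_wpDl.
  pose d := e / (#|` s|%:R + 1).
  have d0 : 0 < d by rewrite divr_gt0.
  have near_s : F [set v : l2 | forall t, t \in s -> nm (g t - v t) < d].
    have h := @filter_bigI _ _ s (fun t => [set v : l2 | nm (g t - v t) < d]) F _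
      (fun t _ => gP t d d0).
    apply: (filterS _ (h _)) => v /= hv t ts; exact: hv.
  have [v [/ball_nm uv vs]] := @filter_ex _ F _ _ (filterI Fu near_s).
  have -> : ((u : T -> R[i]^o) - g) = ((u - v : l2) : T -> R[i]^o) + ((v : T -> R[i]^o) - g).
    by apply/funext => t; rewrite !fctE /= subrKA.
  apply: (le_trans (nsqD _ _ _)).
  have h1 : nsq s (u - v) <= e ^+ 2.
    apply: (le_trans (nsq_nm s (u - v))).
    by rewrite ler_pXn2r ?nnegrE ?nm_ge0 // ltW.
  have h2 : nsq s ((v : T -> R[i]^o) - g) <= e ^+ 2.
    apply: (@le_trans _ _ (\sum_(t <- s) d ^+ 2)).
      rewrite /nsq big_seq [leRHS]big_seq; apply: ler_sum => t ts.
      by rewrite ler_pXn2r ?nnegrE ?nm_ge0 ?(ltW d0) // nmB ltW // vs.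
    rewrite big_const_seq count_predT iter_addr_0 -mulr_natr.
    rewrite /d expr_div_n mulrAC ler_pdivrMr ?exprn_gt0 // ler_pM2l ?exprn_gt0 //.
    have := ler0n R #|` s|; rewrite cardfE /= -?cardfE; nra.
  by rewrite exprMn; lra.
have Gsq : square_summable g.
  have [u Fu] := cF 1%:C ltac:(by rewrite ltcR).
  exists (2 * nm u ^+ 2 + 2 * (2 * 1) ^+ 2) => s.
  have -> : g = (u : T -> R[i]^o) - ((u : T -> R[i]^o) - g).
    by apply/funext => t; rewrite !fctE /= subKr.
  apply: (le_trans (nsqD _ _ _)); apply: lerD; rewrite ler_pM2l //; first exact: nsq_nm.
  by rewrite -scaleN1r nsqZ nmN nm1 expr1n mul1r; exact: near_g Fu s.
pose G := L2 (introT (l2_predP g) Gsq).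
apply/cvg_ex; exists G; apply/cvg_nmP => e e0.
have e4 : 0 < e / 4 by rewrite divr_gt0.
have [u Fu] := cF (e / 4)%:C ltac:(by rewrite ltcR).
have uG : nm (G - u) <= 2 * (e / 4).
  rewrite nmB; apply: nm_l2_le; first by rewrite mulr_ge0 // ltW.
  by move=> s; exact: near_g Fu s.
apply: filterS Fu => v /ball_nm uv.
by apply: (le_lt_trans (nm_tri u _ _)); lra.
Qed.

HB.instance Definition _ := Uniform_isComplete.Build l2 l2_complete.
HB.instance Definition _ := isHilbert.Build R l2 l2_hdot_norm.

Definition fin_fun s (c : T -> R[i]) : T -> R[i]^o :=
  fun t => if t \in s then c t else 0.

Lemma nsq_fin s c s' : nsq s' (fin_fun s c) <= nsq s c.
Proof.
apply: (le_trans (nsq_le _ (fsubsetUr s s'))).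
rewrite /nsq -(big_fset_incl _ (fsubsetUl s s')).
  rewrite big_seq [leRHS]big_seq le_eqVlt; apply/orP; left; apply/eqP.
  by apply: eq_bigr => t ts; rewrite /fin_fun ts.
by move=> t _ /negPf ts; rewrite /fin_fun ts nm0 expr0n.
Qed.

Fact fin_fun_l2 s c : fin_fun s c \in l2_pred.
Proof. by apply/l2_predP; exists (nsq s c) => s'; exact: nsq_fin. Qed.

Definition fin_l2 s c : l2 := L2 (fin_fun_l2 s c).
Definition delta t : l2 := fin_l2 [fset t]%fset (fun=> 1).

Lemma fin_l2E s c t : fin_l2 s c t = if t \in s then c t else 0.
Proof. by []. Qed.

Lemma deltaE t t' : delta t t' = (t' == t)%:R.
Proof. by rewrite fin_l2E inE; case: eqP. Qed.

Lemma delta_neq0 t : delta t != 0.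
Proof.
apply/negP => /eqP/(congr1 (fun u : l2 => u t)); rewrite deltaE eqxx l20.
by move/eqP; rewrite oner_eq0.
Qed.

Lemma nm_fin s c : nm (fin_l2 s c) ^+ 2 <= nsq s c.
Proof.
have h : nm (fin_l2 s c) <= Num.sqrt (nsq s c).
  by apply: nm_l2_le => // s'; rewrite sqr_sqrtr ?nsq_ge0 //; exact: nsq_fin.
by rewrite -[leRHS]sqr_sqrtr ?nsq_ge0 // ler_pXn2r ?nnegrE ?nm_ge0 ?sqrtr_ge0.
Qed.

Lemma fin_l2_sum s c : fin_l2 s c = \sum_(t <- s) c t *: delta t.
Proof.
have coordM (I : Type) (r : seq I) (F : I -> l2) t :
    (\sum_(i <- r) F i : l2) t = \sum_(i <- r) F i t.
  by elim/big_rec2 : _ => [|i x y _ <-].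
have coordZ t' t : (c t' *: delta t') t = c t' * (t == t')%:R by rewrite -deltaE.
apply: l2_ext => t; rewrite coordM fin_l2E.
case: ifPn => ts.
  rewrite (big_fsetD1 t) // coordZ eqxx mulr1 big_seq big1 => [|t']; first by rewrite /= addr0.
  by rewrite !inE => /andP[/negPf tt' _]; rewrite coordZ eq_sym tt' mulr0.
rewrite big_seq big1 // => t' t's; rewrite coordZ.
by case: eqP t's ts => [->|_ _ _]; rewrite ?mulr0 // => ->.
Qed.

Lemma fin_cvg u (e : R) : 0 < e ->
  exists s0, forall s, (s0 `<=` s)%fset -> nm (u - fin_l2 s u) < e.
Proof.
move=> e0; have e2 : 0 < (e / 2) ^+ 2 by rewrite exprn_gt0 ?divr_gt0.
have [s0 hs0] := nm_l2_adherent u e2; exists s0 => s ss.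
apply: (@le_lt_trans _ _ (e / 2)); last by rewrite ltr_pdivrMr //; lra.
apply: nm_l2_le => [|s']; first by rewrite divr_ge0 // ltW.
have split : nsq s' (u - fin_l2 s u) + nsq s u <= nsq (s `|` s')%fset u.
  apply: (le_trans (lerD (nsq_le _ (fsubsetUr s s')) (lexx _))).
  pose F t := if t \in s then nm (u t) ^+ 2 else 0.
  have -> : nsq s u = \sum_(t <- s) F t.
    by rewrite /nsq big_seq [RHS]big_seq; apply: eq_bigr => t ts; rewrite /F ts.
  rewrite (big_fset_incl _ (fsubsetUl s s')) => [|t _ /negPf]; last by rewrite /F => ->.
  rewrite -big_split /=; apply: ler_sum => t _.
  rewrite /F !fctE /fin_fun; case: ifP => _.
    by rewrite subrr nm0 expr0n add0r.
  by rewrite subr0 addr0.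
have := hs0 s ss; have := nsq_nm (s `|` s')%fset u; lra.
Qed.

Lemma hdot_delta u t : hdot u (delta t) = u t.
Proof.
apply: dot_unique; apply/cvg_nmP => e e0; exists [fset t]%fset => // s ts.
have {}ts : t \in s by move/fsubsetP: ts; apply; rewrite inE.
rewrite /pdot (big_fsetD1 t) // deltaE eqxx conjC1 mulr1 big_seq big1.
  by rewrite /= addr0 subrr nm0.
by move=> t'; rewrite !inE => /andP[/negPf tt' _]; rewrite deltaE tt' conjC0 mulr0.
Qed.

End SquareSummable.

(** * Entries of finite sums of matrix algebras *)

Section MatrixEntries.
Variables (R : realType) (k : nat) (n : 'I_k -> nat).
Local Notation M := (msum R n).
Implicit Types x y : M.

(** The rows of all the summands together, so that an element of the sum is one
    square array, vanishing outside of the diagonal blocks. *)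
Definition rows : finType := {j : 'I_k & 'I_(n j)}.
Implicit Types a b c d : rows.
Local Notation row p := (Tagged (fun j => 'I_(n j)) p : rows).

Definition same_block a b := tag a == tag b.
(** A matrix is upper triangular when its non-zero entries sit at pairs related by
    this partial order ([upperP]). *)
Definition row_le a b := same_block a b && (tagged a <= tagged b)%N.

Definition ent x a b : R[i] :=
  if same_block a b then x (tag a) (tagged a) (tagged_as a b) else 0.

Definition munit a b : M := fun j => \matrix_(p, q)
  ((row p == a) && (row q == b))%:R.

Lemma same_refl a : same_block a a. Proof. exact: eqxx. Qed.
Lemma same_sym a b : same_block a b = same_block b a. Proof. exact: eq_sym. Qed.
Lemma same_trans b a c : same_block a b -> same_block b c -> same_block a c.
Proof. by move=> /eqP e /eqP e'; rewrite /same_block e e'. Qed.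

Lemma sameP a b : same_block a b -> exists j (p q : 'I_(n j)),
  a = row p /\ b = row q.
Proof.
by case: a b => [j p] [j' q] /eqP /= e; subst j'; exists j, p, q.
Qed.

Lemma row_le_refl a : row_le a a.
Proof. by rewrite /row_le same_refl leqnn. Qed.

Lemma row_le_same a b : row_le a b -> same_block a b.
Proof. by case/andP. Qed.

Lemma row_le_trans b a c : row_le a b -> row_le b c -> row_le a c.
Proof.
move=> /andP[s1 l1] /andP[s2 l2].
by rewrite /row_le (same_trans s1 s2) (leq_trans l1 l2).
Qed.

Lemma row_le_anti a b : row_le a b -> row_le b a -> a = b.
Proof.
move=> /andP[/sameP[j [p [q [-> ->]]]] /= l] /andP[_ /= l'].
by congr Tagged; apply/val_inj/anti_leq; rewrite l.
Qed.

Lemma row_le_total a b : same_block a b -> row_le a b || row_le b a.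
Proof. by move=> s; rewrite /row_le s same_sym s leq_total. Qed.

Lemma entE x j (p q : 'I_(n j)) :
  ent x (row p) (row q) = x j p q.
Proof. by rewrite /ent /same_block /= eqxx tagged_asE. Qed.

Lemma ent_same x a b : ent x a b != 0 -> same_block a b.
Proof. by rewrite /ent; case: ifP => //; rewrite eqxx. Qed.

Lemma ent_nsame x a b : ~~ same_block a b -> ent x a b = 0.
Proof. by move/negPf; rewrite /ent => ->. Qed.

Lemma ent_ext x y : (forall a b, ent x a b = ent y a b) -> x = y.
Proof.
move=> h; apply: functional_extensionality_dep => j; apply/matrixP => p q.
by rewrite -!entE h.
Qed.

Lemma entD x y a b : ent (x + y) a b = ent x a b + ent y a b.
Proof. by rewrite /ent; case: ifP => _; rewrite ?addr0 // mxE. Qed.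

Lemma entZ (c : R[i]) x a b : ent (c *: x) a b = c * ent x a b.
Proof. by rewrite /ent; case: ifP => _; rewrite ?mulr0 // mxE. Qed.

Lemma ent0 a b : ent 0 a b = 0.
Proof. by rewrite /ent; case: ifP => _; rewrite // mxE. Qed.

Lemma ent_sum (I : Type) (r : seq I) (P : pred I) (F : I -> M) a b :
  ent (\sum_(i <- r | P i) F i) a b = \sum_(i <- r | P i) ent (F i) a b.
Proof. by elim/big_rec2 : _ => [|i x y _ <-]; [exact: ent0|rewrite entD]. Qed.

Lemma entM x y a c : ent (msum_mul x y) a c = \sum_b ent x a b * ent y b c.
Proof.
have [/sameP[j [p [q [-> ->]]]]|ns] := boolP (same_block a c); last first.
  rewrite ent_nsame // big1 // => b _.
  have [sab|/ent_nsame->] := boolP (same_block a b); last by rewrite mul0r.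
  have [sbc|/ent_nsame->] := boolP (same_block b c); last by rewrite mulr0.
  by rewrite (same_trans sab sbc) in ns.
rewrite entE /msum_mul mxE.
rewrite -(@sig_big_dep _ _ _ _ _ predT (fun=> predT) (fun j' r =>
  ent x (row p) (row r) * ent y (row r) (row q))) /=.
rewrite (bigD1 j) //= [X in _ = _ + X]big1 ?addr0.
  by apply: eq_bigr => r _; rewrite !entE.
move=> j' jj'; rewrite big1 // => r _; rewrite ent_nsame ?mul0r //.
by rewrite /same_block /= eq_sym.
Qed.

Lemma entM_neq0 x y a c : ent (msum_mul x y) a c != 0 ->
  exists b, ent x a b != 0 /\ ent y b c != 0.
Proof.
rewrite entM => nz; apply: contrapT => none; move/eqP: nz; apply; apply: big1 => b _.
apply/eqP; rewrite mulf_eq0; apply: contrapT => /negP; rewrite negb_or => /andP[h h'].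
by apply: none; exists b.
Qed.

Lemma ent_diagM x y z : (forall a b, a != b -> ent x a b = 0) ->
  (forall a b, a != b -> ent z a b = 0) ->
  forall a b, ent (msum_mul x (msum_mul y z)) a b = ent x a a * ent y a b * ent z b b.
Proof.
move=> xd zd a b; rewrite entM (bigD1 a) //= big1 ?addr0 => [|e ea]; last first.
  by rewrite xd ?mul0r // eq_sym.
rewrite entM (bigD1 b) //= big1 ?addr0 => [|e eb]; first by rewrite mulrA.
by rewrite zd ?mulr0.
Qed.

Lemma ent_star x a b : ent (msum_star x) a b = Num.conj (ent x b a).
Proof.
have [/sameP[j [p [q [-> ->]]]]|ns] := boolP (same_block a b); last first.
  by rewrite !ent_nsame ?conjC0 // same_sym.
by rewrite !entE /msum_star !mxE.
Qed.

Lemma ent_unit a b c d :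
  ent (munit a b) c d = (same_block a b && (c == a) && (d == b))%:R.
Proof.
have [/sameP[j [p [q [-> ->]]]]|ns] := boolP (same_block c d).
  rewrite entE /munit mxE; case: eqP => [<-|_] /=; last by rewrite andbF.
  case: eqP => [<-|_] /=; last by rewrite !andbF.
  by rewrite /same_block /= eqxx.
rewrite ent_nsame //; case: eqP => [ca|]; rewrite ?andbF //.
case: eqP => [db|]; rewrite ?andbF //.
by move: ns; rewrite ca db => /negPf ->.
Qed.

Lemma matrix_unitE j (p q : 'I_(n j)) :
  matrix_unit R (Tagged (fun j => ('I_(n j) * 'I_(n j))%type) (p, q)) =
  munit (row p) (row q).
Proof.
apply: functional_extensionality_dep => j'; rewrite /matrix_unit /munit /=.
have [<-|jj'] := eqVneq j j'.
  rewrite dfwithin; apply/matrixP => p' q'; rewrite !mxE.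
  by rewrite !eq_Tagged /=.
rewrite dfwithout //; apply/matrixP => p' q'; rewrite !mxE.
rewrite (_ : _ == _ = false) //; apply/negP => /eqP/(congr1 tag) /= e.
by rewrite e eqxx in jj'.
Qed.

Lemma unit_nsame a b : ~~ same_block a b -> munit a b = 0.
Proof. by move=> /negPf ns; apply: ent_ext => c d; rewrite ent_unit ns ent0. Qed.

Lemma upperP x :
  upper_triangular x <-> forall a b, ent x a b != 0 -> row_le a b.
Proof.
split=> h.
  move=> a b nz; have /sameP[j [p [q [e1 e2]]]] := ent_same nz.
  move: nz; rewrite e1 e2 entE /row_le /same_block /= eqxx /= leqNgt.
  by apply: contra => /(h j)->.
move=> j p q qp; apply/eqP/negPn/negP => nz.
have := h (row p) (row q); rewrite entE => /(_ nz) /andP[_ /=].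
by rewrite leqNgt qp.
Qed.

Lemma unit_upper a b : row_le a b -> upper_triangular (munit a b).
Proof.
move=> ab; apply/upperP => c d; rewrite ent_unit.
have [->|_] := eqVneq c a; last by rewrite andbF eqxx.
by have [->|_] := eqVneq d b; last by rewrite andbF eqxx.
Qed.

Lemma msum_decomp x : x = \sum_a \sum_b ent x a b *: munit a b.
Proof.
apply: ent_ext => a b; rewrite ent_sum (bigD1 a) //= ent_sum (bigD1 b) //=.
rewrite entZ ent_unit !eqxx !andbT.
have -> : ent x a b * (same_block a b)%:R = ent x a b.
  have [_|ns] := boolP (same_block a b); first by rewrite mulr1.
  by rewrite ent_nsame // mul0r.
rewrite !big1 ?addr0 // => [c /negPf ca|c /negPf cb].
  rewrite ent_sum big1 // => d _.
  by rewrite entZ ent_unit eq_sym ca andbF mulr0.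
by rewrite entZ ent_unit [b == c]eq_sym cb andbF mulr0.
Qed.

Lemma ent_unitMl a b x c d : same_block a b ->
  ent (msum_mul (munit a b) x) c d = (c == a)%:R * ent x b d.
Proof.
move=> ab; rewrite entM (bigD1 b) //= ent_unit ab eqxx andbT big1 ?addr0 // => e.
by move=> /negPf eb; rewrite ent_unit eb andbF mul0r.
Qed.

Lemma ent_unitMr a b x c d : same_block a b ->
  ent (msum_mul x (munit a b)) c d = ent x c a * (d == b)%:R.
Proof.
move=> ab; rewrite entM (bigD1 a) //= ent_unit ab eqxx big1 ?addr0 // => e.
by move=> /negPf eb; rewrite ent_unit eb andbF mulr0.
Qed.

Lemma unit_compress a b c d x : same_block a b -> same_block c d ->
  msum_mul (msum_mul (munit a b) x) (munit c d) = ent x b c *: munit a d.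
Proof.
move=> ab cd; apply: ent_ext => e f.
rewrite ent_unitMr // ent_unitMl // entZ ent_unit.
have [bc|bc] := boolP (same_block b c); last by rewrite (ent_nsame _ bc) !(mulr0, mul0r).
rewrite (same_trans ab (same_trans bc cd)) /=.
by case: eqP; case: eqP; rewrite ?(mulr0, mul0r, mulr1, mul1r).
Qed.

Lemma unitM a b c : same_block a b -> same_block b c ->
  msum_mul (munit a b) (munit b c) = munit a c.
Proof.
move=> ab bc; apply: ent_ext => d e.
rewrite ent_unitMl // !ent_unit eqxx bc (same_trans ab bc) /=.
by case: eqP; case: eqP; rewrite ?(mulr0, mul0r, mulr1, mul1r).
Qed.

Lemma unitM0 a b c d : b != c -> msum_mul (munit a b) (munit c d) = 0.
Proof.
move=> /negPf bc; have [ab|/unit_nsame->] := boolP (same_block a b); last first.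
  by apply: ent_ext => e f; rewrite entM ent0 big1 // => g _; rewrite ent0 mul0r.
apply: ent_ext => e f; rewrite ent_unitMl // ent_unit bc andbF /= mulr0.
by rewrite ent0.
Qed.

Lemma unit_star a b : msum_star (munit a b) = munit b a.
Proof.
apply: ent_ext => c d; rewrite ent_star !ent_unit conjC_nat same_sym.
by rewrite andbAC.
Qed.

(** A self-adjoint upper triangular matrix is diagonal, and a diagonal idempotent
    has entries 0 and 1. *)
Lemma ent_diag_proj x : upper_triangular x -> msum_star x = x ->
  msum_mul x x = x ->
  (forall a b, a != b -> ent x a b = 0) /\
  (forall a, ent x a a = 0 \/ ent x a a = 1).
Proof.
move=> /upperP ux sx mx.
have dx a b : a != b -> ent x a b = 0.
  move=> ab; apply/eqP/negPn/negP => nz; move/negP: ab; apply; apply/eqP.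
  apply: row_le_anti (ux _ _ nz) _; apply: ux.
  by rewrite -sx ent_star conjC_eq0.
split=> // a.
have : ent x a a = ent x a a ^+ 2.
  rewrite -{1}mx entM (bigD1 a) //= big1 ?addr0 // => b ba.
  by rewrite (dx b a) ?mulr0.
move/eqP; rewrite -subr_eq0 -{1}[ent x a a]mulr1 expr2 -mulrBr mulf_eq0.
case/orP => [/eqP->|]; first by left.
by rewrite subr_eq0 eq_sym => /eqP->; right.
Qed.

End MatrixEntries.

(** * Norm estimates in C*-algebras *)

Section CStarNorm.
Variables (R : realType) (B : cstarAlgType R).
Implicit Types x y z : B.

Lemma cmulDl x y z : (x + y) ∘ z = x ∘ z + y ∘ z.
Proof. by have := cmul_linearl z 1 x y; rewrite !scale1r. Qed.
Lemma cmulDr x y z : z ∘ (x + y) = z ∘ x + z ∘ y.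
Proof. by have := cmul_linearr z 1 x y; rewrite !scale1r. Qed.
Lemma cmul0l x : 0 ∘ x = 0.
Proof. by apply: (addrI (0 ∘ x)); rewrite -cmulDl !addr0. Qed.
Lemma cmul0r x : x ∘ 0 = 0.
Proof. by apply: (addrI (x ∘ 0)); rewrite -cmulDr !addr0. Qed.
Lemma cmulZl c x y : (c *: x) ∘ y = c *: (x ∘ y).
Proof. by have := cmul_linearl y c x 0; rewrite !addr0 cmul0l addr0. Qed.
Lemma cmulZr c x y : x ∘ (c *: y) = c *: (x ∘ y).
Proof. by have := cmul_linearr x c y 0; rewrite !addr0 cmul0r addr0. Qed.
Lemma cmulNl x y : (- x) ∘ y = - (x ∘ y).
Proof. by rewrite -scaleN1r cmulZl scaleN1r. Qed.
Lemma cmulNr x y : x ∘ (- y) = - (x ∘ y).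
Proof. by rewrite -scaleN1r cmulZr scaleN1r. Qed.
Lemma cmulBl x y z : (x - y) ∘ z = x ∘ z - y ∘ z.
Proof. by rewrite cmulDl cmulNl. Qed.
Lemma cmulBr x y z : z ∘ (x - y) = z ∘ x - z ∘ y.
Proof. by rewrite cmulDr cmulNr. Qed.

Lemma cmul_suml (I : Type) (r : seq I) (P : pred I) (F : I -> B) y :
  (\sum_(i <- r | P i) F i) ∘ y = \sum_(i <- r | P i) F i ∘ y.
Proof. by elim/big_rec2 : _ => [|i a b _ <-]; rewrite ?cmul0l ?cmulDl. Qed.
Lemma cmul_sumr (I : Type) (r : seq I) (P : pred I) (F : I -> B) y :
  y ∘ (\sum_(i <- r | P i) F i) = \sum_(i <- r | P i) y ∘ F i.
Proof. by elim/big_rec2 : _ => [|i a b _ <-]; rewrite ?cmul0r ?cmulDr. Qed.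

Lemma cstarD x y : cstar (x + y) = cstar x + cstar y.
Proof. by have := cstar_antilinear 1 x y; rewrite conjC1 !scale1r. Qed.
Lemma cstar0 : cstar (0 : B) = 0.
Proof. by apply: (addrI (cstar 0)); rewrite -cstarD !addr0. Qed.
Lemma cstar_sum (I : Type) (r : seq I) (P : pred I) (F : I -> B) :
  cstar (\sum_(i <- r | P i) F i) = \sum_(i <- r | P i) cstar (F i).
Proof. by elim/big_rec2 : _ => [|i a b _ <-]; rewrite ?cstar0 ?cstarD. Qed.

Lemma nm_cmul x y : nm (x ∘ y) <= nm x * nm y.
Proof. by have := cmul_norm x y; rewrite !nmE -rmorphM lecR. Qed.

Lemma nm_starM x : nm (cstar x ∘ x) = nm x ^+ 2.
Proof. by apply: complexI; rewrite rmorphXn /= -!nmE cstar_norm. Qed.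

Lemma nm_star x : nm (cstar x) = nm x.
Proof.
have le y : nm y <= nm (cstar y).
  have [->|y0] := eqVneq y 0; first by rewrite cstar0.
  have := nm_cmul (cstar y) y; rewrite nm_starM expr2.
  by rewrite ler_pM2r // nm_gt0.
by apply/eqP; rewrite eq_le le andbT; have := le (cstar x); rewrite cstarK.
Qed.

Definition projection_elt x := cstar x = x /\ x ∘ x = x.

Lemma nm_proj x : projection_elt x -> nm x <= 1.
Proof.
move=> [sx xx]; have := nm_starM x; rewrite sx xx => h.
by have := nm_ge0 x; nra.
Qed.

(** The C*-identity turns squaring a self-adjoint element into squaring its norm,
    while squaring a sum of orthogonal elements squares the terms. *)
Lemma orthogonal_powers (I : finType) (n : nat) (h : I -> B) (c : R) :
  (forall i j, i != j -> h i ∘ h j = 0) -> cstar (\sum_i h i) = \sum_i h i ->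
  (forall i, nm (h i) <= c) ->
  nm (\sum_i h i) ^+ (2 ^ n) <= #|I|%:R * c ^+ (2 ^ n).
Proof.
elim: n h c => [|n IH] h c oh sh hc.
  rewrite expn0 !expr1; apply: (le_trans (nm_sum _ _ _)).
  by apply: (le_trans (ler_sum _ (fun i _ => hc i))); rewrite sumr_const mulr_natl.
have sq : (\sum_i h i) ∘ (\sum_i h i) = \sum_i h i ∘ h i.
  rewrite cmul_suml; apply: eq_bigr => i _; rewrite cmul_sumr (bigD1 i) //=.
  by rewrite big1 ?addr0 // => j ji; rewrite oh // eq_sym.
have nsq : nm (\sum_i h i ∘ h i) = nm (\sum_i h i) ^+ 2.
  by rewrite -sq -nm_starM sh.
rewrite expnS !exprM -nsq; apply: IH => [i j ij||i].
- by rewrite cmulA -(cmulA (h i)) oh // cmul0r cmul0l.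
- by rewrite -sq cstarM sh.
- apply: (le_trans (nm_cmul _ _)); rewrite expr2.
  by apply: ler_pM; rewrite ?nm_ge0.
Qed.

Lemma bernoulli (t : R) (m : nat) : 1 <= t -> 1 + m%:R * (t - 1) <= t ^+ m.
Proof.
move=> t1; elim: m => [|m IH]; first by rewrite mul0r addr0 expr0.
rewrite exprS -natr1; apply: (@le_trans _ _ (t * (1 + m%:R * (t - 1)))).
  have : 0 <= m%:R * (t - 1) ^+ 2 :> R by rewrite mulr_ge0 // sqr_ge0.
  by move: (m%:R : R) => p; lra.
by rewrite ler_pM2l // (lt_le_trans ltr01).
Qed.

(** A constant factor disappears in the limit of the [2 ^ n]-th roots. *)
Lemma root_powers (a c K : R) : 0 <= a -> 0 <= c ->
  (forall n, a ^+ (2 ^ n) <= K * c ^+ (2 ^ n)) -> a <= c.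
Proof.
move=> a0 c0 h; rewrite leNgt; apply/negP => ca.
have {}c0 : 0 < c.
  rewrite lt_neqAle c0 andbT eq_sym; apply/eqP => e.
  by have := h 0%N; rewrite e expn0 !expr1 mulr0; lra.
pose t := a / c; have t1 : 1 < t by rewrite ltr_pdivlMr // mul1r.
have tK n : t ^+ (2 ^ n) <= K.
  by rewrite expr_div_n ler_pdivrMr ?exprn_gt0.
have t10 : 0 < t - 1 by rewrite subr_gt0.
pose n := Num.truncn (K / (t - 1)).
have := tK n.+1; have := bernoulli (2 ^ n.+1) (ltW t1).
have : K / (t - 1) < n.+1%:R by exact: truncnS_gt.
rewrite ltr_pdivrMr // => k1.
have : (n.+1%:R : R) <= (2 ^ n.+1)%:R by rewrite ler_nat ltnW // ltn_expl.
nra.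
Qed.

(** A block diagonal sum is no larger than its largest block: with [z] the sum,
    [cstar z ∘ z] is a sum of orthogonal terms, whose high powers are estimated
    by the triangle inequality at the cost of a factor [#|I|]. *)
Lemma nm_blocks (I : finType) (e f x : I -> B) (C : R) :
  (forall i, projection_elt (e i)) -> (forall i, projection_elt (f i)) ->
  (forall i j, i != j -> e i ∘ e j = 0) ->
  (forall i j, i != j -> f i ∘ f j = 0) ->
  0 <= C -> (forall i, nm (x i) <= C) ->
  nm (\sum_i e i ∘ x i ∘ f i) <= C.
Proof.
move=> pe pf oe of_ C0 xC; set z := \sum_i _.
pose h i := f i ∘ (cstar (x i) ∘ (e i ∘ x i)) ∘ f i.
have zz : cstar z ∘ z = \sum_i h i.
  rewrite /z cstar_sum cmul_suml; apply: eq_bigr => i _.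
  rewrite cmul_sumr (bigD1 i) //= big1 ?addr0.
    rewrite !cstarM (pe i).1 (pf i).1 /h !cmulA; congr (_ ∘ _ ∘ _).
    by rewrite -(cmulA _ (e i)) (pe i).2.
  move=> j ji; rewrite !cstarM (pe i).1 !cmulA.
  by rewrite -(cmulA _ (e i)) oe 1?eq_sym // cmul0r !cmul0l.
have hC i : nm (h i) <= C ^+ 2.
  have p0 := xC i; have p1 := nm_proj (pe i); have p2 := nm_proj (pf i).
  have Mle (a b : B) (u v : R) : nm a <= u -> nm b <= v -> nm (a ∘ b) <= u * v.
    by move=> au bv; apply: le_trans (nm_cmul _ _) _; apply: ler_pM; rewrite ?nm_ge0.
  have -> : C ^+ 2 = 1 * (C * (1 * C)) * 1 by ring.
  have p3 : nm (cstar (x i)) <= C by rewrite nm_star.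
  exact: Mle (Mle _ _ _ _ p2 (Mle _ _ _ _ p3 (Mle _ _ _ _ p1 p0))) p2.
have le : nm (\sum_i h i) <= C ^+ 2.
  apply: (@root_powers _ _ #|I|%:R); rewrite ?nm_ge0 ?exprn_ge0 // => n.
  apply: orthogonal_powers => // [i j ij|]; last by rewrite -zz cstarM cstarK.
  by rewrite /h !cmulA -(cmulA _ (f i)) of_ // cmul0r !cmul0l.
by move: le; rewrite -zz nm_starM ler_pXn2r // nnegrE nm_ge0.
Qed.

End CStarNorm.


(** * Matrix units in an inductive limit *)

Definition isnat (R : realType) (z : R[i]) := exists n : nat, z = n%:R.

Lemma isnat_sum (R : realType) (I : Type) (r : seq I) (P : pred I) (F : I -> R[i]) :
  (forall i, P i -> isnat (F i)) -> isnat (\sum_(i <- r | P i) F i).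
Proof.
move=> h; elim/big_rec : _ => [|i x Pi [n ->]]; first by exists 0%N.
by have [m ->] := h i Pi; exists (m + n)%N; rewrite natrD.
Qed.

Lemma isnatM (R : realType) (z w : R[i]) : isnat z -> isnat w -> isnat (z * w).
Proof. by move=> [m ->] [n ->]; exists (m * n)%N; rewrite natrM. Qed.

Lemma isnat_bool (R : realType) (b : bool) : isnat (b%:R : R[i]).
Proof. by exists b. Qed.

Section System.
Variables (R : realType) (B : cstarAlgType R) (S : taf_system R).
Variable iota : forall i, level S i -> B.
Hypothesis limB : is_AF_limit iota.

Definition Rows r := rows (msize (t := S) (i := r)).
Definition level_unit r (a b : Rows r) : level S r := munit R a b.
Local Notation U := level_unit.
Definition image_unit r (a b : Rows r) : B := iota (U a b).
Local Notation E := image_unit.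

Lemma iotaZD r c (x y : level S r) : iota (c *: x + y) = c *: iota x + iota y.
Proof. exact: iota_linear limB r c x y. Qed.
Lemma iotaD r (x y : level S r) : iota (x + y) = iota x + iota y.
Proof. by have := iotaZD 1 x y; rewrite !scale1r. Qed.
Lemma iota0 r : iota (0 : level S r) = 0.
Proof. by apply: (addrI (iota (0 : level S r))); rewrite -iotaD !addr0. Qed.
Lemma iotaZ r c (x : level S r) : iota (c *: x) = c *: iota x.
Proof. by have := iotaZD c x 0; rewrite !addr0 iota0 addr0. Qed.
Lemma iotaN r (x : level S r) : iota (- x) = - iota x.
Proof. by rewrite -scaleN1r iotaZ scaleN1r. Qed.
Lemma iotaB r (x y : level S r) : iota (x - y) = iota x - iota y.
Proof. by rewrite iotaD iotaN. Qed.
Lemma iota_sum r (I : Type) (s : seq I) (P : pred I) (F : I -> level S r) :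
  iota (\sum_(i <- s | P i) F i) = \sum_(i <- s | P i) iota (F i).
Proof. by elim/big_rec2 : _ => [|i a b _ <-]; rewrite ?iota0 ?iotaD. Qed.
Lemma iotaM r (x y : level S r) : iota (msum_mul x y) = iota x ∘ iota y.
Proof. exact: iota_mul limB r x y. Qed.
Lemma iotaS r (x : level S r) : iota (msum_star x) = cstar (iota x).
Proof. exact: iota_star limB r x. Qed.

Lemma E_mul r (a b c : Rows r) : same_block a b -> same_block b c -> E a b ∘ E b c = E a c.
Proof. by move=> ab bc; rewrite /E -iotaM unitM. Qed.

Lemma E_mul0 r (a b c d : Rows r) : b != c -> E a b ∘ E c d = 0.
Proof. by move=> bc; rewrite /E -iotaM unitM0 // iota0. Qed.

Lemma E_star r (a b : Rows r) : cstar (E a b) = E b a.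
Proof. by rewrite /E -iotaS unit_star. Qed.

Lemma E_proj r (a : Rows r) : projection_elt (E a a).
Proof. by split; rewrite ?E_star // E_mul // same_refl. Qed.

Lemma E_neq0 r (a b : Rows r) : same_block a b -> E a b != 0.
Proof.
move=> ab; apply/negP => /eqP; rewrite -(iota0 r) => /(iota_inj limB).
move=> /(congr1 (fun x => ent x a b)); rewrite ent_unit ab !eqxx ent0.
by move/eqP; rewrite oner_eq0.
Qed.

Lemma E_compress r (a b c d : Rows r) x : same_block a b -> same_block c d ->
  E a b ∘ iota x ∘ E c d = ent x b c *: E a d.
Proof. by move=> ab cd; rewrite /E -!iotaM unit_compress // iotaZ. Qed.

Lemma nm_E1 r (a b : Rows r) : same_block a b -> nm (E a b) = 1.
Proof.
move=> ab; have := nm_starM (E a b); rewrite E_star E_mul // 1?same_sym //.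
have := nm_starM (E b b); rewrite E_star E_mul // ?same_refl //.
have := nm_gt0 (E_neq0 (same_refl b)); have := nm_ge0 (E a b).
move: (nm (E a b)) (nm (E b b)) => u v u0 v0 vv uu.
have v1 : v = 1 by nra.
by rewrite v1 in uu; have : (u - 1) * (u + 1) = 0; [nra|move/eqP; rewrite mulf_eq0 => /orP[]/eqP; lra].
Qed.

Lemma nm_E r (a b : Rows r) : nm (E a b) <= 1.
Proof.
have [ab|ab] := boolP (same_block a b); first by rewrite nm_E1.
by rewrite /E /U unit_nsame // iota0 nm0.
Qed.

Lemma nm_cut r (a b c d : Rows r) z : nm (E a b ∘ z ∘ E c d) <= nm z.
Proof.
apply: (le_trans (nm_cmul _ _)); rewrite -[leRHS]mulr1.
apply: ler_pM; rewrite ?nm_ge0 ?nm_E //.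
apply: (le_trans (nm_cmul _ _)); rewrite -[leRHS]mul1r.
by apply: ler_pM; rewrite ?nm_ge0 ?nm_E.
Qed.

Lemma phi0 r : phi (0 : level S r) = 0.
Proof. by apply: (iota_inj limB); rewrite (iota_phi limB) !iota0. Qed.

(** This is where the regularity of the connecting maps enters: together with the
    projections it forces the entries 0 and 1 of [unit_at01]. *)
Lemma ent_phi_unit r (a b : Rows r) (c d : Rows r.+1) :
  isnat (ent (phi (U a b)) c d).
Proof.
have [/sameP[j [p [q [-> ->]]]]|ns] := boolP (same_block a b); last first.
  rewrite /U unit_nsame //; have -> : phi (0 : level S r) = 0 by exact: phi0.
  by rewrite ent0; exists 0%N.
have [V e] := phi_regular (t := S) (Tagged (fun j => ('I__ * 'I__)%type) (p, q)).
rewrite matrix_unitE in e; rewrite /U e ent_sum; apply: isnat_sum => v _.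
case: v => j' [p' q']; rewrite matrix_unitE ent_unit; exact: isnat_bool.
Qed.

Lemma phiE r (x : level S r) (c d : Rows r.+1) :
  ent (phi x) c d = \sum_a \sum_b ent x a b * ent (phi (U a b)) c d.
Proof.
have phi_sum (I : Type) (s : seq I) (F : I -> level S r) :
    phi (\sum_(i <- s) F i) = \sum_(i <- s) phi (F i).
  elim/big_rec2 : _ => [|i u v _ <-]; first exact: phi0.
  by have := phi_linear 1 (F i) v; rewrite !scale1r.
have phiZ k (y : level S r) : phi (k *: y) = k *: phi y.
  by have := phi_linear k y 0; rewrite !addr0 phi0 addr0.
rewrite {1}(msum_decomp x) phi_sum ent_sum; apply: eq_bigr => a _.
by rewrite phi_sum ent_sum; apply: eq_bigr => b _; rewrite phiZ entZ.
Qed.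

(** Every argument about finitely many elements takes place on one common level. *)
Lemma lift_level l r (x : level S l) : (l <= r)%N ->
  exists y : level S r, iota y = iota x /\
    (upper_triangular x -> upper_triangular y).
Proof.
elim: r => [|r IH].
  by rewrite leqn0 => /eqP l0; subst l; exists x.
rewrite leq_eqVlt => /orP[/eqP lr|]; first by subst l; exists x.
rewrite ltnS => /IH[y [yx yu]]; exists (phi y).
by rewrite (iota_phi limB); split => // /yu; exact: phi_upper.
Qed.

Lemma unit_at_nat l r (a b : Rows l) (V : level S r) : (l <= r)%N ->
  iota V = E a b -> forall c d, isnat (ent V c d).
Proof.
move=> lr; have [W We Wn] : exists2 W : level S r, iota W = E a b &
    forall c d, isnat (ent W c d).
  elim: r lr {V} => [|r IH].
    rewrite leqn0 => /eqP l0; subst l; exists (U a b) => // c d.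
    by rewrite ent_unit; exact: isnat_bool.
  rewrite leq_eqVlt => /orP[/eqP lr|].
    subst l; exists (U a b) => // c d.
    by rewrite ent_unit; exact: isnat_bool.
  rewrite ltnS => /IH[W We Wn]; exists (phi W); first by rewrite (iota_phi limB).
  move=> c d; rewrite phiE; apply: isnat_sum => e _; apply: isnat_sum => f _.
  by apply: isnatM => //; exact: ent_phi_unit.
rewrite -We => /(iota_inj limB) -> //.
Qed.

Lemma upper_at l r (a b : Rows l) (V : level S r) : (l <= r)%N ->
  iota V = E a b -> row_le a b -> upper_triangular V.
Proof.
move=> lr Ve ab; have [W [We Wu]] := lift_level (U a b) lr.
have -> : V = W by apply: (iota_inj limB); rewrite We.
by apply: Wu; exact: unit_upper.
Qed.

Lemma diag_at l r (a : Rows l) (V : level S r) : (l <= r)%N ->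
  iota V = E a a ->
  (forall c d, c != d -> ent V c d = 0) /\
  (forall c, ent V c c = 0 \/ ent V c c = 1).
Proof.
move=> lr Ve; apply: ent_diag_proj.
- by apply: upper_at Ve _ => //; exact: row_le_refl.
- by apply: (iota_inj limB); rewrite iotaS Ve E_star.
- by apply: (iota_inj limB); rewrite iotaM Ve E_mul ?same_refl.
Qed.

(** A matrix unit is a partial isometry: [V] times its adjoint is a diagonal
    projection, so the squares of the entries of a row, which are natural numbers,
    add up to at most 1. *)
Lemma unit_at01 l r (a b : Rows l) (V : level S r) : (l <= r)%N -> same_block a b ->
  iota V = E a b -> forall c d, ent V c d != 0 ->
  ent V c d = 1 /\ forall d', d' != d -> ent V c d' = 0.
Proof.
move=> lr ab Ve c d nz; have Vn := unit_at_nat lr Ve.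
have [P [Pe _]] := lift_level (U a a) lr.
have [_ P01] := diag_at lr Pe.
have PV : P = msum_mul V (msum_star V).
  apply: (iota_inj limB); rewrite iotaM iotaS Pe Ve E_star E_mul //.
  by rewrite same_sym.
have sq d' : exists n : nat, ent V c d' = n%:R /\ ent V c d' * ent (msum_star V) d' c = (n ^ 2)%:R.
  by have [n e] := Vn c d'; exists n; rewrite ent_star e conjC_nat natrX.
have {}sq : exists f : Rows r -> nat, forall d', ent V c d' = (f d')%:R /\
    ent V c d' * ent (msum_star V) d' c = (f d' ^ 2)%:R.
  by exists (fun d' => sval (cid (sq d'))) => d'; case: cid.
have [f hf] := sq.
have sum1 : (\sum_d' f d' ^ 2 <= 1)%N.
  have e : ent P c c = (\sum_d' f d' ^ 2)%:R.
    by rewrite PV entM natr_sum; apply: eq_bigr => d' _; exact: (hf d').2.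
  by have := P01 c; rewrite e => -[]/eqP; rewrite ?pnatr_eq0 ?pnatr_eq1 => /eqP->.
have fd : (0 < f d)%N.
  by move: nz; rewrite (hf d).1 pnatr_eq0 lt0n.
move: sum1; rewrite (bigD1 d) //= => sum1.
have fd1 : f d = 1%N.
  apply/eqP; rewrite eqn_leq fd andbT; move: (leq_trans (leq_addr _ _) sum1).
  by rewrite -{2}(exp1n 2) leq_exp2r.
split=> [|d' dd']; first by rewrite (hf d).1 fd1.
move: sum1; rewrite fd1 exp1n -[X in (_ <= X)%N]addn0 leq_add2l leqn0 sum_nat_eq0.
by move=> /forall_inP/(_ d' dd'); rewrite expn_eq0 andbT => /eqP f0; rewrite (hf d').1 f0.
Qed.

Lemma unit_at_col l r (a b : Rows l) (V : level S r) : (l <= r)%N -> same_block a b ->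
  iota V = E a b -> forall c c' d, ent V c d != 0 -> ent V c' d != 0 -> c = c'.
Proof.
move=> lr ab Ve c c' d nz nz'.
have se : iota (msum_star V) = E b a by rewrite iotaS Ve E_star.
have ba : same_block b a by rewrite same_sym.
have h := unit_at01 lr ba se.
have nzs : ent (msum_star V) d c != 0 by rewrite ent_star conjC_eq0.
have nzs' : ent (msum_star V) d c' != 0 by rewrite ent_star conjC_eq0.
apply/eqP/negPn/negP => cc'; have [_ /(_ c')] := h d c nzs.
by rewrite eq_sym => /(_ cc') e; rewrite e eqxx in nzs'.
Qed.

(** The range and source projections of an off-diagonal unit are orthogonal
    diagonal matrices, and [V] is compressed by them. *)
Lemma unit_at_offdiag l r (a b : Rows l) (V : level S r) : (l <= r)%N ->
  same_block a b -> iota V = E a b -> a != b -> forall c, ent V c c = 0.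
Proof.
move=> lr sab Ve ab c.
have [P [Pe _]] := lift_level (U a a) lr; have [Q [Qe _]] := lift_level (U b b) lr.
have [Pd _] := diag_at lr Pe; have [Qd _] := diag_at lr Qe.
have VPQ : V = msum_mul P (msum_mul V Q).
  apply: (iota_inj limB); rewrite !iotaM Pe Qe Ve !E_mul ?same_refl //.
have : ent (msum_mul P (msum_mul P Q)) c c = 0.
  rewrite (_ : msum_mul P (msum_mul P Q) = 0) ?ent0 //.
  by apply: (iota_inj limB); rewrite !iotaM Pe Qe iota0 E_mul0 ?cmul0r.
rewrite ent_diagM // => /eqP; rewrite !mulf_eq0 orbb => /orP[]/eqP z;
  by rewrite VPQ ent_diagM // z ?mul0r ?mulr0.
Qed.


(** * Closed ideals and matrix units *)

Variable A : set B.
Hypothesis AE : A = closure (\bigcup_i (iota (i := i) @` @upper_triangular R _ _)).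

Lemma A_iota r (x : level S r) : upper_triangular x -> A (iota x).
Proof. by move=> ux; rewrite AE; apply: subset_closure; exists r => //; exists x. Qed.

Lemma A_E r (a b : Rows r) : row_le a b -> A (E a b).
Proof. by move=> ab; apply: A_iota; exact: unit_upper. Qed.

Lemma A_closed : closed A.
Proof. by rewrite AE; exact: closed_closure. Qed.

Lemma A_approx a (e : R) : A a -> 0 < e -> exists r0, forall r, (r0 <= r)%N ->
  exists2 x : level S r, upper_triangular x & nm (a - iota x) < e.
Proof.
rewrite AE => /closure_nmP h /h[_ [r0 _ [x ux <-]] lt]; exists r0 => r r0r.
by have [y [yx /(_ ux) uy]] := lift_level x r0r; exists y; rewrite ?yx.
Qed.

Lemma upperD r (c : R[i]) (x y : level S r) : upper_triangular x ->
  upper_triangular y -> upper_triangular (c *: x + y).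
Proof.
move=> /upperP ux /upperP uy; apply/upperP => a b; rewrite entD entZ.
have [->|/ux //] := eqVneq (ent x a b) 0.
by rewrite mulr0 add0r; exact: uy.
Qed.

Lemma upperM r (x y : level S r) : upper_triangular x ->
  upper_triangular y -> upper_triangular (msum_mul x y).
Proof.
move=> /upperP ux /upperP uy; apply/upperP => a c; rewrite entM => nz.
apply/negPn/negP => nac; move/eqP: nz; apply; apply: big1 => b _.
have [->|/ux ab] := eqVneq (ent x a b) 0; first by rewrite mul0r.
have [->|/uy bc] := eqVneq (ent y b c) 0; first by rewrite mulr0.
by rewrite (row_le_trans ab bc) in nac.
Qed.

Lemma A_subspace : subspace A.
Proof.
split; first by rewrite -(iota0 0); apply: A_iota => j p q; rewrite mxE.
move=> c a b Aa Ab; apply: (closed_nm A_closed) => e e0.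
have n1 : 0 < nm c + 1 by have := nm_ge0 c; lra.
have [r1 h1] := A_approx (e := e / 2 / (nm c + 1)) Aa ltac:(by rewrite !divr_gt0).
have [r2 h2] := A_approx (e := e / 2) Ab ltac:(by rewrite !divr_gt0).
have [x ux ax] := h1 _ (leq_maxl r1 r2); have [y uy by_] := h2 _ (leq_maxr r1 r2).
exists (iota (c *: x + y)); first by apply: A_iota; exact: upperD.
rewrite iotaZD opprD addrACA -scalerBr; apply: le_lt_trans (nmD _ _) _.
rewrite [e]splitr; apply: ler_ltD => //.
by move: ax; rewrite nmZ ltr_pdivlMr //; have := nm_ge0 (a - iota x); nra.
Qed.

Lemma A_mul a b : A a -> A b -> A (a ∘ b).
Proof.
move=> Aa Ab; apply: (closed_nm A_closed) => e e0.
have nb0 := nm_ge0 b; have na0 := nm_ge0 a.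
pose d := e / 2 / (nm b + 1); pose d' := e / 2 / (nm a + d + 1).
have d0 : 0 < d by rewrite !divr_gt0 // ltr_wpDl.
have d'0 : 0 < d' by rewrite !divr_gt0 // ltr_wpDl // addr_ge0 // ltW.
have dE : d * (nm b + 1) = e / 2 by rewrite divfK // lt0r_neq0 // ltr_wpDl.
have d'E : d' * (nm a + d + 1) = e / 2.
  by rewrite divfK // lt0r_neq0 // ltr_wpDl // addr_ge0 // ltW.
have [r1 h1] := A_approx Aa d0; have [r2 h2] := A_approx Ab d'0.
have [x ux ax] := h1 _ (leq_maxl r1 r2); have [y uy ay] := h2 _ (leq_maxr r1 r2).
exists (iota (msum_mul x y)); first by apply: A_iota; exact: upperM.
have -> : a ∘ b - iota (msum_mul x y) = (a - iota x) ∘ b + iota x ∘ (b - iota y).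
  by rewrite iotaM cmulBl cmulBr subrKA.
have nx := nm_lebD (iota x) a; rewrite nmB in nx.
apply: le_lt_trans (nmD _ _) _; rewrite [e]splitr; apply: ltrD.
  apply: le_lt_trans (nm_cmul _ _) _; rewrite -dE.
  by apply: (@le_lt_trans _ _ (d * nm b)); [rewrite ler_wpM2r // ltW|rewrite ltr_pM2l //; lra].
apply: le_lt_trans (nm_cmul _ _) _; rewrite -d'E mulrC.
apply: (@le_lt_trans _ _ (d' * nm (iota x))); first by rewrite ler_wpM2r ?nm_ge0 // ltW.
by rewrite ltr_pM2l //; lra.
Qed.

Section Ideal.
Variable J : set B.
Hypothesis idJ : is_ideal A J.

Lemma ideal0 : J 0. Proof. by case: idJ => _ [? _]. Qed.
Lemma idealZD c x y : J x -> J y -> J (c *: x + y).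
Proof. by case: idJ => _ [_ h] _ _; exact: h. Qed.
Lemma idealD x y : J x -> J y -> J (x + y).
Proof. by move=> Jx Jy; rewrite -[x]scale1r; exact: idealZD. Qed.
Lemma idealZ c x : J x -> J (c *: x).
Proof. by move=> Jx; rewrite -[_ *: _]addr0; apply: idealZD => //; exact: ideal0. Qed.
Lemma ideal_sum (I : Type) (s : seq I) (P : pred I) (F : I -> B) :
  (forall i, P i -> J (F i)) -> J (\sum_(i <- s | P i) F i).
Proof. by move=> h; elim/big_rec : _ => [|i x /h *]; [exact: ideal0|exact: idealD]. Qed.
Lemma ideal_sub x : J x -> A x. Proof. by case: idJ => h _ _ _; exact: h. Qed.
Lemma ideal_closed : closed J. Proof. by case: idJ. Qed.
Lemma idealMl a x : A a -> J x -> J (a ∘ x).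
Proof. by case: idJ => _ _ _ h Aa Jx; case: (h a x Aa Jx). Qed.
Lemma idealMr a x : A a -> J x -> J (x ∘ a).
Proof. by case: idJ => _ _ _ h Aa Jx; case: (h a x Aa Jx). Qed.

(** On a high level the unit is a sum of units [E c d] with pairwise distinct rows
    and columns.  An approximant [x] of [y] there has entries [la c] at distance
    at most 1/2 from 1 at these places, so [y], compressed to them and divided
    by the [la c], approximates the unit from within [J].  The error is a block
    sum, hence as small as the distance of [x] to [y], with no factor depending
    on the level. *)
Lemma unit_in_ideal l (a b : Rows l) y : row_le a b -> J y ->
  nm (E a b - y) <= 4^-1 -> J (E a b).
Proof.
move=> ab Jy near; have sab := row_le_same ab.
apply: (closed_nm ideal_closed) => e e0.
pose dl := Num.min (e / 4) 4^-1.
have d0 : 0 < dl by rewrite lt_min invr_gt0 ltr0n andbT divr_gt0.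
have de : dl <= e / 4 by rewrite ge_min lexx.
have d4 : dl <= 4^-1 by rewrite ge_min lexx orbT.
have [r0 /(_ (maxn l r0) (leq_maxr _ _))] := A_approx (ideal_sub Jy) d0.
have := leq_maxl l r0; move: (maxn l r0) => r lr [x ux yx].
have [V [Ve' _]] := lift_level (U a b) lr.
have {Ve'} Ve : iota V = E a b := Ve'.
(* [s c] is the column of the entry 1 of [V] in row [c], if there is one. *)
pose s c := [pick d | ent V c d != 0].
pose ee c := if s c is Some _ then E c c else 0 : B.
pose ff c := if s c is Some d then E d d else 0 : B.
pose la c := if s c is Some d then ent x c d else 0.
pose zz c := (la c)^-1 *: (iota x - y).
have sP c d : s c = Some d -> ent V c d = 1 /\ forall d', d' != d -> ent V c d' = 0.
  by rewrite /s; case: pickP => // d' nz [<-]; exact: (unit_at01 lr sab Ve).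
have sN c d : s c = None -> ent V c d = 0.
  by rewrite /s; case: pickP => // h _; apply/eqP/negPn; rewrite h.
have uE : E a b = \sum_c (if s c is Some d then E c d else 0).
  rewrite -Ve {1}(msum_decomp V) iota_sum; apply: eq_bigr => c _.
  rewrite iota_sum; case sc : (s c) => [d'|].
    have [V1 V0] := sP c d' sc.
    rewrite (bigD1 d') //= iotaZ V1 scale1r big1 ?addr0 // => d'' /V0 ->.
    by rewrite scale0r iota0.
  by rewrite big1 // => d' _; rewrite sN // scale0r iota0.
have compr c d' z : s c = Some d' -> E c c ∘ z ∘ E d' d' = ee c ∘ z ∘ ff c.
  by rewrite /ee /ff => ->.
have proj0 : projection_elt (0 : B) by split; rewrite ?cstar0 ?cmul0l.
have la2 c d' : s c = Some d' -> 2^-1 <= nm (la c).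
  move=> sc; have [V1 _] := sP c d' sc.
  have cd : same_block c d' by apply: (@ent_same _ _ _ V); rewrite V1 oner_eq0.
  have h : nm (1 - la c) <= 2^-1.
    have <- : nm ((1 - la c) *: E c d') = nm (1 - la c) by rewrite nmZ nm_E1 ?mulr1.
    have -> : (1 - la c) *: E c d' = E c c ∘ (E a b - iota x) ∘ E d' d'.
      rewrite cmulBr cmulBl -Ve !E_compress ?same_refl // V1 /la sc scalerBl //.
    apply: (le_trans (nm_cut _ _ _ _ _)).
    by have := nm_tri y (E a b) (iota x); lra.
  have := nm_lebD (1 : R[i]) (1 - la c).
  by rewrite nm1 opprB addrCA subrr addr0 => ?; lra.
exists (\sum_c ee c ∘ ((la c)^-1 *: y) ∘ ff c).
  apply: ideal_sum => c _; rewrite /ee /ff; case: (s c) => [d'|]; last first.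
    by rewrite cmul0r; exact: ideal0.
  by apply: idealMr; [apply: A_E; exact: row_le_refl|apply: idealMl;
    [apply: A_E; exact: row_le_refl|exact: idealZ]].
have -> : E a b - \sum_c ee c ∘ ((la c)^-1 *: y) ∘ ff c = \sum_c ee c ∘ zz c ∘ ff c.
  rewrite uE -sumrB; apply: eq_bigr => c _; rewrite /zz scalerBr cmulBr cmulBl.
  congr (_ - _); case sc : (s c) => [d'|]; last by rewrite /ff sc cmul0r.
  have [V1 _] := sP c d' sc.
  rewrite -(compr _ _ _ sc) cmulZr cmulZl E_compress ?same_refl //.
  rewrite /la sc scalerA mulVf ?scale1r //.
  apply/eqP => la0; have := la2 c d' sc; rewrite /la sc la0 nm0; lra.
apply: (@le_lt_trans _ _ (2 * dl)); last by lra.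
apply: nm_blocks.
- by move=> c; rewrite /ee; case: (s c) => // _; exact: E_proj.
- by move=> c; rewrite /ff; case: (s c) => // d'; exact: E_proj.
- move=> c c' cc'; rewrite /ee; case: (s c) => [_|]; last by rewrite cmul0l.
  by case: (s c') => [_|]; [exact: E_mul0|rewrite cmul0r].
- move=> c c' cc'; rewrite /ff; case sc : (s c) => [d'|]; last by rewrite cmul0l.
  case sc' : (s c') => [d''|]; last by rewrite cmul0r.
  apply: E_mul0; apply: contraNneq cc' => dd; apply/eqP.
  have [V1 _] := sP c d' sc; have [V1' _] := sP c' d'' sc'.
  apply: (unit_at_col lr sab Ve (d := d')); first by rewrite V1 oner_eq0.
  by rewrite dd V1' oner_eq0.
- by rewrite mulr_ge0 // ltW.
move=> c; rewrite /zz nmZ nmV nmB; case sc : (s c) => [d'|]; last first.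
  by rewrite /la sc nm0 invr0 mul0r mulr_ge0 // ltW.
have l2 := la2 c d' sc; have l0 : 0 < nm (la c) by apply: lt_le_trans l2; rewrite invr_gt0.
have i2 : (nm (la c))^-1 <= 2 by rewrite invf_ple ?posrE.
by apply: ler_pM; rewrite ?invr_ge0 ?nm_ge0 // ltW.
Qed.

End Ideal.

Lemma E_nsame r (a b : Rows r) : ~~ same_block a b -> E a b = 0.
Proof. by move=> ns; rewrite /E /U unit_nsame // iota0. Qed.

Lemma iota_decomp r (x : level S r) :
  iota x = \sum_a \sum_b ent x a b *: E a b.
Proof.
rewrite {1}(msum_decomp x) iota_sum; apply: eq_bigr => a _.
by rewrite iota_sum; apply: eq_bigr => b _; rewrite iotaZ.
Qed.

Lemma one_mull r (x : level S r) : (\sum_(c : Rows r) E c c) ∘ iota x = iota x.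
Proof.
rewrite (iota_decomp x) cmul_suml; apply: eq_bigr => a _.
rewrite cmul_sumr (bigD1 a) //= [X in _ + X]big1 ?addr0.
  rewrite cmul_sumr; apply: eq_bigr => b _; rewrite cmulZr.
  have [ab|/E_nsame->] := boolP (same_block a b); last by rewrite cmul0r.
  by rewrite E_mul ?same_refl.
move=> a' aa'; rewrite cmul_sumr big1 // => b _.
by rewrite cmulZr E_mul0 ?scaler0 // eq_sym.
Qed.

Lemma diag_comm l r (a : Rows l) (c : Rows r) : (l <= r)%N ->
  E a a ∘ E c c = E c c ∘ E a a.
Proof.
move=> lr; have [P [Pe' _]] := lift_level (U a a) lr.
have Pe : iota P = E a a := Pe'.
have [Pd _] := diag_at lr Pe.
rewrite -Pe /E -!iotaM; congr (iota _); apply: ent_ext => d e.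
rewrite ent_unitMl ?same_refl // ent_unitMr ?same_refl //.
have [->|dc] := eqVneq d c; have [->|ec] := eqVneq e c; rewrite ?(mulr0, mul0r, mulr1, mul1r) //.
  by rewrite Pd // eq_sym.
by rewrite Pd.
Qed.

(** A row chosen in each block, the same for all the rows of the block, through
    which diagonal units of a higher level are transported. *)
Definition base_row r (a : Rows r) : Rows r := odflt a [pick b | same_block a b].

Lemma base_same r (a : Rows r) : same_block a (base_row a).
Proof. by rewrite /base_row; case: pickP => //= h; rewrite same_refl. Qed.

Lemma base_eq r (a b : Rows r) : same_block a b -> base_row a = base_row b.
Proof.
move=> ab; rewrite /base_row.
have -> : [pick c | same_block a c] = [pick c | same_block b c].
  by apply: eq_pick => c; rewrite /same_block (eqP ab).
by case: pickP => //= /(_ b); rewrite same_refl.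
Qed.

(** The copy of [E c c] in row [a] of level [l].  Copying makes the sum [slice] of
    the cells over all rows commute with the whole level [l]. *)
Definition cell l r (a : Rows l) (c : Rows r) : B :=
  E a (base_row a) ∘ E c c ∘ E (base_row a) a.

Lemma cell_unit l r (a : Rows l) (c : Rows r) : (l <= r)%N ->
  cell a c = 0 \/ exists c' : Rows r, cell a c = E c' c'.
Proof.
move=> lr; have ba := base_same a.
have [W [We' _]] := lift_level (U a (base_row a)) lr.
have We : iota W = E a (base_row a) := We'.
have -> : cell a c = iota (msum_mul (msum_mul W (U c c)) (msum_star W)).
  by rewrite !iotaM iotaS We E_star.
have entc d e : ent (msum_mul (msum_mul W (U c c)) (msum_star W)) d e =
    ent W d c * Num.conj (ent W e c).
  rewrite entM (bigD1 c) //= ent_unitMr ?same_refl // eqxx mulr1 big1 ?addr0.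
    by rewrite ent_star.
  by move=> f /negPf fc; rewrite ent_unitMr ?same_refl // fc mulr0 mul0r.
have [[d nz]|none] := pselect (exists d, ent W d c != 0); last first.
  left; rewrite -(iota0 r); congr (iota _); apply: ent_ext => d e.
  rewrite entc ent0; have [->|nz] := eqVneq (ent W d c) 0; first by rewrite mul0r.
  by case: none; exists d.
right; exists d; congr (iota _); apply: ent_ext => e f.
rewrite entc ent_unit same_refl /=.
have [W1 _] := unit_at01 lr ba We nz.
have W0 g : g != d -> ent W g c = 0.
  move=> gd; apply/eqP/negPn/negP => nz'; move/eqP: gd; apply.
  exact: unit_at_col lr ba We _ _ _ nz' nz.
have [->|/W0->] := eqVneq e d; last by rewrite mul0r.
have [->|/W0->] := eqVneq f d; last by rewrite conjC0 mulr0.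
by rewrite W1 conjC1 mulr1.
Qed.

Lemma cellM l r (a a' : Rows l) (c c' : Rows r) : (l <= r)%N ->
  cell a c ∘ cell a' c' = if (a == a') && (c == c') then cell a c else 0.
Proof.
move=> lr; have [<-|aa'] := eqVneq a a'; last first.
  rewrite /cell -!cmulA (cmulA (E (base_row a) a)) E_mul0 // cmul0l !cmul0r //.
have sb := base_same a; have bs : same_block (base_row a) a by rewrite same_sym.
rewrite /cell -!cmulA (cmulA (E (base_row a) a)) E_mul // (cmulA (E (base_row a) (base_row a))).
rewrite diag_comm // -(cmulA (E c' c')) (E_mul (same_refl _) bs) (cmulA (E c c)) /=.
have [<-|cc'] := eqVneq c c'; first by rewrite E_mul ?same_refl.
by rewrite E_mul0 // cmul0l cmul0r.
Qed.

Lemma cell_star l r (a : Rows l) (c : Rows r) : cstar (cell a c) = cell a c.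
Proof. by rewrite /cell !cstarM !E_star cmulA. Qed.

Definition slice l r (c : Rows r) : B := \sum_(a : Rows l) cell a c.

Lemma sliceM l r (c c' : Rows r) : (l <= r)%N ->
  slice l c ∘ slice l c' = if c == c' then slice l c else 0.
Proof.
move=> lr; rewrite /slice cmul_suml.
rewrite (eq_bigr (fun i : Rows l => if c == c' then cell i c else 0)) => [|a _]; last first.
  rewrite cmul_sumr (bigD1 a) //= cellM // eqxx /=.
  by rewrite big1 ?addr0 // => a' aa'; rewrite cellM // eq_sym (negPf aa').
by case: eqP => // _; rewrite big1.
Qed.

Lemma slice_star l r (c : Rows r) : cstar (slice l c) = slice l c.
Proof. by rewrite cstar_sum; apply: eq_bigr => a _; rewrite cell_star. Qed.

Lemma slice_proj l r (c : Rows r) : (l <= r)%N -> projection_elt (slice l c).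
Proof. by move=> lr; split; [exact: slice_star|rewrite sliceM // eqxx]. Qed.

(** Conjugation by [E (base_row a) a] permutes the cells of a block. *)
Lemma slice_comm l r (c : Rows r) (x : level S l) :
  slice l c ∘ iota x = iota x ∘ slice l c.
Proof.
rewrite (iota_decomp x) [RHS]cmul_suml {1}/slice [LHS]cmul_suml.
rewrite [LHS](_ : _ = \sum_a cell a c ∘ \sum_b ent x a b *: E a b); last first.
  apply: eq_bigr => a _; rewrite cmul_sumr (bigD1 a) //= [X in _ + X]big1 ?addr0 // => a' aa'.
  rewrite cmul_sumr big1 // => b _.
  by rewrite cmulZr /cell -cmulA E_mul0 ?cmul0r ?scaler0 // eq_sym.
apply: eq_bigr => a _; rewrite [LHS]cmul_sumr [RHS]cmul_suml; apply: eq_bigr => b _.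
rewrite [LHS]cmulZr [RHS]cmulZl; congr (_ *: _).
have [ab|ab] := boolP (same_block a b); last by rewrite E_nsame // cmul0r cmul0l.
have sb := base_same a; have bs : same_block (base_row a) a by rewrite same_sym.
rewrite /slice cmul_sumr (bigD1 b) //= big1 ?addr0 => [|a' ab'].
  rewrite /cell -(base_eq ab) -cmulA E_mul // !cmulA E_mul //.
  by apply: same_trans sb; rewrite same_sym.
by rewrite /cell !cmulA E_mul0 ?cmul0l // eq_sym.
Qed.

Lemma slice_sum l r (x : level S l) : (l <= r)%N ->
  (\sum_(c : Rows r) slice l c) ∘ iota x = iota x.
Proof.
move=> lr; rewrite -[RHS]one_mull /slice exchange_big /=; congr (_ ∘ _).
apply: eq_bigr => a _; have sb := base_same a.
have bs : same_block (base_row a) a by rewrite same_sym.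
rewrite /cell -cmul_suml -cmul_sumr -cmulA.
have [y [yE _]] := lift_level (U (base_row a) a) lr.
rewrite -[E (base_row a) a]/(iota (U (base_row a) a)) -yE one_mull yE.
by rewrite -[iota _]/(E _ _) E_mul.
Qed.

(** Pinching by the slices leaves an approximant [x] of [b] on level [l] fixed, and
    is a block sum, so [b] is close to its pinching.  In a slice, [b] is a sum
    of boundedly many compressions by two cells, a number that depends on [l]
    only; each of them is close to a multiple of a matrix unit of level [r], as
    [r] may be taken high enough for an approximation that is fine compared to
    that number.  A multiple which is not small shows its unit to be near [I],
    hence in [I] by [unit_in_ideal], and so in [J]. *)
Theorem ideal_units (I J : set B) : is_ideal A I -> is_ideal A J ->
  (forall r (a b : Rows r), row_le a b -> I (E a b) -> J (E a b)) ->
  I `<=` J.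
Proof.
move=> idI idJ units b Ib; apply: (closed_nm (ideal_closed idJ)) => e e0.
have Ab := ideal_sub idI Ib.
have e4 : 0 < e / 4 by rewrite divr_gt0.
have [l /(_ l (leqnn l)) [x _ bx]] := A_approx Ab e4.
pose N : R := (#|Rows l| * #|Rows l|)%:R.
have N0 : 0 <= N by exact: ler0n.
pose d := e / 4 / (5 * N + 1).
have d0 : 0 < d by rewrite !divr_gt0 // ltr_wpDl // mulr_ge0.
have dN : 5 * N * d <= e / 4.
  have -> : e / 4 = d * (5 * N + 1) by rewrite divfK // lt0r_neq0 // ltr_wpDl // mulr_ge0.
  nra.
have [r0 /(_ (maxn l r0) (leq_maxr _ _))] := A_approx Ab d0.
have := leq_maxl l r0; move: (maxn l r0) => r lr [x' ux' bx'].
have AEc (c : Rows r) : A (E c c) by apply: A_E; exact: row_le_refl.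
have cellA (a : Rows l) (c : Rows r) : A (cell a c).
  by case: (cell_unit a c lr) => [->|[c' ->] //]; case: A_subspace.
have cells (a a' : Rows l) (c : Rows r) : exists j, J j /\
    nm (cell a c ∘ b ∘ cell a' c - j) <= 5 * d.
  have zero : exists j, J j /\ nm (0 - j) <= 5 * d.
    by exists 0; split; [exact: (ideal0 idJ)|rewrite subrr nm0 mulr_ge0 // ltW].
  case: (cell_unit a c lr) => [->|[c1 E1]]; first by rewrite !cmul0l.
  case: (cell_unit a' c lr) => [->|[c2 E2]]; first by rewrite cmul0r.
  have Iy : I (E c1 c1 ∘ b ∘ E c2 c2) by apply: (idealMr idI) => //; apply: (idealMl idI).
  rewrite E1 E2; move: Iy; set y := _ ∘ _ => Iy.
  pose la := ent x' c1 c2.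
  have yla : nm (y - la *: E c1 c2) <= d.
    rewrite /y -E_compress ?same_refl // -cmulBl -cmulBr.
    exact: le_trans (nm_cut _ _ _ _ _) (ltW bx').
  (* Above the threshold [4 * d], dividing by [la] brings the error [d] below 1/4. *)
  have [small|big] := lerP (nm la) (4 * d).
    exists 0; split; first exact: (ideal0 idJ).
    rewrite subr0; have := nm_lebD y (la *: E c1 c2); rewrite nmZ.
    have := nm_E c1 c2; have := nm_ge0 (E c1 c2); have := nm_ge0 la; nra.
  have la0 : la != 0 by apply: contraTneq big => ->; rewrite nm0 -leNgt mulr_ge0 // ltW.
  have cc : row_le c1 c2 by move/upperP: ux'; apply.
  exists (la *: E c1 c2); split; last by lra.
  apply: (idealZ idJ); apply: units => //.
  apply: (unit_in_ideal idI (y := la^-1 *: y)) => //; first exact: (idealZ idI).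
  have -> : E c1 c2 - la^-1 *: y = la^-1 *: (la *: E c1 c2 - y).
    by rewrite scalerBr scalerA mulVf // scale1r.
  rewrite nmZ nmV nmB mulrC ler_pdivrMr; last by apply: lt_trans big; rewrite mulr_gt0.
  by lra.
pose j a a' c := sval (cid (cells a a' c)).
have jJ a a' c : J (j a a' c) by rewrite /j; case: cid => ? [].
have jn a a' c : nm (cell a c ∘ b ∘ cell a' c - j a a' c) <= 5 * d.
  by rewrite /j; case: cid => ? [].
pose t c := \sum_(a : Rows l) \sum_(a' : Rows l) (cell a c ∘ b ∘ cell a' c - j a a' c).
have tn c : nm (t c) <= e / 4.
  apply: le_trans dN; apply: (le_trans (nm_sum _ _ _)).
  apply: (@le_trans _ _ (\sum_(a : Rows l) \sum_(a' : Rows l) 5 * d)).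
    by apply: ler_sum => a _; apply: (le_trans (nm_sum _ _ _)); apply: ler_sum.
  rewrite !sumr_const -mulrnA -mulr_natr -/N le_eqVlt; apply/orP; left.
  by apply/eqP; ring.
have tE c : t c = slice l c ∘ b ∘ slice l c - \sum_a \sum_a' j a a' c.
  rewrite /t /slice cmul_suml cmul_suml -sumrB; apply: eq_bigr => a _.
  by rewrite cmul_sumr sumrB.
pose q (c : Rows r) := slice l c.
exists (\sum_c q c ∘ (\sum_a \sum_a' j a a' c) ∘ q c).
  have qA c : A (q c).
    have [A0 AD] := A_subspace; rewrite /q /slice; elim/big_rec : _ => // a z _ Az.
    by rewrite -[cell _ _]scale1r; exact: AD.
  apply: (ideal_sum idJ) => c _; apply: (idealMr idJ) => //; apply: (idealMl idJ) => //.
  by apply: (ideal_sum idJ) => a _; apply: (ideal_sum idJ).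
have qp c : projection_elt (q c) by exact: slice_proj.
have qo c c' : c != c' -> q c ∘ q c' = 0 by move=> /negPf cc; rewrite sliceM // cc.
have pin : \sum_c q c ∘ iota x ∘ q c = iota x.
  rewrite -[RHS](slice_sum _ lr) cmul_suml; apply: eq_bigr => c _.
  by rewrite -cmulA -slice_comm cmulA sliceM // eqxx.
have -> : b - \sum_c q c ∘ (\sum_a \sum_a' j a a' c) ∘ q c =
   (b - iota x) - \sum_c q c ∘ (b - iota x) ∘ q c + \sum_c q c ∘ t c ∘ q c.
  have -> : \sum_c q c ∘ (b - iota x) ∘ q c = \sum_c q c ∘ b ∘ q c - iota x.
    by rewrite -[in RHS]pin -sumrB; apply: eq_bigr => c _; rewrite cmulBr cmulBl.
  have -> : \sum_c q c ∘ t c ∘ q c = \sum_c q c ∘ b ∘ q c -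
      \sum_c q c ∘ (\sum_a \sum_a' j a a' c) ∘ q c.
    rewrite -sumrB; apply: eq_bigr => c _; rewrite tE cmulBr cmulBl; congr (_ - _).
    by rewrite !cmulA (qp c).2 -!cmulA (qp c).2.
  by rewrite opprB !subrKA.
have e40 : 0 <= e / 4 by exact: ltW.
have n1 : nm (\sum_c q c ∘ (b - iota x) ∘ q c) <= e / 4.
  by apply: nm_blocks => // c; exact: ltW.
have n2 : nm (\sum_c q c ∘ t c ∘ q c) <= e / 4 by apply: nm_blocks.
apply: le_lt_trans (nmD _ _) _; have := nmD (b - iota x) (- \sum_c q c ∘ (b - iota x) ∘ q c).
by rewrite nmN; lra.
Qed.

End System.


(** * Kernels of essential nest representations *)

Section EssentialKernel.
Variables (R : realType) (B : cstarAlgType R) (S : taf_system R).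
Variable iota : forall i, level S i -> B.
Hypothesis limB : is_AF_limit iota.
Variable A : set B.
Hypothesis AE : A = closure (\bigcup_i (iota (i := i) @` @upper_triangular R _ _)).
Variables (H : hilbertType R) (rho : B -> {linear H -> H}).
Hypothesis rep : is_representation A rho.
Local Notation E := (image_unit iota).

Let AEc r (c : Rows S r) : A (E c c).
Proof. by apply: (A_E AE); exact: row_le_refl. Qed.
Let A0 : A 0. Proof. by case: (A_subspace limB AE). Qed.
Let AZD c x y : A x -> A y -> A (c *: x + y).
Proof. by case: (A_subspace limB AE) => _ h; exact: h. Qed.
Let AD x y : A x -> A y -> A (x + y).
Proof. by move=> Ax Ay; rewrite -[x]scale1r; exact: AZD. Qed.
Let AZ c x : A x -> A (c *: x).
Proof. by move=> Ax; rewrite -[_ *: _]addr0; exact: AZD. Qed.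
Let AB x y : A x -> A y -> A (x - y).
Proof. by move=> Ax Ay; rewrite addrC -scaleN1r; exact: AZD. Qed.
Let AM x y : A x -> A y -> A (x ∘ y).
Proof. exact: (A_mul limB AE). Qed.

Lemma repD a b x : A a -> A b -> rho (a + b) x = rho a x + rho b x.
Proof. by move=> Aa Ab; have := rep_linear rep 1 x Aa Ab; rewrite !scale1r. Qed.
Lemma rep0 x : rho 0 x = 0.
Proof. by apply: (addrI (rho 0 x)); rewrite -repD // !addr0. Qed.
Lemma repZ c a x : A a -> rho (c *: a) x = c *: rho a x.
Proof. by move=> Aa; have := rep_linear rep c x Aa A0; rewrite !addr0 rep0 addr0. Qed.
Lemma repB a b x : A a -> A b -> rho (a - b) x = rho a x - rho b x.
Proof.
move=> Aa Ab; rewrite -[- b]scaleN1r repD //; last exact: AZ.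
by rewrite repZ // scaleN1r.
Qed.
Lemma repM a b x : A a -> A b -> rho (a ∘ b) x = rho a (rho b x).
Proof. exact: (rep_mul rep). Qed.

Lemma rep_bound : exists2 M : R, 0 <= M &
  forall a x, A a -> nm (rho a x) <= M * nm a * nm x.
Proof.
have [M hM] := rep_bounded rep; exists (nm M); first exact: nm_ge0.
move=> a x Aa; have := hM a x Aa => le.
have : 0 <= M * `|a| * `|x| by exact: le_trans (normr_ge0 _) le.
move=> /ger0_norm e; move: le; rewrite -e !normrM !normr_id !nmE -!rmorphM.
by rewrite lecR.
Qed.

Lemma rep_kernel_ideal : is_ideal A (rep_kernel A rho).
Proof.
have [M M0 hM] := rep_bound.
split=> [x []//||x clx|a x Aa [Ax x0]].
- split=> [|c x y [Ax x0] [Ay y0]]; first by split=> // x; exact: rep0.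
  by split=> [|v]; [exact: AZD|rewrite (rep_linear rep) // x0 y0 scaler0 addr0].
- have Ax : A x.
    apply: (closed_nm (A_closed AE)) => e e0.
    by have /closure_nmP/(_ e e0)[y [Ay _] xy] := clx; exists y.
  split=> // v; apply: nm_small => e e0.
  have D0 : 0 < M * nm v + 1 by rewrite ltr_wpDl // mulr_ge0 ?nm_ge0.
  have /closure_nmP/(_ (e / (M * nm v + 1))) := clx.
  case; rewrite ?divr_gt0 // => y [Ay y0]; rewrite ltr_pdivlMr // => xy.
  have := hM _ v (AB Ax Ay); rewrite repB // y0 subr0.
  by have := nm_ge0 v; have := nm_ge0 (x - y); nra.
- by split; split=> [|v]; rewrite ?repM ?x0 ?linear0 //; exact: AM.
Qed.

(** Minimality of [0_+] and maximality of [I_-] are applied to the invariant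
    subspaces that an ideal defines, its common kernel and the closure of its
    orbit of a vector. *)
Lemma Lat_ker (I : set B) : is_ideal A I ->
  Lat A rho [set v | forall c, I c -> rho c v = 0].
Proof.
move=> idI; have [M M0 hM] := rep_bound; have IA := ideal_sub idI; split.
- split=> [c _|k x y hx hy c Ic]; first by rewrite linear0.
  by rewrite linearP hx // hy // scaler0 addr0.
- apply: nm_closed => v hv c Ic; apply: nm_small => e e0.
  have D0 : 0 < M * nm c + 1 by rewrite ltr_wpDl // mulr_ge0 ?nm_ge0.
  have [|w w0] := hv (e / (M * nm c + 1)); first by rewrite divr_gt0.
  rewrite ltr_pdivlMr // => vw; have := hM c (v - w) (IA _ Ic).
  rewrite linearB /= w0 // subr0.
  by have := nm_ge0 c; have := nm_ge0 (v - w); nra.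
- by move=> a v Aa hv c Ic; rewrite -repM ?hv //; [apply: (idealMr idI)|exact: IA].
Qed.

Lemma Lat_orbit (I : set B) v : is_ideal A I ->
  Lat A rho (closure [set rho c v | c in I]).
Proof.
move=> idI; have [M M0 hM] := rep_bound; have IA := ideal_sub idI; split.
- apply: subspace_closure; split.
    by exists 0; [exact: (ideal0 idI)|exact: rep0].
  move=> k _ _ [c Ic <-] [d Id <-]; exists (k *: c + d); first exact: (idealZD idI).
  by rewrite (rep_linear rep) //; exact: IA.
- exact: closed_closure.
- move=> a w Aa /closure_nmP hw; apply/closure_nmP => e e0.
  have D0 : 0 < M * nm a + 1 by rewrite ltr_wpDl // mulr_ge0 ?nm_ge0.
  have [|_ [c Ic <-]] := hw (e / (M * nm a + 1)); first by rewrite divr_gt0.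
  rewrite ltr_pdivlMr // => cw; exists (rho (a ∘ c) v).
    by exists (a ∘ c) => //; apply: (idealMl idI).
  rewrite repM //; last exact: IA.
  rewrite -linearB; apply: le_lt_trans (hM _ _ Aa) _.
  by have := nm_ge0 a; have := nm_ge0 (w - rho c v); nra.
Qed.

Variables (g h : H) (a : B).
Hypothesis g0 : g != 0.
Hypothesis h0 : h != 0.
Hypothesis Lat_g : Lat A rho (line g).
Hypothesis min_g : forall M, Lat A rho M -> M <> [set 0] -> line g `<=` M.
Variable K : set H.
Hypothesis Lat_K : Lat A rho K.
Hypothesis max_K : forall M, Lat A rho M -> M <> setT -> M `<=` K.
Hypothesis perp_K : orthogonal_complement K = line h.
Hypothesis Aa : A a.
Hypothesis rho_a : forall x, rho a x = hdot x h *: g.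

Let hh : hdot h h != 0. Proof. by rewrite dnorm_eq0. Qed.

Lemma KE x : K x <-> hdot x h = 0.
Proof.
split=> [Kx|]; last by case: Lat_K => sK cK _; exact: codim1_perp perp_K _.
have : orthogonal_complement K h by rewrite perp_K; exists 1; rewrite ?scale1r.
exact.
Qed.

Definition fixes_g r (c : Rows S r) := rho (E c c) g = g.
Definition fixes_h r (c : Rows S r) :=
  forall x, hdot (rho (E c c) x) h = hdot x h.

(** [rho (E c c)] is idempotent, and it preserves the line of [g], respectively
    the kernel of [hdot _ h]; so it acts on the line, respectively on the quotient,
    by 0 or 1. *)
Lemma diag_g r (c : Rows S r) : rho (E c c) g = 0 \/ fixes_g c.
Proof.
have [_ _ inv] := Lat_g.
have [k _ kg] : line g (rho (E c c) g).
  by apply: inv; [exact: AEc|exists 1; rewrite ?scale1r].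
have := repM g (AEc c) (AEc c); rewrite (E_mul limB) ?same_refl //.
rewrite -kg linearZ /= -kg scalerA => /eqP; rewrite -subr_eq0 -scalerBl.
rewrite scaler_eq0 (negPf g0) orbF -{1}[k]mulr1 -mulrBr mulf_eq0 subr_eq0.
case/orP => /eqP k0; first by left; rewrite k0 scale0r.
by right; rewrite /fixes_g -kg -[k]k0 scale1r.
Qed.

Lemma diag_h r (c : Rows S r) :
  (forall x, hdot (rho (E c c) x) h = 0) \/ fixes_h c.
Proof.
have [_ _ inv] := Lat_K.
pose k := hdot (rho (E c c) h) h / hdot h h.
have kP x : hdot (rho (E c c) x) h = k * hdot x h.
  pose s := hdot x h / hdot h h.
  have Kx : K (x - s *: h).
    by apply/KE; rewrite linearBl /= linearZl_LR /= divfK ?subrr.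
  have /KE := inv _ _ (AEc c) Kx.
  rewrite linearB linearZ /= linearBl /= linearZl_LR /= => /subr0_eq ->.
  by rewrite /s /k; field.
have := kP (rho (E c c) h); rewrite -repM // (E_mul limB) ?same_refl // !kP mulrA.
move/mulIf => /(_ hh)/eqP; rewrite -subr_eq0 -{1}[k]mulr1 -mulrBr mulf_eq0 subr_eq0.
case/orP => /eqP k0; first by left=> x; rewrite kP k0 mul0r.
by right=> x; rewrite kP -k0 mul1r.
Qed.

Definition level_one r : B := \sum_(c : Rows S r) E c c.

Lemma one_proj r : projection_elt (level_one r).
Proof.
split; rewrite /level_one.
  by rewrite cstar_sum; apply: eq_bigr => c _; rewrite (E_star limB).
have e : level_one r = iota (\sum_(c : Rows S r) munit R c c) by rewrite (iota_sum limB).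
by rewrite -/(level_one r) {2}e (one_mull limB) -e.
Qed.

Lemma one_mulr r (x : level S r) : iota x ∘ level_one r = iota x.
Proof.
rewrite -{1}[iota x]cstarK -(one_proj r).1 -cstarM -(iotaS limB).
by rewrite (one_mull limB) (iotaS limB) cstarK.
Qed.

Lemma A_one r : A (level_one r).
Proof.
by rewrite /level_one; elim/big_rec : _ => // c x _ Ax; exact: AD.
Qed.

(** [A] need not have a unit, but the units of the levels are approximate units. *)
Lemma cut_one b (e : R) : A b -> 0 < e -> exists r0, forall r, (r0 <= r)%N ->
  nm (b - level_one r ∘ b ∘ level_one r) < e.
Proof.
move=> Ab e0; have e2 : 0 < e / 2 by rewrite divr_gt0.
have [r0 hr] := A_approx limB AE Ab e2; exists r0 => r /hr[x _ bx].
have -> : b - level_one r ∘ b ∘ level_one r = (b - iota x) - level_one r ∘ (b - iota x) ∘ level_one r.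
  by rewrite cmulBr cmulBl (one_mull limB) one_mulr opprB subrKA.
have p1 := nm_proj (one_proj r).
have := nmD (b - iota x) (- (level_one r ∘ (b - iota x) ∘ level_one r)); rewrite nmN.
have := nm_cmul (level_one r ∘ (b - iota x)) (level_one r).
have := nm_cmul (level_one r) (b - iota x).
have := nm_ge0 (level_one r); have := nm_ge0 (b - iota x); have := nm_ge0 (level_one r ∘ (b - iota x)).
move: bx p1; move: (nm (level_one r)) (nm (b - iota x)) (nm (level_one r ∘ (b - iota x))) => p q m.
move: (nm _) (nm _) => u v qe p1 m0 q0 p0 mp mu uv.
have : m <= q by nra.
nra.
Qed.

Lemma rho_cell r (c d : Rows S r) x :
  rho (E c c ∘ a ∘ E d d) x = hdot (rho (E d d) x) h *: rho (E c c) g.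
Proof.
by rewrite repM //; [rewrite repM // rho_a linearZ|exact: AM].
Qed.

(** Otherwise all compressions of [rho a] by two diagonal units of the level would
    vanish. *)
Lemma fixing_units : exists r0, forall r, (r0 <= r)%N ->
  exists c d : Rows S r, fixes_g c /\ fixes_h d.
Proof.
have [M M0 hM] := rep_bound.
have ah : 0 < nm (rho a h).
  by apply: nm_gt0; rewrite rho_a scaler_eq0 negb_or hh.
have D0 : 0 < M * nm h + 1 by rewrite ltr_wpDl // mulr_ge0 ?nm_ge0.
have [||r0 hr] := @cut_one a (nm (rho a h) / (M * nm h + 1)) => //.
  by rewrite divr_gt0.
exists r0 => r /hr; rewrite ltr_pdivlMr // => near.
have Ao : A (level_one r ∘ a ∘ level_one r) by apply: AM => //; [apply: AM|]; rewrite //; exact: A_one.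
have nz : rho (level_one r ∘ a ∘ level_one r) h != 0.
  apply/eqP => z; have := hM _ h (AB Aa Ao); rewrite repB // z subr0.
  by have := nm_ge0 h; have := nm_ge0 (a - level_one r ∘ a ∘ level_one r); nra.
apply: contrapT => none; move/eqP: nz; apply.
have rho_sum (I : Type) (s : seq I) (F : I -> B) x : (forall i, A (F i)) ->
    A (\sum_(i <- s) F i) /\ rho (\sum_(i <- s) F i) x = \sum_(i <- s) rho (F i) x.
  move=> AF; elim/big_rec2 : _ => [|i u v _ [Av <-]]; first by split=> //; exact: rep0.
  by split; [exact: AD|rewrite repD].
rewrite /level_one cmul_suml cmul_suml.
have AEE (c d : Rows S r) : A (E c c ∘ a ∘ E d d) by apply: AM => //; exact: AM.
rewrite (rho_sum _ _ _ _ _).2; last first.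
  by move=> c; rewrite cmul_sumr; exact: (rho_sum _ _ _ h (AEE c)).1.
apply: big1 => c _; rewrite cmul_sumr (rho_sum _ _ _ _ (AEE c)).2.
apply: big1 => d _; rewrite rho_cell.
case: (diag_g c) => [->|gc]; first by rewrite scaler0.
case: (diag_h d) => [->|gd]; first by rewrite scale0r.
by case: none; exists c, d.
Qed.

(** On the higher level [E c c] is a diagonal matrix of zeros and ones, and the
    functional excludes the entry 0 at [d]. *)
Lemma fixes_h_mul l r (c : Rows S l) (d : Rows S r) : (l <= r)%N ->
  fixes_h c -> fixes_h d -> E c c ∘ E d d = E d d.
Proof.
move=> lr fc fd; have [P [Pe' _]] := lift_level limB (munit R c c) lr.
have Pe : iota P = E c c := Pe'.
have [Pd P01] := diag_at limB lr Pe.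
have cd : E c c ∘ E d d = ent P d d *: E d d.
  rewrite -Pe /image_unit -(iotaM limB) -(iotaZ limB); congr (iota _).
  apply: ent_ext => e f; rewrite ent_unitMr ?same_refl // entZ ent_unit same_refl /=.
  have [->|ed] := eqVneq e d; last by rewrite Pd // mul0r mulr0.
  by case: eqP.
case: (P01 d) => e; rewrite cd e ?scale1r //.
have := fd h; rewrite -fc -repM // cd e scale0r rep0 linear0l => /esym/eqP.
by rewrite (negPf hh).
Qed.

Lemma hdot_cvg (S' : set H) (z : R[i]) v :
  (forall e : R, 0 < e -> exists2 w, S' w & nm (v - w) < e) ->
  (forall w, S' w -> hdot w h = z) -> hdot v h = z.
Proof.
move=> cl hS; apply/eqP; rewrite -subr_eq0; apply/eqP/nm_small => e e0.
have D0 : 0 < nm h + 1 by have := nm_ge0 h; lra.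
have [|w /hS <-] := cl (e / (nm h + 1)); first by rewrite divr_gt0.
rewrite ltr_pdivlMr // => vw; rewrite -linearBl /=.
have := hdot_bound (v - w) h; have := nm_ge0 h; have := nm_ge0 (v - w); nra.
Qed.

Lemma rho_cvg (S' : set H) b v : A b ->
  (forall e : R, 0 < e -> exists2 w, S' w & nm (v - w) < e) ->
  (forall w, S' w -> rho b w = w) -> rho b v = v.
Proof.
move=> Ab cl hS; have [M M0 hM] := rep_bound.
apply/eqP; rewrite -subr_eq0; apply/eqP/nm_small => e e0.
have D0 : 0 < M * nm b + 1 by rewrite ltr_wpDl // mulr_ge0 ?nm_ge0.
have [|w /hS bw] := cl (e / (M * nm b + 1)); first by rewrite divr_gt0.
rewrite ltr_pdivlMr // => vw.
have -> : rho b v - v = rho b (v - w) - (v - w) by rewrite linearB /= bw opprB subrKA.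
apply: (le_trans (nmD _ _)); rewrite nmN.
by have := hM b (v - w) Ab; have := nm_ge0 (v - w); nra.
Qed.

(** The vectors fixed by the first [n] units and normalized by [h] form nested
    closed convex sets; the image of a multiple of [h] under the last unit lies in
    the set, with a norm bounded independently of [n]. *)
Lemma common_fixed_vector r0 (d : forall n, Rows S (n + r0)) :
  (forall n, fixes_h (d n)) ->
  exists k : H, hdot k h = 1 /\ forall n, rho (E (d n) (d n)) k = k.
Proof.
move=> fd; have [M M0 hM] := rep_bound.
pose C n := [set v : H | hdot v h = 1 /\
  forall m, (m <= n)%N -> rho (E (d m) (d m)) v = v].
pose w := (hdot h h)^-1 *: h.
have wh : hdot w h = 1 by rewrite linearZl_LR /= mulVf.
have [k kC] : exists k : H, forall n, C n k.
  apply: (@nested_convex _ _ C (M * nm w)).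
  - move=> n; apply: nm_closed => v cl; split; first by apply: hdot_cvg cl _ => ? [].
    by move=> m mn; apply: rho_cvg cl _ => // ? [_]; exact.
  - move=> n x y [xh fx] [yh fy]; split.
      rewrite linearZl_LR /= linearDl /= xh yh -[X in _ * X]/(2%:R).
      by rewrite mulVf ?pnatr_eq0.
    by move=> m mn; rewrite linearZ /= linearD /= fx // fy.
  - move=> m n mn v [vh fv]; split=> // m' m'm; apply: fv; exact: leq_trans mn.
  - move=> n; exists (rho (E (d n) (d n)) w); last first.
      apply: (le_trans (hM _ w (AEc _))).
      by rewrite ler_wpM2r ?nm_ge0 // ler_piMr // nm_E.
    split; first by rewrite fd.
    by move=> m mn; rewrite -repM // fixes_h_mul // leq_add2r.
by exists k; split=> [|n]; [case: (kC 0%N)|case: (kC n) => _; exact].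
Qed.

(** Compressing [a] and a suitable [c] in [I] by the units [p] and [q]
    of a high level gives almost multiples of one matrix unit, and [a - p a q] is
    in the kernel. *)
Lemma rank_one_in_ideal (I : set B) : is_ideal A I ->
  rep_kernel A rho `<=` I -> ~ I `<=` rep_kernel A rho -> I a.
Proof.
move=> idI JI nIJ; have [M M0 hM] := rep_bound.
have IA := ideal_sub idI.
have [r0 hr] := fixing_units.
have ex n : exists cd : Rows S (n + r0) * Rows S (n + r0), fixes_g cd.1 /\ fixes_h cd.2.
  by have [c [d cd]] := hr (n + r0)%N (leq_addl _ _); exists (c, d).
pose cd n := sval (cid (ex n)).
have cdP n : fixes_g (cd n).1 /\ fixes_h (cd n).2 by rewrite /cd; case: cid.
have [k [kh fk]] := common_fixed_vector (fun n => (cdP n).2).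
(* Otherwise [k] would lie in the common kernel of [I], hence in [K]. *)
have [c0 Ic0 c0k] : exists2 c, I c & rho c k != 0.
  apply: contrapT => none.
  have /(max_K (Lat_ker idI)) : [set v | forall c, I c -> rho c v = 0] <> setT.
    move=> eT; apply: nIJ => c Ic; split=> [|x]; first exact: IA.
    by have : setT x by []; rewrite -eT; apply.
  move=> /(_ k) Kk; have /KE : K k.
    apply: Kk => c Ic; apply/eqP/negPn/negP => nz; apply: none; by exists c.
  by rewrite kh => /eqP; rewrite oner_eq0.
have gW : line g `<=` closure [set rho c k | c in I].
  apply: min_g (Lat_orbit k idI) _ => e0.
  have : closure [set rho c k | c in I] (rho c0 k) by apply: subset_closure; exists c0.
  by rewrite e0 => /= e; rewrite e eqxx in c0k.
have ng := nm_gt0 g0; have nk := nm_ge0 k.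
have [c Ic ck] : exists2 c, I c & nm (g - rho c k) * (M + 1) < nm g / 4.
  have /closure_nmP/(_ (nm g / 4 / (M + 1))) : closure [set rho c k | c in I] g.
    by apply: gW; exists 1; rewrite ?scale1r.
  have M1 : 0 < M + 1 by lra.
  case=> [|_ [c Ic <-]]; first by rewrite !divr_gt0.
  by rewrite ltr_pdivlMr // => ?; exists c.
apply: (closed_nm (ideal_closed idI)) => e e0.
(* [tau] bounds the multiple for [c] from below, [T] is the factor by which the
   precision [del] of the approximants on the level is lost. *)
pose tau := nm g / (2 * (M + 1) * (nm k + 1)).
have D1 : 0 < 2 * (M + 1) * (nm k + 1) by rewrite !mulr_gt0 // ltr_wpDl.
have tau0 : 0 < tau by rewrite divr_gt0.
pose T := 1 + (nm a + 1) / tau.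
have T0 : 0 < T by rewrite ltr_pwDl // divr_ge0 ?addr_ge0 ?nm_ge0 // ltW.
pose del := Num.min 1 (Num.min (e / (2 * T)) (nm g / 4 / ((M + 1) * (nm k + 1)))).
have D2 : 0 < (M + 1) * (nm k + 1) by rewrite mulr_gt0 // ltr_wpDl.
have del0 : 0 < del by rewrite !lt_min ltr01 !divr_gt0 // mulr_gt0.
have del1 : del <= 1 by rewrite ge_min lexx.
have dele : del * T < e.
  have : del <= e / (2 * T) by rewrite !ge_min lexx orbT.
  by rewrite ler_pdivlMr ?mulr_gt0 // => ?; nra.
have delg : del * ((M + 1) * (nm k + 1)) <= nm g / 4.
  have : del <= nm g / 4 / ((M + 1) * (nm k + 1)) by rewrite !ge_min lexx !orbT.
  by rewrite ler_pdivlMr.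
have [r1 h1] := A_approx limB AE Aa del0.
have [r2 h2] := A_approx limB AE (IA _ Ic) del0.
pose n := maxn r1 r2.
have [x ux ax] := h1 (n + r0)%N (leq_trans (leq_maxl _ _) (leq_addr _ _)).
have [y uy cy] := h2 (n + r0)%N (leq_trans (leq_maxr _ _) (leq_addr _ _)).
move: (cdP n) (fk n); case: (cd n) => p q /= [gp hq] qk.
have Ecut z : nm (E p p ∘ z ∘ E q q) <= nm z by exact: (nm_cut limB).
have Acut z : A z -> A (E p p ∘ z ∘ E q q) by move=> Az; do 2!apply: AM => //.
have Ay : A (iota y) by exact: (A_iota AE).
have ycut : E p p ∘ iota y ∘ E q q = ent y p q *: E p q.
  by apply: (E_compress limB); exact: same_refl.
have xcut : E p p ∘ iota x ∘ E q q = ent x p q *: E p q.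
  by apply: (E_compress limB); exact: same_refl.
have Ac := IA _ Ic.
(* The bound [tau] does not depend on the precision [del], because [k] does not
   depend on the level. *)
have ybig : tau <= nm (ent y p q).
  have e1 : nm (g - rho (E p p ∘ c ∘ E q q) k) <= nm g / 4.
    rewrite repM //; last exact: AM.
    rewrite qk repM // -{1}gp -linearB.
    have := hM (E p p) (g - rho c k) (AEc p); have := nm_E limB p p.
    have := nm_ge0 (E p p); have := nm_ge0 (g - rho c k).
    move: ck; move: (nm (g - rho c k)) (nm (E p p)) (nm (rho _ _)) => u v w.
    move=> ck u0 v0 v1 wle; apply: le_trans wle _.
    have Mv : M * v <= M by rewrite ler_piMr.
    apply: le_trans (ltW ck); rewrite mulrC ler_wpM2l //.
    by apply: (le_trans Mv); rewrite lerDl.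
  have e2 : nm (rho (E p p ∘ (c - iota y) ∘ E q q) k) <= nm g / 4.
    have := hM _ k (Acut _ (AB Ac Ay)); have := Ecut (c - iota y).
    have := nm_ge0 (E p p ∘ (c - iota y) ∘ E q q).
    move: cy delg; move: (nm (c - iota y)) (nm (_ ∘ _)) (nm (rho _ _)) => u v w.
    move=> ud dg v0 vu wle; apply: le_trans wle _.
    apply: le_trans dg; rewrite mulrA [del * _]mulrC.
    apply: ler_pM; rewrite ?mulr_ge0 ?lerDl //.
    by apply: ler_pM; rewrite ?lerDl //; exact: le_trans vu (ltW ud).
  have e3 : nm g <= nm g / 2 + nm (rho (E p p ∘ iota y ∘ E q q) k).
    have -> : rho (E p p ∘ iota y ∘ E q q) k =
       g - (g - rho (E p p ∘ c ∘ E q q) k) - rho (E p p ∘ (c - iota y) ∘ E q q) k.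
      rewrite subKr cmulBr cmulBl repB; [by rewrite subKr|exact: Acut|exact: Acut].
    set u := g - _ in e1 *; set v := rho _ k in e2 *.
    have le_g := nm_lebD g (g - u - v).
    rewrite (_ : g - (g - u - v) = u + v) in le_g; last by rewrite -[g - u - v]addrA -opprD subKr.
    by have := nmD u v; lra.
  have e4 : nm (rho (E p p ∘ iota y ∘ E q q) k) <= M * nm (ent y p q) * nm k.
    apply: (le_trans (hM _ k (Acut _ Ay))); rewrite ycut nmZ.
    have := nm_E limB p q; have := nm_ge0 (E p q); have := nm_ge0 (ent y p q).
    move: (nm (E p q)) (nm (ent y p q)) => u v v0 u0 u1.
    have : v * u <= v by rewrite ler_piMr.
    move=> vu; rewrite ler_wpM2r // ler_wpM2l //.
  rewrite /tau ler_pdivrMr //.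
  have := nm_ge0 (ent y p q); move: e3 e4; move: (nm (ent y p q)) (nm (rho _ _)) => v w.
  move=> e3 e4 v0; have vle : M * v * nm k <= (M + 1) * v * (nm k + 1).
    by rewrite ler_pM ?mulr_ge0 ?ler_wpM2r ?lerDl.
  lra.
have y0 : ent y p q != 0.
  by apply: contraTneq ybig => ->; rewrite nm0 -ltNge.
have spq : same_block p q by exact: ent_same y0.
have xle : nm (ent x p q) <= nm a + 1.
  have := Ecut (iota x); rewrite xcut nmZ (nm_E1 limB) // mulr1 => /le_trans; apply.
  apply: (le_trans (nm_lebD _ a)); rewrite lerD2l nmB.
  exact: le_trans (ltW ax) del1.
pose s := ent x p q / ent y p q.
have sle : nm s <= (nm a + 1) / tau.
  rewrite nmM nmV ler_pM ?invr_ge0 ?nm_ge0 // lef_pV2 ?posrE //.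
  exact: lt_le_trans ybig.
exists ((a - E p p ∘ a ∘ E q q) + s *: (E p p ∘ c ∘ E q q)).
  have [_ ID] := (idealZD idI, idealD idI); apply: ID; last first.
    by apply: (idealZ idI); apply: (idealMr idI) => //; apply: (idealMl idI).
  apply: JI; split=> [|v]; first by apply: AB => //; exact: Acut.
  by rewrite repB ?rho_cell ?rho_a ?hq ?gp ?subrr //; exact: Acut.
have -> : a - (a - E p p ∘ a ∘ E q q + s *: (E p p ∘ c ∘ E q q)) =
   E p p ∘ (a - iota x) ∘ E q q - s *: (E p p ∘ (c - iota y) ∘ E q q).
  rewrite !cmulBr !cmulBl xcut ycut scalerBr scalerA divfK // opprD addrA subKr.
  by rewrite opprB addrA subrK.
apply: le_lt_trans dele; apply: (le_trans (nmD _ _)); rewrite nmN nmZ.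
have := Ecut (a - iota x); have := Ecut (c - iota y).
have := nm_ge0 s; have := nm_ge0 (E p p ∘ (c - iota y) ∘ E q q).
move: ax cy sle; rewrite /T; move: ((nm a + 1) / tau) => t.
move: (nm (E p p ∘ (c - iota y) ∘ E q q)) (nm (E p p ∘ (a - iota x) ∘ E q q)).
move: (nm (a - _)) (nm (c - _)) (nm s) => u v w z z' ud vd wt z0 w0 zv zu.
have wz : w * z <= t * del by rewrite ler_pM // (le_trans zv (ltW vd)).
by rewrite mulrDr mulr1 [del * t]mulrC lerD // (le_trans zu (ltW ud)).
Qed.


End EssentialKernel.

(** The default values of [zero_plus] and [I_minus] are excluded by the dimensions
    of the two lines. *)
Theorem essential_kernel_cmi (R : realType) (B : cstarAlgType R) (A J : set B)
    (H : hilbertType R) (rho : B -> {linear H -> H}) :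
  strongly_maximal_TAF A -> essential_nest_representation A rho ->
  J = rep_kernel A rho -> completely_meet_irreducible A J.
Proof.
move=> [S [iota [limB AE]]] [[rep _] [g' g'0 Zg'] [h' h'0 Ph']] [g [h [Zg Ph [a Aa rho_a]]]] ->.
have line_self (v : H) : line v v by exists 1; rewrite ?scale1r.
have g0 : g != 0.
  apply: contraNneq g'0 => g0; have : line g g' by rewrite -Zg Zg'.
  by rewrite g0 => -[c _ <-]; rewrite scaler0.
have h0 : h != 0.
  apply: contraNneq h'0 => h0; have : line h h' by rewrite -Ph Ph'.
  by rewrite h0 => -[c _ <-]; rewrite scaler0.
have [Lg _ ming] : [/\ Lat A rho (line g), line g <> [set 0] &
    forall L, Lat A rho L -> L <> [set 0] -> line g `<=` L].
  rewrite -Zg /zero_plus; set P := [set M | _].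
  have [ex|none] := pselect (exists M, P M); first exact: (xgetPex [set 0] ex).
  have e : xget [set 0] P = [set 0] by apply: xgetPN => M PM; apply: none; exists M.
  have : line g g by []; rewrite -Zg /zero_plus -/P e => /eqP.
  by rewrite (negPf g0).
pose K := I_minus (Lat A rho).
have [LK _ maxK] : [/\ Lat A rho K, K <> setT &
    forall L, Lat A rho L -> L <> setT -> L `<=` K].
  rewrite /K /I_minus; set P := [set M | _].
  have [ex|none] := pselect (exists M, P M); first exact: (xgetPex setT ex).
  have e : xget setT P = setT by apply: xgetPN => M PM; apply: none; exists M.
  have : orthogonal_complement (I_minus (Lat A rho)) h by rewrite Ph.
  rewrite /I_minus -/P e => /(_ h I)/eqP.
  by rewrite dnorm_eq0 (negPf h0).
have idJ := rep_kernel_ideal limB AE rep.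
split=> // F FI JE; apply: contrapT => nFJ.
have : rep_kernel A rho a.
  rewrite JE; split=> // I FI'; have [idI JI] := FI I FI'.
  apply: (rank_one_in_ideal limB AE rep g0 h0 Lg ming LK maxK Ph Aa rho_a idI JI).
  move=> IJ; apply: nFJ; suff -> : rep_kernel A rho = I by [].
  by apply/seteqP.
case=> _ /(_ h)/eqP; rewrite rho_a scaler_eq0 (negPf g0) orbF dnorm_eq0.
by rewrite (negPf h0).
Qed.


(** * Towers of matrix units outside an ideal *)

Section GeneratedIdeal.
Variables (R : realType) (B : cstarAlgType R) (A J : set B) (u : B).
Hypotheses (sA : subspace A) (cA : closed A).
Hypothesis mA : forall a b, A a -> A b -> A (a ∘ b).
Hypothesis idJ : is_ideal A J.
Hypothesis Au : A u.

Definition sum_around (s : seq (B * B)) : B := \sum_(p <- s) p.1 ∘ u ∘ p.2.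
Definition all_in (s : seq (B * B)) := forall p, p \in s -> A p.1 /\ A p.2.

(** The closed ideal generated by [J] and [u], when [u] is of the form [e u f] with
    [e], [f] in [A]. *)
Definition generated : set B :=
  closure [set w | exists2 s, all_in s & J (w - sum_around s)].

Let AZD c x y : A x -> A y -> A (c *: x + y).
Proof. by case: sA => _; apply. Qed.

Lemma all_in_cons p s : all_in (p :: s) -> [/\ A p.1, A p.2 & all_in s].
Proof.
move=> h; have [? ?] := h p (mem_head _ _); split=> // q qs.
by apply: h; rewrite inE qs orbT.
Qed.

Lemma sum_around_in s : all_in s -> A (sum_around s).
Proof.
rewrite /sum_around; elim: s => [_|p s IH /all_in_cons[A1 A2 /IH As]].
  by rewrite big_nil; case: sA.
by rewrite big_cons -[_ ∘ _]scale1r; apply: AZD => //; do 2!apply: mA => //.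
Qed.

Lemma generated_ideal : is_ideal A generated.
Proof.
have JA := ideal_sub idJ.
have inA w : (exists2 s, all_in s & J (w - sum_around s)) -> A w.
  move=> [s /sum_around_in As /JA Aw].
  by rewrite -[w](subrK (sum_around s)) -[w - _]scale1r; exact: AZD.
have sub : generated `<=` A.
  move=> w /closure_nmP cl; apply: (closed_nm cA) => e /cl[v /inA Av ?].
  by exists v.
split=> //; [apply: subspace_closure; split|exact: closed_closure|].
- exists [::] => //; rewrite /sum_around big_nil subr0; exact: (ideal0 idJ).
- move=> c w v [s As Jw] [t At Jv].
  exists ([seq (c *: p.1, p.2) | p <- s] ++ t).
    move=> p; rewrite mem_cat => /orP[/mapP[q /As[Aq1 Aq2] ->]|/At //].
    by split=> //=; rewrite -[_ *: _]addr0; apply: AZD => //; case: sA.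
  rewrite /sum_around big_cat big_map /= -/(sum_around t).
  have -> : \sum_(p <- s) (c *: p.1) ∘ u ∘ p.2 = c *: sum_around s.
    by rewrite /sum_around scaler_sumr; apply: eq_bigr => p _; rewrite !cmulZl.
  rewrite opprD addrACA -scalerBr; exact: (idealZD idJ).
- move=> a w Aa /closure_nmP cl.
  have n1 : 0 < nm a + 1 by have := nm_ge0 a; lra.
  split; apply/closure_nmP => e e0; have [|v [s As Jv]] := cl (e / (nm a + 1)); rewrite ?divr_gt0 //.
    rewrite ltr_pdivlMr // => wv; exists (a ∘ v); last first.
      rewrite -cmulBr; apply: le_lt_trans (nm_cmul _ _) _.
      by have := nm_ge0 a; have := nm_ge0 (w - v); nra.
    exists [seq (a ∘ p.1, p.2) | p <- s].
      by move=> p /mapP[q /As[Aq1 Aq2] ->]; split=> //=; exact: mA.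
    have -> : sum_around [seq (a ∘ p.1, p.2) | p <- s] = a ∘ sum_around s.
      by rewrite /sum_around big_map cmul_sumr; apply: eq_bigr => p _; rewrite /= !cmulA.
    by rewrite -cmulBr; apply: (idealMl idJ).
  rewrite ltr_pdivlMr // => wv; exists (v ∘ a); last first.
    rewrite -cmulBl; apply: le_lt_trans (nm_cmul _ _) _.
    by have := nm_ge0 a; have := nm_ge0 (w - v); nra.
  exists [seq (p.1, p.2 ∘ a) | p <- s].
    by move=> p /mapP[q /As[Aq1 Aq2] ->]; split=> //=; exact: mA.
  have -> : sum_around [seq (p.1, p.2 ∘ a) | p <- s] = sum_around s ∘ a.
    by rewrite /sum_around big_map cmul_suml; apply: eq_bigr => p _; rewrite /= !cmulA.
  by rewrite -cmulBl; apply: (idealMr idJ).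
Qed.

Lemma generated_sub : J `<=` generated.
Proof.
move=> w Jw; apply: subset_closure; exists [::] => //.
by rewrite /sum_around big_nil subr0.
Qed.

Lemma generated_mem e f : A e -> A f -> e ∘ u ∘ f = u -> generated u.
Proof.
move=> Ae Af euf; apply: subset_closure; exists [:: (e, f)].
  by move=> p; rewrite inE => /eqP->.
by rewrite /sum_around big_seq1 euf subrr; exact: (ideal0 idJ).
Qed.

End GeneratedIdeal.

Section Tower.
Variables (R : realType) (B : cstarAlgType R) (S : taf_system R).
Variable iota : forall i, level S i -> B.
Hypothesis limB : is_AF_limit iota.
Variable A : set B.
Hypothesis AE : A = closure (\bigcup_i (iota (i := i) @` @upper_triangular R _ _)).
Local Notation E := (image_unit iota).

Lemma iota_phiU r (a b : Rows S r) : iota (phi (munit R a b)) = E a b.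
Proof. exact: (iota_phi limB). Qed.

Lemma ent_at_compress l r (a b : Rows S l) (V P Q W : level S r) : (l <= r)%N ->
  iota P = E a a -> iota Q = E b b -> iota W = iota P ∘ iota V ∘ iota Q ->
  forall c d, ent W c d = ent P c c * ent V c d * ent Q d d.
Proof.
move=> lr Pe Qe We c d; have [Pd _] := diag_at limB lr Pe.
have [Qd _] := diag_at limB lr Qe; rewrite -ent_diagM //; congr (ent _ c d).
by apply: (iota_inj limB); rewrite !(iotaM limB) We cmulA.
Qed.

Variables x y : forall i, Rows S i.
Hypothesis xy : forall i, row_le (x i) (y i).
Hypothesis step : forall i, ent (phi (munit R (x i) (y i))) (x i.+1) (y i.+1) != 0.

Definition in_tower i (a : Rows S i) := row_le (x i) a && row_le a (y i).
Local Notation inS := in_tower.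

Lemma inS_x i : inS (x i). Proof. by rewrite /in_tower row_le_refl xy. Qed.
Lemma inS_y i : inS (y i). Proof. by rewrite /in_tower row_le_refl xy. Qed.

Lemma inS_same i (a b : Rows S i) : inS a -> inS b -> same_block a b.
Proof.
move=> /andP[/row_le_same xa _] /andP[/row_le_same xb _].
by apply: same_trans xb; rewrite same_sym.
Qed.

Lemma inS_between i (a b c : Rows S i) : inS a -> inS c ->
  row_le a b -> row_le b c -> inS b.
Proof.
move=> /andP[xa _] /andP[_ cy] ab bc.
by rewrite /in_tower (row_le_trans xa ab) (row_le_trans bc cy).
Qed.

(** Being a summand is transitive: the unit of level [l] of the tower dominates
    all the later ones. *)
Lemma corner_ent l r (V : level S r) : (l <= r)%N -> iota V = E (x l) (y l) ->
  ent V (x r) (y r) = 1.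
Proof.
move=> lr Ve; have sxy := row_le_same (xy l).
suff nz : ent V (x r) (y r) != 0 by have [] := unit_at01 limB lr sxy Ve nz.
elim: r lr V Ve => [|r IH].
  rewrite leqn0 => /eqP l0; subst l => V /(iota_inj limB) ->.
  by rewrite ent_unit (row_le_same (xy 0)) !eqxx oner_eq0.
rewrite leq_eqVlt => /orP[/eqP lr|].
  by subst l => V /(iota_inj limB) ->; rewrite ent_unit (row_le_same (xy _)) !eqxx oner_eq0.
rewrite ltnS => lr V Ve.
have [W [We _]] := lift_level limB (munit R (x l) (y l)) lr.
have {IH} W1 : ent W (x r) (y r) = 1.
  by have [] := unit_at01 limB lr sxy We (IH lr W We).
have e : iota (phi (munit R (x r) (y r))) =
    iota (phi (munit R (x r) (x r))) ∘ iota V ∘ iota (phi (munit R (y r) (y r))).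
  rewrite !iota_phiU Ve -[E (x l) (y l)]/(iota (munit R (x l) (y l))) -We.
  by rewrite (E_compress limB) ?same_refl // W1 scale1r.
have := step r.
rewrite (ent_at_compress (leqnSn r) (iota_phiU (x r) (x r)) (iota_phiU (y r) (y r)) e).
by apply: contra => /eqP->; rewrite mulr0 mul0r.
Qed.

Variable J : set B.
Hypothesis idJ : is_ideal A J.
Hypothesis notJ : forall i, ~ J (E (x i) (y i)).
Hypothesis cof : forall I, is_ideal A I -> J `<=` I -> ~ I `<=` J ->
  forall i, I (E (x i) (y i)).

(** The unit [E (x i) (y i)] factors through [E a b]. *)
Lemma alive i (a b : Rows S i) : inS a -> inS b -> row_le a b -> ~ J (E a b).
Proof.
move=> Sa Sb ab JE; apply: (@notJ i).
have xa : row_le (x i) a by case/andP: Sa.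
have by_ : row_le b (y i) by case/andP: Sb.
have -> : E (x i) (y i) = E (x i) a ∘ E a b ∘ E b (y i).
  rewrite !(E_mul limB) //; try exact: row_le_same.
  exact: same_trans (row_le_same xa) (row_le_same ab).
by apply: (idealMr idJ); [exact: (A_E AE)|apply: (idealMl idJ) => //; exact: (A_E AE)].
Qed.

(** With upper triangular approximants of its factors, a product [p u q] has
    entries only at places which contain, in the sense of the order of rows and
    columns, an entry of [u]. *)
Lemma sum_around_approx (u : B) s (e : R) : all_in A s -> 0 < e ->
  exists r0, forall r, (r0 <= r)%N -> forall W : level S r, iota W = u ->
  exists z : level S r, nm (sum_around u s - iota z) < e /\
    forall c d, ent z c d != 0 -> exists c' d',
      [/\ row_le c c', row_le d' d & ent W c' d' != 0].
Proof.
elim: s e => [|[p q] s IH] e.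
  move=> _ e0; exists 0%N => r _ W _; exists 0; split.
    by rewrite /sum_around big_nil (iota0 limB) subrr nm0.
  by move=> c d; rewrite ent0 eqxx.
move=> /all_in_cons[/= Ap Aq As] e0; have e2 : 0 < e / 2 by rewrite divr_gt0.
have [r1 h1] := IH _ As e2.
have nu := nm_ge0 u; have np := nm_ge0 p; have nq := nm_ge0 q.
(* A modulus of continuity of the product at [p], [q]. *)
pose K := (nm u + 1) * (nm p + nm q + 2).
have K0 : 0 < K by rewrite mulr_gt0 //; lra.
pose d := Num.min 1 (e / 2 / K).
have d0 : 0 < d by rewrite lt_min ltr01 !divr_gt0.
have d1 : d <= 1 by rewrite ge_min lexx.
have dK : d * K <= e / 2.
  by rewrite -ler_pdivlMr // ge_min lexx orbT.
have [r2 h2] := A_approx limB AE Ap d0; have [r3 h3] := A_approx limB AE Aq d0.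
exists (maxn r1 (maxn r2 r3)) => r; rewrite !geq_max => /and3P[rr1 rr2 rr3] W We.
have [z [zn zP]] := h1 r rr1 W We.
have [p' /upperP up pp'] := h2 r rr2; have [q' /upperP uq qq'] := h3 r rr3.
exists (msum_mul (msum_mul p' W) q' + z); split.
  rewrite /sum_around big_cons -/(sum_around u s) (iotaD limB) !(iotaM limB) We /=.
  rewrite opprD addrACA; apply: le_lt_trans (nmD _ _) _; rewrite [e]splitr.
  apply: ler_ltD => //; apply: le_trans dK.
  have -> : p ∘ u ∘ q - iota p' ∘ u ∘ iota q' =
     (p - iota p') ∘ u ∘ q + iota p' ∘ u ∘ (q - iota q').
    by rewrite !cmulBl cmulBr subrKA.
  have n1 : nm ((p - iota p') ∘ u ∘ q) <= d * nm u * nm q.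
    apply: (le_trans (nm_cmul _ _)); rewrite ler_wpM2r //.
    by apply: (le_trans (nm_cmul _ _)); rewrite ler_wpM2r // ltW.
  have np' : nm (iota p') <= nm p + 1.
    by have := nm_lebD (iota p') p; rewrite nmB; lra.
  have n2 : nm (iota p' ∘ u ∘ (q - iota q')) <= (nm p + 1) * nm u * d.
    apply: (le_trans (nm_cmul _ _)); apply: ler_pM; rewrite ?nm_ge0 ?(ltW qq') //.
    by apply: (le_trans (nm_cmul _ _)); rewrite ler_wpM2r.
  apply: (le_trans (nmD _ _)); rewrite /K.
  have -> : d * ((nm u + 1) * (nm p + nm q + 2)) =
    d * nm u * nm q + (nm p + 1) * nm u * d + d * (nm u + (nm p + nm q + 2)) by ring.
  have : 0 <= d * (nm u + (nm p + nm q + 2)) by rewrite mulr_ge0 ?(ltW d0) //; lra.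
  lra.
move=> c f; rewrite entD => nz.
have [z0|/zP //] := eqVneq (ent z c f) 0.
rewrite z0 addr0 in nz.
have [g [/entM_neq0[g' [/up cg' nzW]] /uq gf]] := entM_neq0 nz.
by exists g', g.
Qed.

Lemma msum3_neq0 r (X V Y : level S r) c d :
  ent (msum_mul X (msum_mul V Y)) c d != 0 ->
  exists c1 d1, [/\ ent X c c1 != 0, ent V c1 d1 != 0 & ent Y d1 d != 0].
Proof.
by move=> /entM_neq0[c1 [nX /entM_neq0[d1 [nV nY]]]]; exists c1, d1.
Qed.

(** A second entry [E a b] strictly inside the corner lies in every ideal strictly
    above [J], in particular in the ideal generated by [J] and [u], the unit of
    the tower on the same level [m].  So [E a b] is, up to [J] and 1/4, a sum of
    products around [u].  On a high level [r], [u] is a matrix [W], and every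
    entry of [W] in the tower strictly contains an entry of [E a b], which is
    not in [J]; by the approximation that one contains an entry of [W] again.
    The rows of these entries of [W] increase for ever. *)
Lemma corner_only l m (V : level S m) : (l <= m)%N -> iota V = E (x l) (y l) ->
  forall a b, inS a -> inS b -> ent V a b != 0 -> a = x m /\ b = y m.
Proof.
move=> lm Ve a b Sa Sb nz; have sxy := row_le_same (xy l).
have V1 := corner_ent lm Ve; have V1' : ent V (x m) (y m) != 0 by rewrite V1 oner_eq0.
have [Vab _] := unit_at01 limB lm sxy Ve nz.
have [ax|ax] := eqVneq a (x m).
  subst a; split=> //; apply/eqP/negPn/negP => bY.
  have [_ /(_ b bY) e] := unit_at01 limB lm sxy Ve V1'.
  by rewrite e eqxx in nz.
have [bY|bY] := eqVneq b (y m).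
  by subst b; split=> //; exact: (unit_at_col limB lm sxy Ve nz V1').
exfalso.
have uV := upper_at limB lm Ve (xy l); have ab : row_le a b by move/upperP: uV; apply.
have xa : row_le (x m) a by case/andP: Sa.
have by_ : row_le b (y m) by case/andP: Sb.
pose u := E (x m) (y m).
have Au : A u by apply: (A_E AE).
have AEE c : A (E (c : Rows S m) c) by apply: (A_E AE); exact: row_le_refl.
have sA := A_subspace limB AE; have cA := A_closed AE; have mA := A_mul limB AE.
pose I := generated A J u.
have idI : is_ideal A I by exact: generated_ideal.
have Iu : I u.
  apply: (generated_mem idJ (AEE (x m)) (AEE (y m))).
  by rewrite /u !(E_mul limB) ?same_refl ?(row_le_same (xy m)).
have Iv : I (E a b).
  have -> : E a b = E a a ∘ E (x l) (y l) ∘ E b b.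
    by rewrite -Ve (E_compress limB) ?same_refl // Vab scale1r.
  apply: (idealMr idI) => //; apply: (idealMl idI) => //.
  by apply: cof => // [|IJ]; [exact: generated_sub|exact: (@notJ m (IJ _ Iu))].
have e8 : 0 < 8^-1 :> R by rewrite invr_gt0.
have /closure_nmP/(_ _ e8)[w [s As Jw] vw] := Iv.
have [r0 /(_ (maxn m r0) (leq_maxr _ _))] := sum_around_approx u As e8.
have := leq_maxl m r0; move: (maxn m r0) => r mr hz.
have [W [We' _]] := lift_level limB (munit R (x m) (y m)) mr.
have We : iota W = u := We'.
have [z [zn zP]] := hz W We.
have [X [Xe' _]] := lift_level limB (munit R (x m) a) mr; have Xe : iota X = E (x m) a := Xe'.
have [Y [Ye' _]] := lift_level limB (munit R b (y m)) mr; have Ye : iota Y = E b (y m) := Ye'.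
have [Z [Ze' _]] := lift_level limB (munit R a b) mr; have Ze : iota Z = E a b := Ze'.
have WXYZ : W = msum_mul X (msum_mul Z Y).
  apply: (iota_inj limB); rewrite !(iotaM limB) We Xe Ye Ze !(E_mul limB) //;
    try exact: row_le_same.
  exact: same_trans (row_le_same ab) (row_le_same by_).
have /upperP uX := upper_at limB mr Xe xa; have /upperP uY := upper_at limB mr Ye by_.
have /upperP uZ := upper_at limB mr Ze ab; have /upperP uW := upper_at limB mr We (xy m).
have W1 := corner_ent mr We.
(* [nX], [nZ], [nY]: [W] is the product of [E (x m) a], [E a b] and [E b (y m)], and
   the first factor is off-diagonal. *)
have next c d : inS c -> inS d -> ent W c d != 0 -> exists c' d',
    [/\ inS c', inS d', ent W c' d' != 0, row_le c c' & c != c'].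
  move=> Sc Sd; rewrite {1}WXYZ => /msum3_neq0[c1 [d1 [nX nZ nY]]].
  have cc1 := uX _ _ nX; have d1d := uY _ _ nY; have c1d1 := uZ _ _ nZ.
  have ncc1 : c != c1.
    apply/eqP => e; subst c1; move: nX.
    by rewrite (unit_at_offdiag limB mr (row_le_same xa) Xe) ?eqxx // eq_sym.
  have Sc1 : inS c1 by apply: inS_between Sc Sd cc1 _; exact: row_le_trans d1d.
  have Sd1 : inS d1 by apply: inS_between Sc Sd _ d1d; exact: row_le_trans c1d1.
  have nJ := alive Sc1 Sd1 c1d1.
  have [Z1 _] := unit_at01 limB mr (row_le_same ab) Ze nZ.
  have AEr (c0 : Rows S r) : A (E c0 c0) by apply: (A_E AE); exact: row_le_refl.
  have nz0 : ent z c1 d1 != 0.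
    apply/eqP => z0; apply: nJ.
    apply: (unit_in_ideal limB AE idJ (y := E c1 c1 ∘ (w - sum_around u s) ∘ E d1 d1)) => //.
      by apply: (idealMr idJ) => //; apply: (idealMl idJ).
    have -> : E c1 d1 - E c1 c1 ∘ (w - sum_around u s) ∘ E d1 d1 =
        E c1 c1 ∘ ((E a b - w) + (sum_around u s - iota z)) ∘ E d1 d1.
      rewrite !(cmulDl, cmulDr, cmulNl, cmulNr) -Ze !(E_compress limB) ?same_refl //.
      by rewrite Z1 scale1r z0 scale0r oppr0 addr0 opprD opprK addrA.
    have n0 := nmD (E a b - w) (sum_around u s - iota z).
    by apply: (le_trans (nm_cut limB _ _ _ _ _)); lra.
  have [c' [d' [c1c' d'd1 nW]]] := zP _ _ nz0.
  have c'd' := uW _ _ nW.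
  have Sc' : inS c' by apply: inS_between Sc1 Sd1 c1c' _; exact: row_le_trans d'd1.
  have Sd' : inS d' by apply: inS_between Sc1 Sd1 _ d'd1; exact: row_le_trans c'd'.
  exists c', d'; split=> //; first exact: row_le_trans c1c'.
  apply: contra_neq ncc1 => e; subst c'.
  exact: row_le_anti.
(* Strictly increasing rows of one block have increasing positions. *)
have climb k : exists c d, [/\ inS c, inS d, ent W c d != 0 & (k <= tagged c)%N].
  elim: k => [|k [c [d [Sc Sd nW kc]]]].
    by exists (x r), (y r); rewrite inS_x inS_y W1 oner_eq0.
  have [c' [d' [Sc' Sd' nW' cc' ncc']]] := next c d Sc Sd nW.
  exists c', d'; split=> //; apply: leq_ltn_trans kc _.
  have scc := row_le_same cc'.
  rewrite ltnNge; apply: contra ncc' => le; apply/eqP; apply: row_le_anti cc' _.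
  by rewrite /row_le same_sym scc.
have [c [d [Sc _ _]]] := climb (msize (tag (x r))).
have := inS_same (inS_x r) Sc; rewrite /same_block => /eqP ->.
by rewrite leqNgt ltn_ord.
Qed.

End Tower.


(** * The direct limit of the rows of a tower *)

Section DirectLimit.
Variables (X : nat -> finType) (D : forall i, pred (X i)).
Variables (al : forall i, X i -> X i.+1) (x0 : X 0).
Hypothesis Dx0 : D x0.
Hypothesis Dal : forall i (a : X i), D a -> D (al a).
Hypothesis al_inj : forall i (a b : X i), D a -> D b -> al a = al b -> a = b.

(** The first representative of a point of the direct limit, found by taking
    preimages as long as possible.  The limit is the type of these normal forms,
    which avoids a quotient. *)
Fixpoint germ i : X i -> {i : nat & X i} :=
  match i with
  | 0 => fun a => Tagged X a
  | j.+1 => fun b => if [pick a | D a && (al a == b)] is Some a then germ a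
                     else Tagged X b
  end.

Lemma germ_tag i (a : X i) : (tag (germ a) <= i)%N.
Proof.
elim: i a => [|i IH] a //=; case: pickP => [b _|//].
exact: leq_trans (IH b) (leqnSn i).
Qed.

Lemma germ_al i (a : X i) : D a -> germ (al a) = germ a.
Proof.
move=> Da /=; case: pickP => [b /andP[Db /eqP e]|/(_ a)]; first by rewrite (al_inj Db Da e).
by rewrite Da eqxx.
Qed.

Lemma germ_inj i (a b : X i) : D a -> D b -> germ a = germ b -> a = b.
Proof.
elim: i a b => [|i IH] a b Da Db /=; first exact: eq_from_Tagged.
case: pickP => [a' /andP[Da' /eqP <-]|na]; case: pickP => [b' /andP[Db' /eqP <-]|nb].
- by move/(IH _ _ Da' Db') ->.
- by move=> e; have := germ_tag a'; rewrite e /= ltnn.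
- by move=> e; have := germ_tag b'; rewrite -e /= ltnn.
- exact: eq_from_Tagged.
Qed.

Definition germ_pred (t : {i : nat & X i}) :=
  `[< exists i (a : X i), D a /\ t = germ a >].

Definition dlim : choiceType := {t : {i : nat & X i} | germ_pred t}.

Lemma germ_predP i (a : X i) : D a -> germ_pred (germ a).
Proof. by move=> Da; apply/asboolP; exists i, a. Qed.

Definition dlim0 : dlim := exist _ (germ x0) (germ_predP Dx0).

Definition pt i (a : X i) : dlim := insubd dlim0 (germ a).

Lemma val_pt i (a : X i) : D a -> val (pt a) = germ a.
Proof. by move=> Da; rewrite /pt insubdK //; exact: germ_predP. Qed.

Lemma pt_al i (a : X i) : D a -> pt (al a) = pt a.
Proof. by move=> Da; apply: val_inj; rewrite !val_pt ?germ_al //; exact: Dal. Qed.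

Lemma pt_inj i (a b : X i) : D a -> D b -> pt a = pt b -> a = b.
Proof. by move=> Da Db /(congr1 val); rewrite !val_pt //; exact: germ_inj. Qed.

Lemma pt_surj (t : dlim) : exists r0, forall r, (r0 <= r)%N ->
  exists2 a : X r, D a & t = pt a.
Proof.
have /asboolP[i [a [Da e]]] := valP t; exists i.
have {e} te : t = pt a by apply: val_inj; rewrite val_pt.
elim=> [|r IH]; first by rewrite leqn0 => /eqP i0; subst i; exists a.
rewrite leq_eqVlt => /orP[/eqP ir|]; first by subst i; exists a.
by rewrite ltnS => /IH[b Db ->]; exists (al b); rewrite ?pt_al //; exact: Dal.
Qed.

Definition stage r : {fset dlim} := [fset pt a | a in [pred a : X r | D a]]%fset.

Lemma stageP r t : reflect (exists2 a : X r, D a & t = pt a) (t \in stage r).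
Proof.
rewrite /stage; apply: (iffP (imfsetP _ _ _ _)) => [[a Da ->]|[a Da ->]]; exists a => //.
Qed.

Lemma stage_exhaust (s : {fset dlim}) : exists r0, forall r, (r0 <= r)%N ->
  (s `<=` stage r)%fset.
Proof.
elim/finSet_rect: s => s IH.
have [->|[t ts]] := fset_0Vmem s; first by exists 0%N => r _; exact: fsub0set.
have [r1 h1] := IH _ (fproperD1 ts); have [r2 h2] := pt_surj t.
exists (maxn r1 r2) => r; rewrite geq_max => /andP[/h1 sub /h2 tr].
rewrite -(fsetD1K ts); apply/fsubsetP => t'; rewrite !inE => /orP[/eqP->|h].
  exact/stageP.
by move/fsubsetP: sub; apply; rewrite !inE.
Qed.

Lemma stage_mono r r' : (r <= r')%N -> (stage r `<=` stage r')%fset.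
Proof.
move=> rr'; apply/fsubsetP => t /stageP[a Da ->]; elim: r' rr' => [|r' IH].
  by rewrite leqn0 => /eqP r0; subst r; apply/stageP; exists a.
rewrite leq_eqVlt => /orP[/eqP e|]; first by subst r; apply/stageP; exists a.
rewrite ltnS => /IH/stageP[b Db ->]; apply/stageP; exists (al b); first exact: Dal.
by rewrite pt_al.
Qed.

Lemma sum_stage (V : nmodType) r (F : dlim -> V) :
  \sum_(t <- stage r) F t = \sum_(a : X r | D a) F (pt a).
Proof.
rewrite big_imfset /=; last by move=> a b Da Db; exact: pt_inj.
by rewrite big_enum_cond /=; apply: eq_bigl => a; rewrite andbT.
Qed.

End DirectLimit.

Section TowerMaps.
Variables (R : realType) (B : cstarAlgType R) (S : taf_system R).
Variable iota : forall i, level S i -> B.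
Hypothesis limB : is_AF_limit iota.
Variables x y : forall i, Rows S i.
Hypothesis xy : forall i, row_le (x i) (y i).
Hypothesis step : forall i, ent (phi (munit R (x i) (y i))) (x i.+1) (y i.+1) != 0.
Local Notation E := (image_unit iota).
Local Notation inS := (in_tower x y).
Local Notation phU a b := (phi (munit R a b)).

(** The row that takes the place of [a] in the copy of its block which has its
    corner at [x i.+1], [y i.+1]. *)
Definition next_row i (a : Rows S i) : Rows S i.+1 :=
  odflt (x i.+1) [pick c | ent (phU (x i) a) (x i.+1) c != 0].

Lemma phiM i (a b c : Rows S i) : same_block a b -> same_block b c ->
  phU a c = msum_mul (phU a b) (phU b c).
Proof. by move=> ab bc; rewrite -phi_mul unitM. Qed.

Lemma ph_upper i (a b : Rows S i) c d : row_le a b -> ent (phU a b) c d != 0 ->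
  row_le c d.
Proof.
move=> ab; have /upperP := upper_at limB (leqnSn i) (iota_phiU limB a b) ab.
exact.
Qed.

Lemma ph01 i (a b : Rows S i) c d : same_block a b -> ent (phU a b) c d != 0 ->
  ent (phU a b) c d = 1.
Proof.
by move=> ab nz; have [] := unit_at01 limB (leqnSn i) ab (iota_phiU limB a b) nz.
Qed.

Lemma ph_row i (a b : Rows S i) c d d' : same_block a b -> ent (phU a b) c d != 0 ->
  ent (phU a b) c d' != 0 -> d = d'.
Proof.
move=> ab nz nz'; apply/eqP/negPn/negP => dd'.
have [_ /(_ d)] := unit_at01 limB (leqnSn i) ab (iota_phiU limB a b) nz'.
by move=> /(_ dd') e; rewrite e eqxx in nz.
Qed.

Lemma ph_col i (a b : Rows S i) c c' d : same_block a b -> ent (phU a b) c d != 0 ->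
  ent (phU a b) c' d != 0 -> c = c'.
Proof. by move=> ab; exact: (unit_at_col limB (leqnSn i) ab (iota_phiU limB a b)). Qed.

Lemma next_row_spec i (a : Rows S i) : inS a ->
  ent (phU (x i) a) (x i.+1) (next_row a) != 0 /\ inS (next_row a).
Proof.
move=> /andP[xa ay]; have := step i.
rewrite (phiM (row_le_same xa) (row_le_same ay)) => /entM_neq0[c [nc nc']].
rewrite /next_row; case: pickP => [d nd /=|/(_ c)]; last by rewrite nc.
split=> //; rewrite -(ph_row (row_le_same xa) nc nd) /in_tower.
by rewrite (ph_upper xa nc) (ph_upper ay nc').
Qed.

Lemma next_row_inS i (a : Rows S i) : inS a -> inS (next_row a).
Proof. by case/next_row_spec. Qed.

Lemma next_row_unit i (a b : Rows S i) : inS a -> inS b ->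
  ent (phU a b) (next_row a) (next_row b) != 0.
Proof.
move=> Sa Sb; have [na _] := next_row_spec Sa; have [nb _] := next_row_spec Sb.
have xa : same_block (x i) a by case/andP: Sa => /row_le_same.
move: nb; rewrite (phiM xa (inS_same Sa Sb)) => /entM_neq0[d [nd nd']].
by rewrite (ph_row xa na nd).
Qed.

(** Distinct rows have orthogonal images. *)
Lemma diag_disjoint i (a b : Rows S i) c : ent (phU a a) c c != 0 ->
  ent (phU b b) c c != 0 -> a = b.
Proof.
move=> na nb; apply/eqP/negPn/negP => ab.
have [Pd _] := diag_at limB (leqnSn i) (iota_phiU limB a a).
have : ent (msum_mul (phU a a) (phU b b)) c c = 0.
  by rewrite -phi_mul unitM0 // (phi0 limB) ent0.
rewrite entM (bigD1 c) //= big1 ?addr0 => [|d dc]; last by rewrite Pd ?mul0r // eq_sym.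
by move/eqP; rewrite mulf_eq0 (negPf na) (negPf nb).
Qed.

Lemma next_row_inj i (a b : Rows S i) : inS a -> inS b -> next_row a = next_row b -> a = b.
Proof.
move=> Sa Sb e; apply: (@diag_disjoint i a b (next_row a)); first exact: next_row_unit.
by rewrite e; exact: next_row_unit.
Qed.

Lemma next_row_x i : next_row (x i) = x i.+1.
Proof.
have [nz _] := next_row_spec (inS_x xy i); apply/esym.
have [Pd _] := diag_at limB (leqnSn i) (iota_phiU limB (x i) (x i)).
by apply/eqP/negPn/negP => /Pd e; rewrite e eqxx in nz.
Qed.

Lemma next_row_y i : next_row (y i) = y i.+1.
Proof.
have [nz _] := next_row_spec (inS_y xy i).
exact: (ph_row (row_le_same (xy i)) nz (step i)).
Qed.

(** Between the rows of the tower, [phi z] acts on the image of the previous level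
    as [z] does.  An entry of [z] in a row outside the tower contributes
    nothing: its image factors through row [x i.+1], so it could meet the tower
    only on the diagonal, where the image of an off-diagonal unit vanishes. *)
Lemma next_row_col i (z : level S i) (b : Rows S i) (c : Rows S i.+1) :
  upper_triangular z -> inS b -> inS c ->
  ent (phi z) c (next_row b) = \sum_(a | inS a) (c == next_row a)%:R * ent z a b.
Proof.
move=> /upperP uz Sb Sc; rewrite (phiE limB) [RHS]big_mkcond /=.
apply: eq_bigr => a1 _; rewrite (bigD1 b) //= big1 ?addr0 => [|a2 a2b]; last first.
  have [->|za] := eqVneq (ent z a1 a2) 0; first by rewrite mul0r.
  have [->|] := eqVneq (ent (phU a1 a2) c (next_row b)) 0; first by rewrite mulr0.
  rewrite (phiM (ent_same za) (same_refl a2)) => /entM_neq0[d [_ nd]].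
  have [Pd _] := diag_at limB (leqnSn i) (iota_phiU limB a2 a2).
  have db : d = next_row b by apply/eqP/negPn/negP => /Pd e; rewrite e eqxx in nd.
  have := @diag_disjoint i a2 b (next_row b); rewrite {1}db in nd.
  by move=> /(_ nd (next_row_unit Sb Sb)) e; rewrite e eqxx in a2b.
have [->|za] := eqVneq (ent z a1 b) 0; first by rewrite mul0r mulr0 if_same.
have a1b := uz _ _ za.
case: ifPn => [Sa1|nSa1].
  rewrite mulrC; congr (_ * _); have sab := row_le_same a1b.
  have [->|ca] := eqVneq c (next_row a1); first by rewrite ph01 // next_row_unit.
  apply/eqP/negPn/negP => nz; move/eqP: ca; apply.
  exact: ph_col sab nz (next_row_unit Sa1 Sb).
have xb : row_le (x i) b by case/andP: Sb.
have sax : same_block a1 (x i) by apply: same_trans (row_le_same a1b) _; rewrite same_sym row_le_same.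
have a1x : row_le a1 (x i).
  have /orP[//|xa1] := row_le_total sax.
  by case/negP: nSa1; rewrite /in_tower xa1 (row_le_trans a1b) //; case/andP: Sb.
have na1x : a1 != x i by apply: contraNneq nSa1 => ->; exact: inS_x.
have [->|] := eqVneq (ent (phU a1 b) c (next_row b)) 0; first by rewrite mulr0.
rewrite (phiM sax (row_le_same xb)) => /entM_neq0[d [nd nd']].
have [nb _] := next_row_spec Sb.
have dx : d = x i.+1 by apply: ph_col (row_le_same xb) nd' nb.
subst d; have cx := ph_upper a1x nd.
have xc : row_le (x i.+1) c by case/andP: Sc.
have ce : c = x i.+1 by exact: row_le_anti.
subst c; move: nd.
by rewrite (unit_at_offdiag limB (leqnSn i) sax (iota_phiU limB _ _)) ?eqxx.
Qed.

End TowerMaps.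


(** * The representation attached to a tower *)

Section Tends.
Variables (R : realType) (V : normedZmodType R[i]).

Definition tends (u : nat -> V) (l : V) :=
  forall e : R, 0 < e -> exists N, forall n, (N <= n)%N -> nm (u n - l) < e.

Lemma tends_unique u l l' : tends u l -> tends u l' -> l = l'.
Proof.
move=> h h'; apply/eqP; rewrite -subr_eq0; apply/eqP/nm_small => e e0.
have e2 : 0 < e / 2 by rewrite divr_gt0.
have [N hN] := h _ e2; have [N' hN'] := h' _ e2.
have := hN _ (leq_maxl N N'); have := hN' _ (leq_maxr N N').
have := nm_tri (u (maxn N N')) l l'; rewrite [nm (l - u _)]nmB; lra.
Qed.

Lemma eq_tends u v l : (forall n, u n = v n) -> tends u l -> tends v l.
Proof. by move=> e h d /h[N hN]; exists N => n /hN; rewrite e. Qed.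

Lemma tends_const l (u : nat -> V) r0 : (forall r, (r0 <= r)%N -> u r = l) -> tends u l.
Proof. by move=> h e e0; exists r0 => n /h ->; rewrite subrr nm0. Qed.

End Tends.

Lemma tendsZD (R : realType) (V : normedModType R[i]) (c : R[i]) (u v : nat -> V) l m :
  tends u l -> tends v m -> tends (fun n => c *: u n + v n) (c *: l + m).
Proof.
move=> hu hv e e0; have n1 : 0 < nm c + 1 by have := nm_ge0 c; lra.
have [N hN] := hu (e / 2 / (nm c + 1)) ltac:(by rewrite !divr_gt0).
have [N' hN'] := hv (e / 2) ltac:(by rewrite divr_gt0).
exists (maxn N N') => n; rewrite geq_max => /andP[/hN h /hN' h'].
rewrite opprD addrACA -scalerBr; apply: le_lt_trans (nmD _ _) _.
rewrite [e]splitr; apply: ler_ltD => //; rewrite nmZ.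
by move: h; rewrite ltr_pdivlMr //; have := nm_ge0 (u n - l); nra.
Qed.

Lemma tendsM (R : realType) (B : cstarAlgType R) (u v : nat -> B) l m :
  tends u l -> tends v m -> tends (fun n => u n ∘ v n) (l ∘ m).
Proof.
move=> hu hv e e0; have nl := nm_ge0 l; have n_m := nm_ge0 m.
have D : 0 < nm l + nm m + 1 by lra.
pose d := Num.min 1 (e / 2 / (nm l + nm m + 1)).
have d0 : 0 < d by rewrite lt_min ltr01 !divr_gt0.
have d1 : d <= 1 by rewrite ge_min lexx.
have dD : d * (nm l + nm m + 1) <= e / 2 by rewrite -ler_pdivlMr // ge_min lexx orbT.
have [N hN] := hu d d0; have [N' hN'] := hv d d0.
exists (maxn N N') => n; rewrite geq_max => /andP[/hN h /hN' h'].
have -> : u n ∘ v n - l ∘ m = (u n - l) ∘ v n + l ∘ (v n - m).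
  by rewrite cmulBl cmulBr subrKA.
apply: le_lt_trans (nmD _ _) _.
have := nm_cmul (u n - l) (v n); have := nm_cmul l (v n - m).
have := nm_lebD (v n) m; have := nm_ge0 (v n - m); have := nm_ge0 (u n - l).
have := nm_ge0 (v n).
move: h h'; move: (nm (u n - l)) (nm (v n - m)) (nm (v n)) (nm (_ ∘ _)) (nm (_ ∘ _)).
move=> p q w f g pd qd w0 p0 q0 wle gle fle.
have : f <= d * (nm m + 1) by apply: (le_trans fle); apply: ler_pM => //; lra.
have : g <= nm l * d by apply: (le_trans gle); apply: ler_pM => //; lra.
nra.
Qed.

Section Representation.
Variables (R : realType) (B : cstarAlgType R) (S : taf_system R).
Variable iota : forall i, level S i -> B.
Hypothesis limB : is_AF_limit iota.
Variable A : set B.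
Hypothesis AE : A = closure (\bigcup_i (iota (i := i) @` @upper_triangular R _ _)).
Variables x y : forall i, Rows S i.
Hypothesis xy : forall i, row_le (x i) (y i).
Hypothesis step : forall i, ent (phi (munit R (x i) (y i))) (x i.+1) (y i.+1) != 0.
Local Notation E := (image_unit iota).
Local Notation inS := (in_tower x y).

Let alx i : Rows S i -> Rows S i.+1 := @next_row R S x i.
Let S0 : inS (x 0) := inS_x xy 0.
Let alS i (a : Rows S i) : inS a -> inS (alx a) := @next_row_inS R B S iota limB x y step i a.
Let alI i (a b : Rows S i) : inS a -> inS b -> alx a = alx b -> a = b :=
  @next_row_inj R B S iota limB x y step i a b.

Definition tower_limit : choiceType := @dlim (Rows S) (@in_tower R S x y) (@next_row R S x).
Local Notation H := (l2 R tower_limit).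
Definition pnt r (a : Rows S r) : tower_limit :=
  @pt (Rows S) (@in_tower R S x y) (@next_row R S x) (x 0) S0 r a.
Definition stg r : {fset tower_limit} :=
  @stage (Rows S) (@in_tower R S x y) (@next_row R S x) (x 0) S0 r.

Lemma pnt_al r (a : Rows S r) : inS a -> pnt (alx a) = pnt a.
Proof. exact: pt_al. Qed.

Lemma pnt_inj r (a b : Rows S r) : inS a -> inS b -> pnt a = pnt b -> a = b.
Proof. exact: pt_inj. Qed.

Lemma sum_stg (V : nmodType) r (F : tower_limit -> V) :
  \sum_(t <- stg r) F t = \sum_(a : Rows S r | inS a) F (pnt a).
Proof. exact: sum_stage. Qed.

Definition comb r (c : Rows S r -> R[i]) : H := \sum_(a | inS a) c a *: delta R (pnt a).

Definition coeff r (c : Rows S r -> R[i]) (t : tower_limit) : R[i] :=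
  if [pick a | inS a && (pnt a == t)] is Some a then c a else 0.

Lemma coeffE r (c : Rows S r -> R[i]) a : inS a -> coeff c (pnt a) = c a.
Proof.
move=> Sa; rewrite /coeff; case: pickP => [b /andP[Sb /eqP e]|/(_ a)].
  by rewrite (pnt_inj Sb Sa e).
by rewrite Sa eqxx.
Qed.

Lemma comb_fin r (c : Rows S r -> R[i]) : comb c = fin_l2 (stg r) (coeff c).
Proof. by rewrite fin_l2_sum sum_stg; apply: eq_bigr => a Sa; rewrite coeffE. Qed.

Lemma pnt_stg r (a : Rows S r) : inS a -> pnt a \in stg r.
Proof. by move=> Sa; apply/stageP; exists a. Qed.

Lemma comb_coord r (c : Rows S r -> R[i]) a : inS a -> comb c (pnt a) = c a.
Proof. by move=> Sa; rewrite comb_fin fin_l2E pnt_stg // coeffE. Qed.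

Lemma nm_comb r (c : Rows S r -> R[i]) :
  nm (comb c) ^+ 2 <= \sum_(a | inS a) nm (c a) ^+ 2.
Proof.
rewrite comb_fin; apply: (le_trans (nm_fin _ _)); rewrite /nsq sum_stg.
by apply: ler_sum => a Sa; rewrite coeffE.
Qed.

Lemma comb_ext r (c d : Rows S r -> R[i]) :
  (forall a, inS a -> c a = d a) -> comb c = comb d.
Proof. by move=> cd; apply: eq_bigr => a Sa; rewrite cd. Qed.

(** The compression of [z] to the rows of the tower, as an operator of finite rank
    on the families over the direct limit. *)
Definition op r (z : level S r) (u : H) : H :=
  comb (fun a => \sum_(b | inS b) ent z a b * u (pnt b)).

Definition cut r (u : H) : H := fin_l2 (stg r) u.

Lemma op_linear r (z : level S r) k u v : op z (k *: u + v) = k *: op z u + op z v.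
Proof.
rewrite /op /comb scaler_sumr -big_split; apply: eq_bigr => a _ /=.
rewrite scalerA -scalerDl; congr (_ *: _); rewrite mulr_sumr -big_split.
by apply: eq_bigr => b _ /=; rewrite mulrDr mulrCA.
Qed.

Lemma op_linearl r (z w : level S r) k u : op (k *: z + w) u = k *: op z u + op w u.
Proof.
rewrite /op /comb scaler_sumr -big_split; apply: eq_bigr => a _ /=.
rewrite scalerA -scalerDl; congr (_ *: _); rewrite mulr_sumr -big_split.
by apply: eq_bigr => b _ /=; rewrite entD entZ mulrDl mulrA.
Qed.

Lemma opD r (z : level S r) u v : op z (u + v) = op z u + op z v.
Proof. by rewrite -[u]scale1r op_linear !scale1r. Qed.
Lemma op0 r (z : level S r) : op z 0 = 0.
Proof. by apply: (addrI (op z 0)); rewrite -opD !addr0. Qed.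
Lemma opZ r (z : level S r) k u : op z (k *: u) = k *: op z u.
Proof. by rewrite -[_ *: u]addr0 op_linear op0 addr0. Qed.
Lemma opB r (z : level S r) u v : op z (u - v) = op z u - op z v.
Proof. by rewrite opD -scaleN1r opZ scaleN1r. Qed.
Lemma opBl r (z w : level S r) u : op (z - w) u = op z u - op w u.
Proof. by rewrite addrC -scaleN1r op_linearl scaleN1r addrC. Qed.
Lemma op_sum r (z : level S r) (I : Type) (s : seq I) (P : pred I) (F : I -> H) :
  op z (\sum_(i <- s | P i) F i) = \sum_(i <- s | P i) op z (F i).
Proof. by elim/big_rec2 : _ => [|i u v _ <-]; rewrite ?op0 ?opD. Qed.

(** By the C*-identity the norm of [B] is the Hilbert space norm on the matrices
    with a single column.  Acting on them by [z] bounds the operator norm of the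
    compression ([op_bound]). *)
Definition column r (v : Rows S r -> R[i]) : level S r :=
  \sum_(a | same_block a (y r)) v a *: munit R a (y r).

Lemma ent_column r (v : Rows S r -> R[i]) a b :
  ent (column v) a b = (same_block a (y r) && (b == y r))%:R * v a.
Proof.
rewrite ent_sum; have [say|nsay] := boolP (same_block a (y r)).
  rewrite (bigD1 a) //= entZ ent_unit say eqxx /= mulrC big1 ?addr0 // => c /andP[_ ca].
  by rewrite entZ ent_unit eq_sym (negPf ca) andbF mulr0.
rewrite mul0r big1 // => c sc; rewrite entZ ent_unit; case: eqP => [e|]; rewrite ?andbF ?mulr0 //.
by rewrite e sc in nsay.
Qed.

Lemma nm_column r (v : Rows S r -> R[i]) :
  nm (iota (column v)) ^+ 2 = \sum_(a | same_block a (y r)) nm (v a) ^+ 2.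
Proof.
have e : msum_mul (msum_star (column v)) (column v) =
    ((\sum_(a | same_block a (y r)) nm (v a) ^+ 2)%:C : R[i]) *: munit R (y r) (y r).
  apply: ent_ext => a b; rewrite entM entZ ent_unit same_refl /= rmorph_sum /=.
  have [->|ay] := eqVneq a (y r); last first.
    rewrite mulr0 big1 // => c _.
    by rewrite ent_star ent_column (negPf ay) andbF mul0r conjC0 mul0r.
  have [->|by_] := eqVneq b (y r); last first.
    by rewrite mulr0 big1 // => c _; rewrite [ent _ c b]ent_column (negPf by_) andbF mul0r mulr0.
  rewrite mulr1 [RHS]big_mkcond /=; apply: eq_bigr => c _.
  rewrite ent_star !ent_column eqxx andbT; case: ifP => _; last by rewrite !mul0r mulr0.
  by rewrite !mul1r mulrC mulc_conj.
rewrite -nm_starM -(iotaS limB) -(iotaM limB) e (iotaZ limB) nmZ (nm_E1 limB) ?same_refl //.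
by rewrite mulr1 nm_real ger0_norm // sumr_ge0 // => a _; rewrite exprn_ge0 ?nm_ge0.
Qed.

Lemma mul_column r (z : level S r) v :
  msum_mul z (column v) = column (fun a => \sum_b ent z a b * v b).
Proof.
apply: ent_ext => a c; rewrite entM ent_column mulr_sumr; apply: eq_bigr => b _.
rewrite ent_column mulrCA.
have [->|/ent_same sab] := eqVneq (ent z a b) 0; first by rewrite !(mul0r, mulr0).
by congr ((_ && _)%:R * _); rewrite /same_block (eqP sab).
Qed.

Lemma op_bound r (z : level S r) u : nm (op z u) <= nm (iota z) * nm u.
Proof.
rewrite -(ler_pXn2r (n := 2)) ?nnegrE ?mulr_ge0 ?nm_ge0 //.
apply: (le_trans (nm_comb _)).
pose v (b : Rows S r) : R[i] := if inS b then u (pnt b) else 0.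
have sy a : inS a -> same_block a (y r) by move=> Sa; apply: (inS_same Sa (inS_y xy r)).
have split_same (f : Rows S r -> R) : (forall a, 0 <= f a) ->
    \sum_(a | inS a) f a <= \sum_(a | same_block a (y r)) f a.
  move=> f0; rewrite big_mkcond [leRHS]big_mkcond /=; apply: ler_sum => a _.
  by case: ifP => [/sy ->|_] //; case: ifP.
have vS (w : Rows S r -> R[i]) : \sum_(b | inS b) w b * u (pnt b) = \sum_b w b * v b.
  by rewrite big_mkcond; apply: eq_bigr => b _; rewrite /v; case: ifP => _; rewrite ?mulr0.
apply: (le_trans (split_same _ _)); first by move=> a; rewrite exprn_ge0 ?nm_ge0.
under eq_bigr => a _ do rewrite vS.
rewrite -(nm_column (fun a => \sum_b ent z a b * v b)) -mul_column (iotaM limB).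
apply: (@le_trans _ _ ((nm (iota z) * nm (iota (column v))) ^+ 2)).
  by rewrite ler_pXn2r ?nnegrE ?mulr_ge0 ?nm_ge0 // nm_cmul.
rewrite !exprMn ler_wpM2l ?exprn_ge0 ?nm_ge0 // nm_column.
apply: (le_trans _ (nsq_nm (stg r) u)); rewrite /nsq sum_stg big_mkcond [leRHS]big_mkcond /=.
apply: ler_sum => a _; rewrite /v; case: (inS a); last first.
  by case: ifP => _; rewrite ?nm0 ?expr0n.
by case: ifP => // _; rewrite exprn_ge0 ?nm_ge0.
Qed.

(** A product of non-zero upper triangular entries between two rows of the tower
    passes through a row between them, which is in the tower. *)
Lemma op_mul r (z w : level S r) u : upper_triangular z -> upper_triangular w ->
  op z (op w u) = op (msum_mul z w) u.
Proof.
move=> /upperP uz /upperP uw; apply: comb_ext => a Sa.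
under eq_bigr => b Sb do rewrite comb_coord // mulr_sumr.
rewrite exchange_big /=; apply: eq_bigr => c Sc.
rewrite entM mulr_suml [LHS]big_mkcond /=; apply: eq_bigr => b _.
case: ifPn => [_|nSb]; first by rewrite mulrA.
have [->|/uz ab] := eqVneq (ent z a b) 0; first by rewrite !mul0r.
have [->|/uw bc] := eqVneq (ent w b c) 0; first by rewrite mulr0 mul0r.
by case/negP: nSb; exact: inS_between Sa Sc ab bc.
Qed.

Lemma cutE r u : cut r u = comb (fun a : Rows S r => u (pnt a)).
Proof. by rewrite /cut fin_l2_sum sum_stg. Qed.

Lemma op_cut r (z : level S r) u : op z (cut r u) = op z u.
Proof.
apply: comb_ext => a Sa; apply: eq_bigr => b Sb.
by rewrite /cut fin_l2E pnt_stg.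
Qed.

Lemma op_delta r (z : level S r) b : inS b ->
  op z (delta R (pnt b)) = comb (fun a : Rows S r => ent z a b).
Proof.
move=> Sb; apply: comb_ext => a Sa; rewrite (bigD1 b) // deltaE eqxx mulr1.
rewrite big1 => [|c /andP[Sc cb]]; [by rewrite /= addr0|rewrite deltaE].
by case: eqP => [/(pnt_inj Sc Sb) e|]; rewrite ?mulr0 // e eqxx in cb *.
Qed.

Lemma op_step r (z : level S r) u : upper_triangular z ->
  op (phi z) (cut r u) = op z u.
Proof.
move=> uz; rewrite -(op_cut z) cutE /comb !op_sum; apply: eq_bigr => b Sb.
rewrite !opZ; congr (_ *: _); rewrite -{1}(pnt_al Sb) !op_delta ?alS //.
rewrite /comb; under eq_bigr => c Sc.
  rewrite (next_row_col limB xy step uz Sb Sc) scaler_suml.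
  over.
rewrite exchange_big /=; apply: eq_bigr => a Sa.
rewrite (bigD1 (alx a)) ?alS //= eqxx mul1r pnt_al // big1 ?addr0 // => c /andP[_ ca].
by rewrite (negPf ca) mul0r scale0r.
Qed.

Lemma cut_cut r r' u : (r <= r')%N -> cut r' (cut r u) = cut r u.
Proof.
move=> rr'; apply: l2_ext => t; rewrite !fin_l2E; case: ifPn => // tr'.
case: ifPn => // tr; case/negP: tr'.
by have /fsubsetP := stage_mono S0 alS alI rr'; apply.
Qed.

Lemma op_lift r r' (z : level S r) (z' : level S r') u : (r <= r')%N ->
  upper_triangular z -> iota z' = iota z -> op z' (cut r u) = op z u.
Proof.
move=> rr' uz; elim: r' rr' z' => [|r' IH].
  by rewrite leqn0 => /eqP r0 z'; subst r => /(iota_inj limB) ->; exact: op_cut.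
rewrite leq_eqVlt => /orP[/eqP e z'|].
  by subst r => /(iota_inj limB) ->; exact: op_cut.
rewrite ltnS => rr' z' z'z; have [w [wz uw]] := lift_level limB z rr'.
have -> : z' = phi w by apply: (iota_inj limB); rewrite (iota_phi limB) wz.
rewrite -(cut_cut u rr') (op_step _ (uw uz)); exact: IH.
Qed.

Lemma cut_near u (e : R) : 0 < e -> exists r0, forall r, (r0 <= r)%N ->
  nm (u - cut r u) < e.
Proof.
move=> e0; have [s hs] := fin_cvg u e0.
have [r0 hr] := stage_exhaust S0 alS alI s.
by exists r0 => r /hr; exact: hs.
Qed.

(** One sequence of approximants, chosen to be almost nearest on each level, so
    that it converges without being tied to a modulus. *)
Lemma approx_seq (a : B) : exists zs : forall r, level S r,
  (forall r, upper_triangular (zs r)) /\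
  (A a -> tends (fun r => iota (zs r)) a).
Proof.
pose N r := [set nm (a - iota z) | z in @upper_triangular R _ (msize (t := S) (i := r))].
have infN r : has_inf (N r).
  split; last by exists 0 => _ [z _ <-]; exact: nm_ge0.
  by exists (nm (a - iota (0 : level S r))); exists 0 => // j p q _; rewrite mxE.
have ex r : exists z : level S r, upper_triangular z /\ nm (a - iota z) < inf (N r) + r.+1%:R^-1.
  have [_ [z uz <-] lt] := @inf_adherent R (N r) r.+1%:R^-1 ltac:(by rewrite invr_gt0) (infN r).
  by exists z.
exists (fun r => sval (cid (ex r))); split=> [r|Aa e e0]; first by case: (cid (ex r)) => ? [].
have e2 : 0 < e / 2 by rewrite divr_gt0.
have [r1 h1] := A_approx limB AE Aa e2.
have [r2 _ h2] := near_infty_natSinv_lt (PosNum e2).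
exists (maxn r1 r2) => r; rewrite geq_max => /andP[/h1[w uw aw] /h2 /= re].
case: (cid (ex r)) => z [uz az] /=; rewrite nmB; apply: lt_trans az _.
have : inf (N r) <= nm (a - iota w) by apply: ge_inf; [case: (infN r)|exists w].
by move: (r.+1%:R^-1 : R) re => ? ? ?; lra.
Qed.

Definition approx (a : B) (r : nat) : level S r := sval (cid (approx_seq a)) r.
Arguments approx : clear implicits.

Lemma approx_upper a r : upper_triangular (approx a r).
Proof. by rewrite /approx; case: cid => zs [uz _] /=. Qed.

Lemma approx_tends a : A a -> tends (fun r => iota (approx a r)) a.
Proof. by rewrite /approx; case: cid => zs [_ h] /=. Qed.

(** On the vectors supported by a fixed stage, higher approximants act as lifts of
    the approximant of that stage, up to the distance between them. *)
Lemma op_cvg a u : A a -> exists v : H, tends (fun r => op (approx a r) u) v.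
Proof.
move=> Aa; have ta := approx_tends Aa.
suff h : forall e : R, 0 < e -> exists N, forall m n,
     (N <= m)%N -> (N <= n)%N -> nm (op (approx a m) u - op (approx a n) u) < e.
  have [v /cvg_seqP hv] := cauchy_seq_cvg h; by exists v.
move=> e e0; have halves (p q s : R) : p < e / 2 -> q < e / 2 -> s <= p + q -> s < e by lra.
have nu := nm_ge0 u; have na := nm_ge0 a.
have D1 : 0 < nm u + 1 by lra.
have D2 : 0 < nm a + 1 by lra.
pose e1 := Num.min 1 (e / 8 / (nm u + 1)).
have e10 : 0 < e1 by rewrite lt_min ltr01 !divr_gt0.
have e11 : e1 <= 1 by rewrite ge_min lexx.
have e1u : e1 * (nm u + 1) <= e / 8 by rewrite -ler_pdivlMr // ge_min lexx orbT.
have [N1 h1] := ta e1 e10.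
have [N2 h2] := cut_near u (e := e / 8 / (nm a + 1)) ltac:(by rewrite !divr_gt0).
pose r := maxn N1 N2; have cr := h2 r (leq_maxr _ _).
have ar := h1 r (leq_maxl _ _).
rewrite ltr_pdivlMr // in cr.
have nr : nm (iota (approx a r)) <= nm a + 1 by have := nm_lebD (iota (approx a r)) a; lra.
have near m : (r <= m)%N -> nm (op (approx a m) u - op (approx a r) u) < e / 2.
  move=> rm; have [w [wz uw]] := lift_level limB (approx a r) rm.
  have am := h1 m (leq_trans (leq_maxl _ _) rm).
  have -> : op (approx a m) u - op (approx a r) u = op (approx a m - w) u + op w (u - cut r u).
    by rewrite opBl opB (op_lift u rm (@approx_upper a r) wz) subrKA.
  apply: le_lt_trans (nmD _ _) _.
  have := op_bound (approx a m - w) u; have := op_bound w (u - cut r u).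
  rewrite (iotaB limB) wz; have := nm_tri a (iota (approx a m)) (iota (approx a r)).
  rewrite [nm (a - _)]nmB; have := nm_ge0 (u - cut r u).
  have := nm_ge0 (iota (approx a m) - iota (approx a r)).
  move: am ar cr nr; move: (nm (iota (approx a m) - a)) (nm (iota (approx a r) - a)) => p q.
  move: (nm (iota (approx a m) - iota (approx a r))) (nm (u - cut r u)) (nm (iota (approx a r))) => s t k.
  move: (nm (op (approx a m - w) u)) (nm (op w (u - cut r u))) => f g.
  move=> pe qe te ke s0 t0 sle gle fle.
  have : f <= e / 4.
    by apply: (le_trans fle); have : s * nm u <= (e1 + e1) * (nm u + 1); [apply: ler_pM; lra|lra].
  have : g <= t * (nm a + 1) by apply: (le_trans gle); rewrite mulrC; apply: ler_wpM2l.
  lra.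
exists r => m n /near hm /near hn.
apply: halves hm hn _; rewrite -[nm (op (approx a n) u - _)]nmB.
exact: nm_tri.
Qed.

(** Outside of [A] the value is zero, so that the map is linear in [u] for every
    [a]. *)
Definition rho_fun (a : B) (u : H) : H :=
  if pselect (A a) is left Aa then sval (cid (op_cvg u Aa)) else 0.

Lemma rho_app a u : A a -> tends (fun r => op (approx a r) u) (rho_fun a u).
Proof.
by move=> Aa; rewrite /rho_fun; case: pselect => // Aa'; case: (cid _).
Qed.

(** Frees [rho_fun] from the chosen approximants, so that those of a sum or product
    can be the sums or products of approximants. *)
Lemma rho_tends a (zs : forall r, level S r) u : A a ->
  tends (fun r => iota (zs r)) a -> tends (fun r => op (zs r) u) (rho_fun a u).
Proof.
move=> Aa tz e e0; have ta := approx_tends Aa.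
have D1 : 0 < nm u + 1 by have := nm_ge0 u; lra.
have [N1 h1] := ta (e / 4 / (nm u + 1)) ltac:(by rewrite !divr_gt0).
have [N2 h2] := tz (e / 4 / (nm u + 1)) ltac:(by rewrite !divr_gt0).
have [N3 h3] := rho_app u Aa (e := e / 4) ltac:(by rewrite divr_gt0).
exists (maxn N1 (maxn N2 N3)) => r; rewrite !geq_max => /and3P[/h1 k1 /h2 k2 /h3 k3].
move: k1 k2; rewrite !ltr_pdivlMr // => k1 k2.
have := nm_tri (op (approx a r) u) (op (zs r) u) (rho_fun a u).
have := op_bound (zs r - approx a r) u; rewrite opBl (iotaB limB).
have := nm_tri a (iota (zs r)) (iota (approx a r)); rewrite [nm (a - _)]nmB.
have := nm_ge0 u; have := nm_ge0 (iota (zs r) - iota (approx a r)).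
have := nm_ge0 (iota (zs r) - a); have := nm_ge0 (iota (approx a r) - a).
move: k1 k2 k3; move: (nm (iota (approx a r) - a)) (nm (iota (zs r) - a)) => p q.
move: (nm (iota (zs r) - iota (approx a r))) (nm u) (nm (op (approx a r) u - _)) => s v f.
move: (nm (op (zs r) u - op (approx a r) u)) (nm (op (zs r) u - _)) => g g'.
move=> k1 k2 k3 p0 q0 s0 v0 sle gle g'le.
have : s * v <= (q + p) * v by apply: ler_wpM2r.
lra.
Qed.

Lemma rho_fun_linear a : linear (rho_fun a).
Proof.
move=> c u v; have [Aa|nAa] := pselect (A a); last first.
  by rewrite /rho_fun; case: pselect => // _; rewrite scaler0 addr0.
apply: tends_unique (rho_app _ Aa) _.
apply: eq_tends (tendsZD c (rho_app u Aa) (rho_app v Aa)) => r.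
by rewrite op_linear.
Qed.

HB.instance Definition _ a := GRing.isLinear.Build R[i] H H _ (rho_fun a) (rho_fun_linear a).

Definition tower_rep (a : B) : {linear H -> H} := rho_fun a.
Local Notation rho := tower_rep.

Lemma rho_bound a u : A a -> nm (rho a u) <= nm a * nm u.
Proof.
move=> Aa; apply/ler_addgt0Pr => e e0.
have D1 : 0 < nm u + 1 by have := nm_ge0 u; lra.
have [N1 h1] := approx_tends Aa (e := e / 2 / (nm u + 1)) ltac:(by rewrite !divr_gt0).
have [N2 h2] := rho_app u Aa (e := e / 2) ltac:(by rewrite divr_gt0).
pose r := maxn N1 N2; have k1 := h1 r (leq_maxl _ _); have k2 := h2 r (leq_maxr _ _).
rewrite ltr_pdivlMr // in k1.
have := nm_lebD (rho a u) (op (approx a r) u); rewrite nmB.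
have := op_bound (approx a r) u; have := nm_lebD (iota (approx a r)) a.
have := nm_ge0 u; have := nm_ge0 (iota (approx a r) - a).
move: k1 k2; rewrite -/(rho a u); move: (nm (iota (approx a r) - a)) (nm (op _ _ - _)) => p q.
move: (nm (iota (approx a r))) (nm u) (nm (op _ _)) => s v f k1 k2 p0 v0 sle fle le.
have : s * v <= (nm a + p) * v by apply: ler_wpM2r.
lra.
Qed.

Let AM := A_mul limB AE.

Lemma rho_rep : is_representation A rho.
Proof.
split.
- move=> c a b u Aa Ab.
  have Acab : A (c *: a + b) by case: (A_subspace limB AE) => _; apply.
  have h := tendsZD c (rho_app u Aa) (rho_app u Ab).
  apply: tends_unique h.
  apply: eq_tends (@rho_tends _ (fun r => c *: approx a r + approx b r) u Acab _) => [r|].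
    by rewrite op_linearl.
  by apply: eq_tends (tendsZD c (approx_tends Aa) (approx_tends Ab)) => r; rewrite (iotaZD limB).
- move=> a b u Aa Ab.
  have h := @rho_tends _ (fun r => msum_mul (approx a r) (approx b r)) u (AM Aa Ab).
  have {}h : tends (fun r => op (approx a r) (op (approx b r) u)) (rho (a ∘ b) u).
    apply: eq_tends (h _) => [r|]; first by rewrite op_mul //; exact: approx_upper.
    by apply: eq_tends (tendsM (approx_tends Aa) (approx_tends Ab)) => r; rewrite (iotaM limB).
  apply: tends_unique h _ => e e0.
  have D1 : 0 < nm a + 1 by have := nm_ge0 a; lra.
  have [N1 h1] := approx_tends Aa ltr01.
  have [N2 h2] := rho_app u Ab (e := e / 2 / (nm a + 1)) ltac:(by rewrite !divr_gt0).
  have [N3 h3] := rho_app (rho b u) Aa (e := e / 2) ltac:(by rewrite divr_gt0).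
  exists (maxn N1 (maxn N2 N3)) => r; rewrite !geq_max => /and3P[/h1 k1 /h2 k2 /h3 k3].
  rewrite ltr_pdivlMr // in k2.
  rewrite -/(rho a (rho b u)) in k3; rewrite -/(rho b u) in k2.
  have := nm_tri (op (approx a r) (rho b u)) (op (approx a r) (op (approx b r) u)) (rho a (rho b u)).
  rewrite -opB; have := op_bound (approx a r) (op (approx b r) u - rho b u).
  have := nm_lebD (iota (approx a r)) a; have := nm_ge0 (op (approx b r) u - rho b u).
  move: k1 k2 k3; move: (nm (iota (approx a r) - a)) (nm (op (approx b r) u - _)) => p q.
  move: (nm (op (approx a r) (rho b u) - _)) (nm (iota (approx a r))) => f s.
  move: (nm (op (approx a r) (op (approx b r) u - _))) (nm (op (approx a r) (op (approx b r) u) - _)) => g g'.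
  move=> k1 k2 k3 q0 sle gle g'le.
  have : s * q <= (nm a + 1) * q by apply: ler_wpM2r => //; lra.
  lra.
- exists 1 => a u Aa; rewrite mul1r !nmE -rmorphM lecR; exact: rho_bound.
Qed.

Lemma rho_iota l (z : level S l) u : upper_triangular z ->
  rho (iota z) (cut l u) = op z u.
Proof.
move=> uz; have Az : A (iota z) by exact: (A_iota AE).
have ex r : exists w : level S r, (l <= r)%N -> iota w = iota z.
  have [lr|] := boolP (l <= r)%N; last by exists 0.
  by have [w [e _]] := lift_level limB z lr; exists w.
pose zs r := sval (cid (ex r)).
have zsP r : (l <= r)%N -> iota (zs r) = iota z by rewrite /zs; case: cid.
have := @rho_tends _ zs (cut l u) Az (tends_const zsP).
move/tends_unique; apply; apply: (tends_const (r0 := l)) => r lr.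
by apply: op_lift => //; exact: zsP.
Qed.

(** * Invariant subspaces and kernel of the representation *)

Lemma comb_single r (a : Rows S r) k : inS a ->
  comb (fun c => (c == a)%:R * k) = k *: delta R (pnt a).
Proof.
move=> Sa; rewrite /comb (bigD1 a Sa) eqxx mul1r big1; first exact: addr0.
by move=> c /andP[_ /negPf ->]; rewrite mul0r scale0r.
Qed.

Lemma op_unit r (a b : Rows S r) u : inS a -> inS b ->
  op (munit R a b) u = u (pnt b) *: delta R (pnt a).
Proof.
move=> Sa Sb; rewrite -comb_single //; apply: comb_ext => c _.
rewrite (bigD1 b Sb) big1 => [|d /andP[_ /negPf db]]; last first.
  by rewrite ent_unit db andbF mul0r.
by rewrite ent_unit (inS_same Sa Sb) eqxx andbT /= addr0.
Qed.

Lemma cut_delta r (a : Rows S r) : inS a -> cut r (delta R (pnt a)) = delta R (pnt a).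
Proof.
move=> Sa; apply: l2_ext => t; rewrite fin_l2E; case: ifPn => // nt.
by rewrite deltaE; case: eqP => // e; rewrite e pnt_stg in nt.
Qed.

Lemma pnt_surj t : exists r0, forall r, (r0 <= r)%N ->
  exists2 a : Rows S r, inS a & t = pnt a.
Proof. exact: (pt_surj S0 alS). Qed.

Lemma pnt_pair t t' : exists r (a a' : Rows S r),
  [/\ inS a, inS a', t = pnt a & t' = pnt a'].
Proof.
have [r1 h1] := pnt_surj t; have [r2 h2] := pnt_surj t'.
have [a Sa ta] := h1 _ (leq_maxl r1 r2); have [a' Sa' ta'] := h2 _ (leq_maxr r1 r2).
by exists (maxn r1 r2), a, a'.
Qed.

Lemma pnt_x r : pnt (x r) = pnt (x 0).
Proof.
elim: r => // r <-; rewrite -(next_row_x limB xy step r).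
exact: pnt_al (inS_x xy r).
Qed.

Lemma pnt_y r : pnt (y r) = pnt (y 0).
Proof.
elim: r => // r <-; rewrite -(next_row_y limB xy step r).
exact: pnt_al (inS_y xy r).
Qed.

Section InvariantSubspace.
Variable M : set H.
Hypothesis LM : Lat A rho M.

Let MZD c u v : M u -> M v -> M (c *: u + v).
Proof. by case: LM => -[_ h] _ _; exact: h. Qed.
Let M0 : M 0. Proof. by case: LM => -[]. Qed.
Let MZ c u : M u -> M (c *: u).
Proof. by move=> Mu; rewrite -[_ *: _]addr0; exact: MZD. Qed.

(** The diagonal unit of the row of [t] on a high level isolates the coordinate
    [t] of [u], up to the part of [u] outside of the stage. *)
Lemma Lat_delta (u : H) t : M u -> u t != 0 -> M (delta R t).
Proof.
move=> Mu ut; have [_ cM inv] := LM.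
rewrite -[delta R t]scale1r -(mulVf ut) -scalerA; apply: MZ.
apply: (closed_nm cM) => e e0; have [r1 h1] := cut_near u e0.
have [r2 h2] := pnt_surj t; pose r := maxn r1 r2.
have [a Sa ta] := h2 r (leq_maxr _ _); have near := h1 r (leq_maxl _ _).
have Ea : A (E a a) by apply: (A_E AE); exact: row_le_refl.
exists (rho (E a a) u); first exact: inv.
have -> : u t *: delta R t = rho (E a a) (cut r u).
  by rewrite ta -(op_unit u Sa Sa); exact/esym/rho_iota/unit_upper/row_le_refl.
rewrite -linearB; apply: le_lt_trans near.
have := rho_bound (cut r u - u) Ea; rewrite [nm (cut r u - u)]nmB.
by have := nm_E limB a a; have := nm_ge0 (u - cut r u); nra.
Qed.

Lemma Lat_down r (a a' : Rows S r) : inS a -> inS a' -> row_le a a' ->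
  M (delta R (pnt a')) -> M (delta R (pnt a)).
Proof.
move=> Sa Sa' aa' Ma'; have [_ _ inv] := LM.
have <- : rho (E a a') (delta R (pnt a')) = delta R (pnt a).
  have e := rho_iota (delta R (pnt a')) (unit_upper R aa').
  rewrite cut_delta // op_unit // deltaE eqxx scale1r in e; exact: e.
exact: inv (A_E AE aa') Ma'.
Qed.

Lemma Lat_full (u : H) : (forall t, u t != 0 -> M (delta R t)) -> M u.
Proof.
move=> h; have [_ cM _] := LM; apply: (closed_nm cM) => e /(cut_near u)[r hr].
exists (cut r u); last exact: hr.
rewrite cutE /comb; elim/big_rec : _ => // a v _ Mv.
have [->|/h Ma] := eqVneq (u (pnt a)) 0; first by rewrite scale0r add0r.
exact: MZD.
Qed.

Lemma Lat_min t : M (delta R t) -> M (delta R (pnt (x 0))).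
Proof.
have [r h] := pnt_surj t; have [a Sa ->] := h r (leqnn r).
rewrite -(pnt_x r); apply: Lat_down => //; first exact: inS_x.
by case/andP: Sa.
Qed.

Lemma Lat_max : M (delta R (pnt (y 0))) -> forall u, M u.
Proof.
move=> My u; apply: Lat_full => t _.
have [r h] := pnt_surj t; have [a Sa ->] := h r (leqnn r).
move: My; rewrite -(pnt_y r); apply: Lat_down => //; first exact: inS_y.
by case/andP: Sa.
Qed.

End InvariantSubspace.

(** An invariant subspace is determined by the basis vectors it contains
    ([Lat_delta], [Lat_full]), and those form an initial segment ([Lat_down]). *)
Lemma Lat_linear : linearly_ordered (Lat A rho).
Proof.
move=> L M LL LM; have [|nLM] := pselect (L `<=` M); [by left|right].
have [t Lt nMt] : exists2 t, L (delta R t) & ~ M (delta R t).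
  apply: contrapT => none; apply: nLM => u Lu; apply: (Lat_full LM) => t ut.
  apply: contrapT => nMt; apply: none; exists t => //; exact: Lat_delta ut.
move=> u Mu; apply: (Lat_full LL) => t' ut'.
have Mt' := Lat_delta LM Mu ut'.
have [r [a [a' [Sa Sa' ta ta']]]] := pnt_pair t t'.
have /orP[aa'|a'a] := row_le_total (inS_same Sa Sa').
  by case: nMt; rewrite ta; apply: (Lat_down LM Sa Sa' aa'); rewrite -ta'.
by rewrite ta'; apply: (Lat_down LL Sa' Sa a'a); rewrite -ta.
Qed.

Variable J : set B.
Hypothesis idJ : is_ideal A J.
Hypothesis notJ : forall i, ~ J (E (x i) (y i)).
Hypothesis cof : forall I, is_ideal A I -> J `<=` I -> ~ I `<=` J ->
  forall i, I (E (x i) (y i)).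

(** A large entry of [z] between rows of the tower would put the unit of the tower
    close to [J] after compression and rescaling. *)
Lemma entry_small b r (z : level S r) (d : R) a a' : J b -> 0 < d ->
  upper_triangular z ->
  nm (b - iota z) <= d -> inS a -> inS a' -> nm (ent z a a') <= 4 * d.
Proof.
move=> Jb d0 /upperP uz bz Sa Sa'; rewrite leNgt; apply/negP => big.
have nz : ent z a a' != 0.
  by apply: contraTneq big => ->; rewrite nm0 -leNgt mulr_ge0 // ltW.
have aa' := uz _ _ nz.
have xa : row_le (x r) a by case/andP: Sa.
have ay : row_le a' (y r) by case/andP: Sa'.
apply: (@notJ r); pose la := ent z a a'.
pose w := E (x r) a ∘ b ∘ E a' (y r).
have Jw : J w.
  by apply: (idealMr idJ); [exact: (A_E AE)|apply: (idealMl idJ) => //; exact: (A_E AE)].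
apply: (unit_in_ideal limB AE idJ (y := la^-1 *: w)) => //; first exact: (idealZ idJ).
have -> : E (x r) (y r) - la^-1 *: w = la^-1 *: (la *: E (x r) (y r) - w).
  by rewrite scalerBr scalerA mulVf // scale1r.
rewrite nmZ nmV mulrC ler_pdivrMr; last by apply: lt_trans big; rewrite mulr_gt0.
apply: (@le_trans _ _ d); last by rewrite /la; lra.
rewrite -(E_compress limB z (row_le_same xa) (row_le_same ay)) /w -cmulBl -cmulBr.
by rewrite -nmB in bz; exact: le_trans (nm_cut limB _ _ _ _ _) bz.
Qed.

Lemma rho_J b u : J b -> rho b u = 0.
Proof.
move=> Jb; have Ab := ideal_sub idJ Jb.
have rho_delta t : rho b (delta R t) = 0.
  apply: l2_ext => t'; apply: nm_small => e e0.
  have [r1 h1] := approx_tends Ab (e := e / 8) ltac:(by rewrite divr_gt0).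
  have [r2 h2] := rho_app (delta R t) Ab (e := e / 2) ltac:(by rewrite divr_gt0).
  have [r3 h3] := pnt_surj t; have [r4 h4] := pnt_surj t'.
  pose r := maxn (maxn r1 r2) (maxn r3 r4).
  have [a' Sa' ta'] := h3 r ltac:(by rewrite !leq_max leqnn !orbT).
  have [a Sa ta] := h4 r ltac:(by rewrite !leq_max leqnn !orbT).
  have k1 := h1 r ltac:(by rewrite !leq_max leqnn).
  have k2 := h2 r ltac:(by rewrite !leq_max leqnn !orbT).
  have e8 : 0 < e / 8 by rewrite divr_gt0.
  rewrite nmB in k1.
  have small := entry_small Jb e8 (@approx_upper b r) (ltW k1) Sa Sa'.
  have coord : op (approx b r) (delta R t) t' = ent (approx b r) a a'.
    by rewrite ta' op_delta // ta comb_coord.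
  have := nm_coord (op (approx b r) (delta R t) - rho b (delta R t)) t'.
  rewrite l2D l2N coord.
  have := nm_lebD (rho b (delta R t) t') (ent (approx b r) a a').
  rewrite [nm (_ - ent _ _ _)]nmB; move: k2; rewrite -/(rho b _); lra.
apply: nm_small => e e0.
have D1 : 0 < nm b + 1 by have := nm_ge0 b; lra.
have [r /(_ r (leqnn r))] := cut_near u (e := e / (nm b + 1)) ltac:(by rewrite divr_gt0).
rewrite ltr_pdivlMr // => near.
have cut0 : rho b (cut r u) = 0.
  by rewrite cutE /comb linear_sum big1 // => a _; rewrite linearZ /= rho_delta scaler0.
have := rho_bound (u - cut r u) Ab; rewrite linearB /= cut0 subr0.
by have := nm_ge0 (u - cut r u); nra.
Qed.

(** On every level the unit has in the tower the single entry at the corner, by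
    [corner_ent] and [corner_only], and the corners are the points [x 0], [y 0]
    of the limit. *)
Lemma rho_corner u :
  rho (E (x 0) (y 0)) u = u (pnt (y 0)) *: delta R (pnt (x 0)).
Proof.
have Au : A (E (x 0) (y 0)) by apply: (A_E AE).
have ex r : exists w : level S r, iota w = E (x 0) (y 0).
  by have [w [e _]] := lift_level limB (munit R (x 0) (y 0)) (leq0n r); exists w.
pose zs r := sval (cid (ex r)).
have zsP r : iota (zs r) = E (x 0) (y 0) by rewrite /zs; case: cid.
have := @rho_tends _ zs u Au (tends_const (r0 := 0%N) (fun r _ => zsP r)).
move/tends_unique; apply; apply: (tends_const (r0 := 0%N)) => r _.
rewrite -(op_unit u (inS_x xy 0) (inS_y xy 0)).
have -> : op (munit R (x 0) (y 0)) u = op (munit R (x r) (y r)) u.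
  rewrite (op_unit u (inS_x xy 0) (inS_y xy 0)).
  by rewrite (op_unit u (inS_x xy r) (inS_y xy r)) (pnt_x r) (pnt_y r).
apply: comb_ext => a Sa; apply: eq_bigr => b Sb; congr (_ * _).
rewrite ent_unit (row_le_same (xy r)) /=.
have only := corner_only limB AE xy step idJ notJ cof (leq0n r) (zsP r) Sa Sb.
have c1 := corner_ent limB xy step (leq0n r) (zsP r).
have [nz|] := boolP (ent (zs r) a b != 0).
  by have [-> ->] := only nz; rewrite !eqxx.
rewrite negbK => /eqP z0; rewrite z0; case: eqP => //= ax; case: eqP => //= bY.
by move/eqP: z0; rewrite ax bY c1 oner_eq0.
Qed.

Let x0 := pnt (x 0).
Let y0 := pnt (y 0).

(** Upper triangular matrices move the support of a vector downwards. *)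
Lemma vanish_Lat (Q : set tower_limit) :
  (forall r (b b' : Rows S r), inS b -> inS b' -> row_le b b' ->
     Q (pnt b) -> Q (pnt b')) ->
  Lat A rho [set u | forall t, Q t -> u t = 0].
Proof.
move=> up; split.
- split=> [t _|c u v hu hv t Qt]; first exact: l20.
  by rewrite l2D l2Z hu // hv // mulr0 addr0.
- apply: nm_closed => u cl t Qt; apply: nm_small => e /cl[v /(_ _ Qt) v0 uv].
  by have := nm_coord (u - v) t; rewrite l2D l2N v0 subr0; lra.
- move=> a u Aa hu t Qt; apply: nm_small => e e0.
  have [r1 h1] := rho_app u Aa e0; have [r2 h2] := pnt_surj t.
  have k1 := h1 _ (leq_maxl r1 r2); have [b Sb tb] := h2 _ (leq_maxr r1 r2).
  have z : op (approx a (maxn r1 r2)) u t = 0.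
    rewrite tb comb_coord // big1 // => b' Sb'.
    have [->|nz] := eqVneq (ent (approx a (maxn r1 r2)) b b') 0; first by rewrite mul0r.
    have /upperP/(_ _ _ nz) bb' := @approx_upper a (maxn r1 r2).
    by rewrite hu ?mulr0 //; apply: up bb' _ => //; rewrite -tb.
  have := nm_coord (op (approx a (maxn r1 r2)) u - rho a u) t.
  rewrite l2D l2N z sub0r nmN; move: k1; rewrite -/(rho a u); lra.
Qed.

Lemma lineP t0 (u : H) : line (delta R t0) u <-> forall t, t <> t0 -> u t = 0.
Proof.
split=> [[k _ <-] t /eqP/negPf tt0|h]; first by rewrite l2Z deltaE tt0 mulr0.
exists (u t0) => //; apply: l2_ext => t; rewrite l2Z deltaE.
by have [->|/eqP/h ->] := eqVneq t t0; rewrite ?mulr1 ?mulr0.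
Qed.

Lemma zero_plus_rho : zero_plus (Lat A rho) = line (delta R x0).
Proof.
have lineE : line (delta R x0) = [set u : H | forall t, t <> x0 -> u t = 0].
  by apply/seteqP; split=> u /lineP.
have Ll : Lat A rho (line (delta R x0)).
  rewrite lineE; apply: vanish_Lat => r b b' Sb Sb' bb' nb e; apply: nb.
  rewrite /x0 -(pnt_x r) in e *; move/(pnt_inj Sb' (inS_x xy r)): e => e.
  congr (pnt _); apply: row_le_anti; first by rewrite -e.
  by case/andP: Sb.
have nl : line (delta R x0) <> [set 0].
  move=> e; have : line (delta R x0) (delta R x0) by exists 1; rewrite ?scale1r.
  by rewrite e => /eqP; rewrite (negPf (delta_neq0 R x0)).
have ml L : Lat A rho L -> L <> [set 0] -> line (delta R x0) `<=` L.
  move=> LL L0; have [u Lu u0] : exists2 u, L u & u <> 0.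
    apply: contrapT => none; apply: L0; apply/seteqP; split=> [u Lu|_ ->].
      by apply: contrapT => u0; apply: none; exists u.
    by case: LL => -[].
  have [t ut] : exists t, u t != 0.
    apply: contrapT => none; apply: u0; apply: l2_ext => t; rewrite l20.
    by apply/eqP/negPn/negP => ut; apply: none; exists t.
  have Lx := Lat_min LL (Lat_delta LL Lu ut).
  by move=> _ [k _ <-]; rewrite -[_ *: _]addr0; case: LL => -[L00 LZD] _ _; exact: LZD.
rewrite /zero_plus; set P := [set M | _].
have Pl : P (line (delta R x0)) by [].
have [LZ nZ mZ] := xgetPex [set 0] (ex_intro _ _ Pl).
by apply/seteqP; split; [exact: mZ|exact: ml].
Qed.

Lemma I_minus_rho : I_minus (Lat A rho) = [set u : H | u y0 = 0].
Proof.
set K := [set u : H | _].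
have LK : Lat A rho K.
  have -> : K = [set u : H | forall t, t = y0 -> u t = 0].
    by apply/seteqP; split=> [u Ku t ->|u]; [|apply].
  apply: vanish_Lat => r b b' Sb Sb' bb' e.
  rewrite /y0 -(pnt_y r) in e *; move/(pnt_inj Sb (inS_y xy r)): e => e.
  congr (pnt _); apply: row_le_anti; last by rewrite -e.
  by case/andP: Sb'.
have nK : K <> setT.
  move=> e; have Ky : K (delta R y0) by rewrite e.
  have {Ky} : delta R y0 y0 = 0 := Ky.
  by rewrite deltaE eqxx => /eqP; rewrite oner_eq0.
have mK L : Lat A rho L -> L <> setT -> L `<=` K.
  move=> LL LT u Lu; rewrite /K /=; apply/eqP/negPn/negP => uy; apply: LT.
  by apply/seteqP; split=> // v _; apply: (Lat_max LL (Lat_delta LL Lu uy)).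
rewrite /I_minus; set P := [set M | _].
have PK : P K by [].
have [LZ nZ mZ] := xgetPex setT (ex_intro _ _ PK).
by apply/seteqP; split; [exact: mK|exact: mZ].
Qed.

Lemma orthogonal_rho :
  orthogonal_complement (I_minus (Lat A rho)) = line (delta R y0).
Proof.
rewrite I_minus_rho; apply/seteqP; split=> [v hv|_ [k _ <-] u /= uy].
  apply/lineP => t ty; have dt : delta R t y0 = 0.
    by rewrite deltaE; case: eqP => // e; case: ty.
  by rewrite -hdot_delta hdotC (hv _ dt) conjC0.
by rewrite linearZr_LR /= hdot_delta uy mulr0.
Qed.

Lemma rho_essential : essential_nest_representation A rho.
Proof.
split.
- by split; [exact: rho_rep|exact: Lat_linear].
- by rewrite zero_plus_rho; exists (delta R x0) => //; exact: delta_neq0.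
- by rewrite orthogonal_rho; exists (delta R y0) => //; exact: delta_neq0.
exists (delta R x0), (delta R y0); split; [exact: zero_plus_rho|exact: orthogonal_rho|].
exists (E (x 0) (y 0)); first exact: (A_E AE).
by move=> u; rewrite hdot_delta rho_corner.
Qed.

Lemma rho_kernel : J = rep_kernel A rho.
Proof.
have JK : J `<=` rep_kernel A rho.
  by move=> b Jb; split=> [|u]; [exact: (ideal_sub idJ)|exact: rho_J].
apply/seteqP; split=> //; apply: contrapT => nKJ.
have := cof (rep_kernel_ideal limB AE rho_rep) JK nKJ 0 => -[_ /(_ (delta R y0))].
rewrite rho_corner deltaE eqxx scale1r => /eqP.
by rewrite (negPf (delta_neq0 R x0)).
Qed.

End Representation.


(** * Completely meet irreducible ideals as kernels *)

Section Shift.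
Variables (R : realType) (S : taf_system R) (l : nat).

(** The system without its first [l] levels: it lets a tower start on level 0. *)
Definition shift_system : taf_system R := @TafSystem R
  (fun i => summands S (i + l)) (fun i => msize (t := S) (i := i + l))
  (fun i => msize_gt0 (t := S) (i := i + l)) (fun i => phi (t := S) (i := i + l))
  (fun i => phi_linear (t := S) (i := i + l)) (fun i => phi_mul (t := S) (i := i + l))
  (fun i => phi_star (t := S) (i := i + l)) (fun i => phi_inj (t := S) (i := i + l))
  (fun i => phi_upper (t := S) (i := i + l)) (fun i => phi_regular (t := S) (i := i + l)).

Variables (B : cstarAlgType R) (iota : forall i, level S i -> B).
Hypothesis limB : is_AF_limit iota.

Definition shift_iota (i : nat) : level shift_system i -> B := @iota (i + l)%N.

Lemma shift_limit : is_AF_limit shift_iota.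
Proof.
split=> [i|i|i|i|i z|].
- exact: (iota_linear limB).
- exact: (iota_mul limB).
- exact: (iota_star limB).
- exact: (iota_inj limB).
- exact: (iota_phi limB).
apply/seteqP; split=> // b _.
have : closure (\bigcup_i range (@iota i)) b by rewrite (iota_dense limB).
apply: closureS => _ [i _ [z _ <-]]; exists i => //.
by have [w [wz _]] := lift_level limB z (leq_addr l i); exists w.
Qed.

Lemma shift_algebra :
  closure (\bigcup_i (iota (i := i) @` @upper_triangular R _ _)) =
  closure (\bigcup_i (shift_iota (i := i) @` @upper_triangular R _ _)).
Proof.
apply/seteqP; split; apply: closureS => _ [i _ [z uz <-]]; last by exists (i + l)%N => //; exists z.
exists i => //; have [w [wz uw]] := lift_level limB z (leq_addr l i).
by exists w => //; exact: uw.
Qed.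

End Shift.

Section Towers.
Variables (R : realType) (B : cstarAlgType R) (S : taf_system R).
Variable iota : forall i, level S i -> B.
Hypothesis limB : is_AF_limit iota.
Variable A : set B.
Hypothesis AE : A = closure (\bigcup_i (iota (i := i) @` @upper_triangular R _ _)).
Local Notation E := (image_unit iota).
Variable J : set B.
Hypothesis idJ : is_ideal A J.

Definition alive_pair i := {p : Rows S i * Rows S i | row_le p.1 p.2 /\ ~ J (E p.1 p.2)}.

(** If all summands of the image of a unit were in [J], so would be the unit. *)
Lemma next_pair i (p : alive_pair i) : exists q : alive_pair i.+1,
  ent (phi (munit R (sval p).1 (sval p).2)) (sval q).1 (sval q).2 != 0.
Proof.
case: p => -[a b] /= [ab nJ].
have uph := upper_at limB (leqnSn i) (iota_phiU limB a b) ab.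
apply: contrapT => none; apply: nJ; rewrite -(iota_phiU limB) (iota_decomp limB).
apply: (ideal_sum idJ) => c _; apply: (ideal_sum idJ) => d _.
have [->|nz] := eqVneq (ent (phi (munit R a b)) c d) 0.
  by rewrite scale0r; exact: (ideal0 idJ).
apply: (idealZ idJ); apply: contrapT => nJ; apply: none.
have cd : row_le c d by move/upperP: uph; apply.
by exists (exist _ (c, d) (conj cd nJ)).
Qed.

Fixpoint alive_tower (p0 : alive_pair 0) i : alive_pair i :=
  match i with
  | 0 => p0
  | j.+1 => sval (cid (next_pair (alive_tower p0 j)))
  end.

Lemma alive_tower_step p0 i :
  ent (phi (munit R (sval (alive_tower p0 i)).1 (sval (alive_tower p0 i)).2))
    (sval (alive_tower p0 i.+1)).1 (sval (alive_tower p0 i.+1)).2 != 0.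
Proof. by rewrite /=; case: cid. Qed.

Lemma successor_kernel (p0 : alive_pair 0) :
  (forall I, is_ideal A I -> J `<=` I -> ~ I `<=` J -> I (E (sval p0).1 (sval p0).2)) ->
  exists (H : hilbertType R) (rho : B -> {linear H -> H}),
    essential_nest_representation A rho /\ J = rep_kernel A rho.
Proof.
move=> succ; pose t i := alive_tower p0 i.
pose x i := (sval (t i)).1; pose y i := (sval (t i)).2.
have xy i : row_le (x i) (y i) by case: (svalP (t i)).
have notJ i : ~ J (E (x i) (y i)) by case: (svalP (t i)).
have step i : ent (phi (munit R (x i) (y i))) (x i.+1) (y i.+1) != 0.
  exact: alive_tower_step.
have cof I : is_ideal A I -> J `<=` I -> ~ I `<=` J -> forall i, I (E (x i) (y i)).
  move=> idI JI nIJ; elim=> [|i IH]; first exact: succ.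
  have -> : E (x i.+1) (y i.+1) =
      E (x i.+1) (x i.+1) ∘ E (x i) (y i) ∘ E (y i.+1) (y i.+1).
    rewrite -[E (x i) (y i)](iota_phiU limB) (E_compress limB) ?same_refl //.
    have [-> _] := unit_at01 limB (leqnSn i) (row_le_same (xy i)) (iota_phiU limB _ _) (step i).
    by rewrite scale1r.
  have Ad (c : Rows S i.+1) : A (E c c) by apply: (A_E AE); exact: row_le_refl.
  by apply: (idealMr idI) => //; apply: (idealMl idI).
exists (l2 R (tower_limit x y)), (tower_rep limB AE xy step); split.
  exact: (rho_essential limB AE xy step idJ notJ cof).
exact: (rho_kernel limB AE xy step idJ notJ cof).
Qed.

End Towers.

(** The intersection [J'] of the ideals strictly above [J] is itself strictly above
    [J], so [ideal_units] gives a matrix unit in [J'] and not in [J]. *)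
Theorem cmi_essential_kernel (R : realType) (B : cstarAlgType R) (A J : set B) :
  strongly_maximal_TAF A -> is_ideal A J -> completely_meet_irreducible A J ->
  exists (H : hilbertType R) (rho : B -> {linear H -> H}),
    essential_nest_representation A rho /\ J = rep_kernel A rho.
Proof.
move=> [S [iota [limB AE]]] idJ [_ cmi].
pose F := [set I | [/\ is_ideal A I, J `<=` I & ~ I `<=` J]].
pose J' := A `&` \bigcap_(I in F) I.
have idJ' : is_ideal A J'.
  have [A0 AD] := A_subspace limB AE.
  split=> [b []//||b clb|a b Aa [Ab hb]].
  - split; first by split=> // I [idI _ _]; exact: (ideal0 idI).
    move=> c u v [Au hu] [Av hv]; split; first exact: AD.
    by move=> I FI; have [idI _ _] := FI; apply: (idealZD idI); [exact: hu|exact: hv].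
  - split; first by apply: (A_closed AE); apply: closureS clb => ? [].
    move=> I FI; have [idI _ _] := FI; apply: (ideal_closed idI).
    by apply: closureS clb => ? [_]; exact.
  - split; (split; first exact: (A_mul limB AE)) => I FI; have [idI _ _] := FI.
      by apply: (idealMl idI) => //; exact: hb.
    by apply: (idealMr idI) => //; exact: hb.
have JJ' : J `<=` J'.
  by move=> b Jb; split=> [|I [_ JI _]]; [exact: (ideal_sub idJ)|exact: JI].
have nJ'J : ~ J' `<=` J.
  move=> J'J; have [_ _] : F J; last by apply.
  by apply: cmi => [I [idI JI _]|]; [split|apply/seteqP].
have [r [a [b [ab J'ab nJab]]]] : exists r (a b : Rows S r),
    [/\ row_le a b, J' (image_unit iota a b) & ~ J (image_unit iota a b)].
  apply: contrapT => none; apply: nJ'J; apply: (ideal_units limB AE idJ' idJ).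
  move=> r a b ab J'ab; apply: contrapT => nJab; apply: none.
  by exists r, a, b.
have limB' := shift_limit r limB; rewrite (shift_algebra r limB) in AE.
pose p0 : alive_pair (@shift_iota _ _ r _ iota) J 0 := exist _ (a, b) (conj ab nJab).
apply: (successor_kernel limB' AE idJ (p0 := p0)) => I idI JI nIJ.
by case: J'ab => _; exact.
Qed.

Theorem corollary2p5 (R : realType) (B : cstarAlgType R) (A : set B)
  (hA : strongly_maximal_TAF A) (J : set B) (hJ : is_ideal A J) :
  completely_meet_irreducible A J <->
  exists (H : hilbertType R) (rho : B -> {linear H -> H}),
    essential_nest_representation A rho /\ J = rep_kernel A rho.
Proof.
split=> [|[H [rho [ess JE]]]]; first exact: cmi_essential_kernel.
exact: essential_kernel_cmi ess JE.
Qed.
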